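(* For every positive integer $N$, $$v_3(T(N))=N\Bigl(\log_3 2-\frac12\Bigr)+N\,\Phi(\log_3 N),$$ where $$\Phi(x)=\sum_{k\in\mathbb{Z}\setminus\{0\}}c_k e^{2k\pi i x}$$ is a $1$-periodic continuous function on $\mathbb{R}$ with Fourier coefficients $$c_k=\frac{2(1-2^{\chi_k})\,\zeta(\chi_k)}{\chi_k(1+\chi_k)\log 3},\qquad \chi_k=\frac{2k\pi i}{\log 3}\qquad (k\in\mathbb{Z}\setminus\{0\}).$$
   Context: For a positive integer $N$, $T(N)=\prod_{j=0}^{N-1}\frac{(3j+1)!}{(N+j)!}$ (the number of $N\times N$ alternating sign matrices, a positive integer). For a positive integer $m$, $v_3(m)$ is the $3$-adic valuation, i.e. the largest $k$ such that $3^k$ divides $m$. $\log$ is the natural logarithm, $\log_3 x=\log x/\log 3$, $2^{z}=e^{z\log 2}$, and $\zeta$ is the (analytically continued) Riemann zeta function. *)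

(* Defs.v *)
From mathcomp Require Import all_boot.
From Stdlib Require Import Reals ZArith List.
From Coquelicot Require Import Coquelicot.

(* T(N).  The quotient of the two products is exact: it is the number of
   N x N alternating sign matrices, so the truncated division loses nothing. *)
Definition asm_number (N : nat) : nat :=
  ((\prod_(j < N) (3 * j + 1)`!) %/ (\prod_(j < N) (N + j)`!))%nat.

Local Open Scope R_scope.

Definition log3 (x : R) : R := ln x / ln 3.

Definition Cexp (z : C) : C := (exp (Re z) * cos (Im z), exp (Re z) * sin (Im z)).

Local Open Scope C_scope.

(* x^z = e^{z log x}; meaningful for x > 0 only. *)
Definition Rcpow (x : R) (z : C) : C := Cexp (z * RtoC (ln x)).

Definition analytic_at (f : C -> C) (s : C) : Prop :=
  exists (r : posreal) (a : nat -> C),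
    forall z : C, (Cmod (z - s)%C < r)%R ->
      @is_pseries C_AbsRing C_NormedModule a (z - s) (f z).

(* The analytic continuation of sum_{n >= 1} n^{-s} from Re s > 1 to C \ {1}.
   By the identity theorem this determines zeta on the connected set C \ {1};
   the value at the pole 1 is left unconstrained. *)
Definition is_riemann_zeta (zeta : C -> C) : Prop :=
  (forall s : C, (1 < Re s)%R ->
     @is_series C_AbsRing C_NormedModule
       (fun n : nat => Rcpow (INR n.+1) (- s)) (zeta s)) /\
  (forall s : C, s <> RtoC 1 -> analytic_at zeta s).

(* Unordered (equivalently, absolutely convergent) summation over Z \ {0}:
   convergence of the net of finite partial sums. *)
Definition is_sum_nonzeroZ (a : Z -> C) (l : C) : Prop :=
  forall eps : posreal, exists F0 : list Z,
    ~ In 0%Z F0 /\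
    forall F : list Z, NoDup F -> ~ In 0%Z F -> incl F0 F ->
      (Cmod (fold_right (fun (k : Z) (acc : C) => a k + acc)%C (RtoC 0) F - l)%C < eps)%R.

Definition fourier_char (k : Z) (x : R) : C :=
  Cexp (RtoC (2 * IZR k * PI * x)%R * Ci).

Definition chi (k : Z) : C := RtoC (2 * IZR k * PI)%R * Ci / RtoC (ln 3).

Definition coef (zeta : C -> C) (k : Z) : C :=
  (RtoC 2 * (RtoC 1 - Rcpow 2 (chi k)) * zeta (chi k)) /
  (chi k * (RtoC 1 + chi k) * RtoC (ln 3)).

Definition is_fourier_coef (f : R -> C) (k : Z) (c : C) : Prop :=
  @is_RInt C_R_NormedModule (fun x : R => f x * fourier_char (- k) x) 0%R 1%R c.

(* Main.v *)
Require Import Defs.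
From mathcomp Require Import all_boot.
From Stdlib Require Import Reals ZArith List.
From Coquelicot Require Import Coquelicot.
From mathcomp Require Import zify.
From Stdlib Require Import Lra Lia Permutation.

(* Write b(y) = f(1 - f)/2 with f the fractional part of y, so that
   P(y) = (y^2 - y)/2 + b(y) is the integral of the floor function over [0, y].
   Legendre's formula gives
     v_3(T(N)) = - N/2 + sum over r >= 1 of 3^r H(N/3^r)
   for a combination H of the functions y |-> P(cy), c = 1, 2, 3, 6, whose
   polynomial parts cancel.  Thus H is Lipschitz with period 1, and it vanishes
   on [0, 1/6], so x |-> sum over r in Z of 3^(r-x) H(3^(x-r)) is
   continuous and 1-periodic, and its k-th Fourier coefficient unfolds to the
   integral of H(y) y^(-2-s) over y > 0 at s = 2 k pi i / log 3, divided by
   log 3.  For Re s > 1, integrating piecewise turns that integral into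
     (2^s - 1)(3^s - 3) zeta(s) / (s (s + 1));
   along the horizontal line through that point both sides are real
   analytic in Re s, so the identity extends to Re s = 0.  The mean value is a
   Frullani integral.  The modulus of continuity h log(1/h) gives absolute
   convergence of the Fourier series (Bernstein), and a continuous periodic
   function with vanishing Fourier coefficients is zero. *)

(** * Legendre's formula for the product of factorials *)

(** The Mellin integral of H converges for Re s > -1, because H is bounded and vanishes near 0,
    whereas the Dirichlet series of zeta needs Re s > 1; the imaginary axis can therefore be reached
    only by continuation. For k <> 0 the line Im s = 2 k pi / ln 3 misses the pole at 1, so
    continuation in a single real variable is enough. For k = 0 the line runs into that pole and the
    factor s vanishes at the target, which is why the mean value needs its own computation. The
    numerator 2 (1 - 2^s) of the coefficients is what (2^s - 1)(3^s - 3) becomes where 3^s = 1. The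
    sum over the nonzero integers is unordered, so convergence must be absolute. The dilates of H,
    read in the variable x, share one Lipschitz constant that does not decay, so their sum is only
    shown to be log-Lipschitz; this is still Hoelder of an exponent above 1/2, which is what
    Bernstein's argument needs. *)

Section AsmValuation.
Local Open Scope nat_scope.

Lemma divn_eq_of_bounds (d n q : nat) : q * d <= n -> n < q.+1 * d -> n %/ d = q.
Proof.
move=> h1 h2; have d0 : 0 < d by case: d h1 h2 => [|d] //; rewrite !muln0.
by apply/eqP; rewrite eqn_leq -ltnS ltn_divLR // h2 leq_divRL.
Qed.

(** Hermite's identity: passing from m to m + 1 trades the term m %/ d for (m + d) %/ d, which is
    one larger. *)
Lemma sum_divn_add (d m : nat) : 0 < d -> \sum_(i < d) (m + i) %/ d = m.
Proof.
move=> d0; elim: m => [|m IH].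
  by rewrite big1 // => i _; rewrite add0n divn_small.
case: d d0 IH => // d _ IH.
rewrite big_ord_recr /= addSnnS divnDr // divnn /=.
move: IH; rewrite big_ord_recl /= addn0 => IH.
rewrite (eq_bigr (fun i : 'I_d => (m + bump 0 i) %/ d.+1)); last first.
  by move=> i _; rewrite /bump /= add1n addSnnS.
lia.
Qed.

(** As 3 j + 1 < 3 d, each quotient is 0, 1 or 2 and counts how many of d and 2 d are reached; the
    first j to reach them are (d + 1) %/ 3 and (2 d + 1) %/ 3. *)
Lemma sum_divn_linear_small (d N : nat) : N <= d ->
  \sum_(j < N) (3 * j + 1) %/ d = (N - (d + 1) %/ 3) + (N - (2 * d + 1) %/ 3).
Proof.
elim: N => [|N IH] h; first by rewrite big_ord0.
rewrite big_ord_recr /= IH; last by lia.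
have [h1|h1] := ltnP (3 * N + 1) d; first by rewrite (divn_small h1); lia.
have [h2|h2] := ltnP (3 * N + 1) (2 * d).
  by rewrite (@divn_eq_of_bounds d (_ * _ + _) 1); lia.
by rewrite (@divn_eq_of_bounds d (_ * _ + _) 2); lia.
Qed.

Lemma sum_divn_shift_small (d N M : nat) : N <= d -> M <= d ->
  \sum_(j < M) (N + j) %/ d = N + M - d.
Proof.
move=> hN; elim: M => [|M IH] h; first by rewrite big_ord0; lia.
rewrite big_ord_recr /= IH; last by lia.
have [h1|h1] := ltnP (N + M) d; first by rewrite (divn_small h1); lia.
by rewrite (@divn_eq_of_bounds d (_ + _) 1); lia.
Qed.

(* Raising N by d raises both sides by 3 N + d, so only N <= d has to be
   checked. *)
Lemma leq_sum_divn_asm (d N : nat) : 0 < d ->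
  \sum_(j < N) (N + j) %/ d <= \sum_(j < N) (3 * j + 1) %/ d.
Proof.
move=> d0; rewrite (divn_eq N d); move: (ltn_pmod N d0).
move: (N %/ d) (N %% d) => q r /ltnW rd; elim: q => [|q IH].
  (* The two thresholds add up to exactly d, so the right side is at least the truncated r + r -
     d. *)
  rewrite mul0n add0n sum_divn_linear_small // sum_divn_shift_small //; lia.
rewrite mulSn -addnA [d + _]addnC; set n := q * d + r in IH *.
have -> : \sum_(j < n + d) (n + d + j) %/ d = \sum_(j < n) (n + j) %/ d + (3 * n + d).
  rewrite (eq_bigr (fun j : 'I_(n + d) => (n + j) %/ d + 1)); last first.
    by move=> i _; rewrite addnAC divnDr // divnn d0.
  rewrite big_split /= sum_nat_const card_ord muln1 big_split_ord /=.
  rewrite (eq_bigr (fun i : 'I_d => (n + n + i) %/ d)); last first.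
    by move=> i _; rewrite addnA.
  by rewrite sum_divn_add //; lia.
have -> : \sum_(j < n + d) (3 * j + 1) %/ d = \sum_(j < n) (3 * j + 1) %/ d + (3 * n + d).
  rewrite addnC big_split_ord /= sum_divn_linear_small //.
  rewrite (eq_bigr (fun j : 'I_n => (3 * j + 1) %/ d + 3)); last first.
    move=> i _; rewrite (_ : 3 * (d + i) + 1 = 3 * i + 1 + 3 * d); last by lia.
    by rewrite divnDr ?dvdn_mull // mulnK.
  by rewrite big_split /= sum_nat_const card_ord; lia.
by rewrite leq_add2r.
Qed.

Lemma logn_fact_widen (p n K : nat) : prime p -> n < K ->
  logn p n`! = \sum_(1 <= k < K) n %/ expn p k.
Proof.
move=> pp nK; rewrite logn_fact // [RHS](@big_cat_nat _ _ _ n.+1) //=.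
rewrite [X in _ = _ + X](_ : _ = 0) ?addn0 // big_nat big1 // => k /andP [hk _].
by rewrite divn_small // (ltn_trans hk) // ltn_expl // prime_gt1.
Qed.

Lemma logn_prod_fact (p N K : nat) (f : nat -> nat) : prime p ->
  (forall j, j < N -> f j < K) ->
  logn p (\prod_(j < N) (f j)`!) = \sum_(1 <= k < K) \sum_(j < N) f j %/ expn p k.
Proof.
move=> pp hf; rewrite exchange_big /=.
elim: N hf => [|N IH] hf; first by rewrite !big_ord0 logn1.
rewrite !big_ord_recr /= lognM ?fact_gt0 //; last by apply: prodn_gt0 => i; exact: fact_gt0.
by rewrite IH ?(@logn_fact_widen p _ K) ?hf // => j hj; apply: hf; lia.
Qed.

(** By Legendre's formula this is an inequality between quotient sums at each prime power, and
    [leq_sum_divn_asm] gives it at every d > 0. It makes the division in [asm_number] exact, so that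
    valuations subtract. *)
Lemma asm_number_integral (N : nat) :
  \prod_(j < N) (N + j)`! %| \prod_(j < N) (3 * j + 1)`!.
Proof.
set a := \prod_(j < N) (N + j)`!; set b := \prod_(j < N) (3 * j + 1)`!.
have a0 : 0 < a by apply: prodn_gt0 => i; exact: fact_gt0.
have b0 : 0 < b by apply: prodn_gt0 => i; exact: fact_gt0.
suff <- : gcdn a b = a by exact: dvdn_gcdr.
apply: eqn_from_log => // [|p]; first by rewrite gcdn_gt0 a0.
rewrite logn_gcd //; apply/minn_idPl.
have [pp|npp] := boolP (prime p); last by rewrite lognE (negbTE npp).
rewrite (@logn_prod_fact p N (3 * N + 1) (fun j => N + j)) //; last by move=> j; lia.
rewrite (@logn_prod_fact p N (3 * N + 1) (fun j => 3 * j + 1)) //; last by move=> j; lia.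
by apply: leq_sum => k _; apply: leq_sum_divn_asm; rewrite expn_gt0 prime_gt0.
Qed.

(** Since (3 j + 1) %/ 3^k = j %/ 3^(k-1), the numerator gives the sum with [k.-1], whose k = 1 term
    has divisor 1. The shifted sums of the denominator are differences of sums up to 2 N and up to
    N. The additive form avoids truncated subtraction. *)
Lemma logn_asm_number (N K : nat) : 3 * N < K ->
  logn 3 (asm_number N) + \sum_(1 <= k < K) \sum_(j < N + N) j %/ expn 3 k =
  \sum_(1 <= k < K) \sum_(j < N) j %/ expn 3 k +
  \sum_(1 <= k < K) \sum_(j < N) j %/ expn 3 k.-1.
Proof.
move=> hK; rewrite /asm_number logn_div ?asm_number_integral //.
have := dvdn_leq_log 3 _ (asm_number_integral N).
rewrite (@logn_prod_fact 3 N K (fun j => N + j)) //; last by move=> j; lia.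
rewrite (@logn_prod_fact 3 N K (fun j => 3 * j + 1)) //; last by move=> j; lia.
have -> : \sum_(1 <= k < K) \sum_(j < N) (3 * j + 1) %/ expn 3 k =
          \sum_(1 <= k < K) \sum_(j < N) j %/ expn 3 k.-1.
  apply: eq_big_nat => -[|k] // _; apply: eq_bigr => j _ /=.
  by rewrite expnS divnMA; congr (_ %/ _); lia.
have -> : \sum_(1 <= k < K) \sum_(j < N + N) j %/ expn 3 k =
  \sum_(1 <= k < K) \sum_(j < N) j %/ expn 3 k +
  \sum_(1 <= k < K) \sum_(j < N) (N + j) %/ expn 3 k.
  by rewrite -big_split /=; apply: eq_bigr => k _; rewrite big_split_ord.
have p0 : 0 < \prod_(j < N) (3 * j + 1)`! by apply: prodn_gt0 => i; exact: fact_gt0.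
by move=> /(_ p0); lia.
Qed.

End AsmValuation.

Section Analysis.
Local Open Scope R_scope.

(** * The sawtooth and the oscillation function *)

Definition saw (y : R) : R := frac_part y * (1 - frac_part y) / 2.

Lemma frac_part_on (n : Z) (y : R) : IZR n <= y < IZR n + 1 -> frac_part y = y - IZR n.
Proof. by move=> hy; rewrite /frac_part -(@Int_part_spec y n) //; lra. Qed.

Lemma frac_part_addZ (y : R) (n : Z) : frac_part (y + IZR n) = frac_part y.
Proof.
have [h1 h2] := base_Int_part y.
rewrite (@frac_part_on (Int_part y + n)) plus_IZR; last by lra.
by rewrite /frac_part; ring.
Qed.

Lemma saw_bounds (y : R) : 0 <= saw y <= 1 / 8.
Proof.
have [/Rge_le h1 h2] := base_fp y; rewrite /saw; move: (frac_part y) h1 h2 => f h1 h2.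
have := Rmult_le_pos f (1 - f) h1 ltac:(lra); have := pow2_ge_0 (f - 1 / 2); lra.
Qed.

Lemma saw_on (n : Z) (y : R) : IZR n <= y <= IZR n + 1 ->
  saw y = (y - IZR n) * (IZR n + 1 - y) / 2.
Proof.
move=> [h1 [h2|->]]; first by rewrite /saw (@frac_part_on n) //; field.
rewrite /saw (@frac_part_on (n + 1)) plus_IZR; last by lra.
by field.
Qed.

Lemma saw_le_dist (y : R) (n : Z) : saw y <= Rabs (y - IZR n) / 2.
Proof.
have [h1 h2] := base_Int_part y.
set m := Int_part y in h1 h2.
rewrite (@saw_on m); last by lra.
have [h|h] := Z_le_gt_dec n m.
  by have := IZR_le _ _ h => h3; rewrite Rabs_pos_eq; nra.
have h3 : IZR (m + 1) <= IZR n by apply: IZR_le; lia.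
by rewrite plus_IZR in h3; rewrite Rabs_left1; nra.
Qed.

(** Inside one period the slope lies in [-1/2, 1/2]. Otherwise an integer m lies between x and y,
    and [saw_le_dist] bounds both values by half their distances to m, which add up to y - x. *)
Lemma saw_lipschitz (x y : R) : Rabs (saw x - saw y) <= Rabs (x - y) / 2.
Proof.
wlog xy : x y / x <= y.
  move=> H; case: (Rle_dec x y) => h; first exact: H.
  by rewrite Rabs_minus_sym (Rabs_minus_sym x); apply: H; lra.
have [h1 h2] := base_Int_part y; set m := Int_part y in h1 h2.
case: (Rle_dec (IZR m) x) => hx.
  rewrite (@saw_on m x) ?(@saw_on m y); try lra.
  by apply: Rabs_le; rewrite Rabs_left1; nra.
have := saw_le_dist x m; have := saw_le_dist y m.
have := saw_bounds x; have := saw_bounds y.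
rewrite (Rabs_left1 (x - y)); last by lra.
rewrite (Rabs_left1 (x - IZR m)); last by lra.
rewrite (Rabs_pos_eq (y - IZR m)); last by lra.
by move=> *; apply: Rabs_le; lra.
Qed.

Lemma continuous_saw (y : R) : continuous saw y.
Proof.
apply/filterlim_locally => eps.
exists eps => z hz; rewrite /ball /= /AbsRing_ball /abs /minus /plus /opp /= in hz *.
by apply: Rle_lt_trans (saw_lipschitz z y) _; have := Rabs_pos (z - y); rewrite /Rminus in hz *;
  lra.
Qed.

Definition floor_int (y : R) : R := (y ^ 2 - y) / 2 + saw y.

Lemma floor_int_on (n : Z) (y : R) : IZR n <= y <= IZR n + 1 ->
  floor_int y = IZR n * y - IZR n * (IZR n + 1) / 2.
Proof. by move=> hy; rewrite /floor_int (@saw_on n) //; field. Qed.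

(** Both sides are q times the integral of the floor over [0, N / q]: no integer lies strictly
    between j / q and (j + 1) / q, so each step stays in one closed cell of [floor_int_on]. *)
Lemma sum_divn_floor_int (q N : nat) : (0 < q)%nat ->
  INR (\sum_(j < N) j %/ q) = INR q * floor_int (INR N / INR q).
Proof.
move=> q0; have q0' : 0 < INR q by apply: lt_0_INR; lia.
elim: N => [|N IH].
  by rewrite big_ord0 (@floor_int_on 0) /= /Rdiv ?Rmult_0_l; lra.
rewrite big_ord_recr /= plus_INR IH.
have hd := divn_eq N q; have hm := ltn_pmod N q0.
set n := (N %/ q)%nat in hd *; set r := (N %% q)%nat in hd hm.
have hN : INR N = INR n * INR q + INR r by rewrite {1}hd plus_INR mult_INR.
have hr : INR r + 1 <= INR q by rewrite -S_INR; apply: le_INR; lia.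
have r0 := pos_INR r.
have eN : INR N / INR q = INR n + INR r / INR q by rewrite hN; field; lra.
have eN1 : INR N.+1 / INR q = INR n + (INR r + 1) / INR q.
  by rewrite S_INR hN; field; lra.
have b1 : 0 <= INR r / INR q by apply: Rdiv_le_0_compat.
have b2 : (INR r + 1) / INR q <= 1 by apply/Rle_div_l; lra.
have b3 : INR r / INR q <= (INR r + 1) / INR q.
  by apply: Rmult_le_compat_r; [apply: Rlt_le; apply: Rinv_0_lt_compat|lra].
have hn : INR n = IZR (Z.of_nat n) by rewrite INR_IZR_INZ.
rewrite !(@floor_int_on (Z.of_nat n)) -?hn ?eN ?eN1; try lra.
by field; lra.
Qed.

(** With A(y) = P(2y)/2 - P(y), this is A(3y)/3 - 3 A(y), where P is replaced by its periodic
    part. *)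
Definition osc (y : R) : R :=
  saw (6 * y) / 6 - 3 / 2 * saw (2 * y) - saw (3 * y) / 3 + 3 * saw y.

(** The weights w of the dilations c = 6, 2, 3, 1 satisfy sum w c^2 = sum w c = 0. The [saw] form
    serves for bounds, this one near 0 and in the arithmetic. *)
Lemma osc_floor_int (y : R) : osc y =
  floor_int (6 * y) / 6 - 3 / 2 * floor_int (2 * y) - floor_int (3 * y) / 3 + 3 * floor_int y.
Proof. by rewrite /osc /floor_int; field. Qed.

Lemma osc_bound (y : R) : Rabs (osc y) <= 1.
Proof.
have := saw_bounds (6 * y); have := saw_bounds (2 * y).
have := saw_bounds (3 * y); have := saw_bounds y => *.
by apply: Rabs_le; rewrite /osc; lra.
Qed.

Lemma osc_small (y : R) : 0 <= y <= 1 / 6 -> osc y = 0.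
Proof. by move=> hy; rewrite osc_floor_int !(@floor_int_on 0) /=; lra. Qed.

(** Removes the terms 3^r H(N / 3^r) with r <= 0, where N / 3^r is an integer, so that only those of
    Legendre's formula are left. *)
Lemma osc_INR (n : nat) : osc (INR n) = 0.
Proof.
have h (m : Z) : saw (IZR m) = 0 by rewrite (@saw_on m) //; lra.
by rewrite /osc INR_IZR_INZ -!mult_IZR !h; field.
Qed.

(** The four terms contribute 1/2 + 3/2 + 1/2 + 3/2 = 4. *)
Lemma osc_lipschitz (x y : R) : Rabs (osc x - osc y) <= 4 * Rabs (x - y).
Proof.
have := saw_lipschitz (6 * x) (6 * y); have := saw_lipschitz (2 * x) (2 * y).
have := saw_lipschitz (3 * x) (3 * y); have := saw_lipschitz x y.
rewrite -!Rmult_minus_distr_l !Rabs_mult !(Rabs_pos_eq (IZR _)); try lra.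
by rewrite /osc => /Rabs_le_between ? /Rabs_le_between ? /Rabs_le_between ? /Rabs_le_between ?;
  apply: Rabs_le; lra.
Qed.

(** * The periodic fluctuation *)

Fixpoint Rsum (f : nat -> R) (n : nat) : R :=
  if n is n'.+1 then Rsum f n' + f n' else 0.

Lemma Rsum_ext (f g : nat -> R) (n : nat) :
  (forall k, (k < n)%nat -> f k = g k) -> Rsum f n = Rsum g n.
Proof.
elim: n => //= n IH h; rewrite IH ?h // => k hk; apply: h; exact: ltnW.
Qed.

Lemma Rsum_plus (f g : nat -> R) (n : nat) :
  Rsum (fun k => f k + g k) n = Rsum f n + Rsum g n.
Proof. by elim: n => [|n IH] /=; [lra|rewrite IH; lra]. Qed.

Lemma Rsum_scal (c : R) (f : nat -> R) (n : nat) :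
  Rsum (fun k => c * f k) n = c * Rsum f n.
Proof. by elim: n => [|n IH] /=; [lra|rewrite IH; lra]. Qed.

Lemma Rsum_recl (f : nat -> R) (n : nat) :
  Rsum f n.+1 = f 0%nat + Rsum (fun k => f k.+1) n.
Proof. by elim: n => [|n IH] //=; [lra|rewrite -/(Rsum f n.+1) IH; lra]. Qed.

Lemma Rsum_rev (f : nat -> R) (n : nat) :
  Rsum f n = Rsum (fun k => f (n - k.+1)%nat) n.
Proof.
elim: n => [|n IH] //; rewrite [RHS]Rsum_recl subn1 /= IH Rplus_comm.
by congr (_ + _); apply: Rsum_ext => k _; congr f; lia.
Qed.

Lemma Rsum_le (f g : nat -> R) (n : nat) :
  (forall k, (k < n)%nat -> f k <= g k) -> Rsum f n <= Rsum g n.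
Proof.
elim: n => [|n IH] h /=; first by lra.
by apply: Rplus_le_compat; [apply: IH => k hk; apply: h; lia|apply: h].
Qed.

Lemma Rsum_const (c : R) (n : nat) : Rsum (fun=> c) n = INR n * c.
Proof. by elim: n => [|n IH]; rewrite ?S_INR /=; [lra|rewrite IH; lra]. Qed.

Lemma Rabs_Rsum (f : nat -> R) (n : nat) : Rabs (Rsum f n) <= Rsum (fun k => Rabs (f k)) n.
Proof.
elim: n => [|n IH] /=; first by rewrite Rabs_R0; lra.
by apply: Rle_trans (Rabs_triang _ _) _; lra.
Qed.

Lemma Rsum_add (f : nat -> R) (m n : nat) :
  Rsum f (m + n) = Rsum f m + Rsum (fun k => f (m + k)%nat) n.
Proof. by elim: n => [|n IH]; rewrite ?addn0 ?addnS /= ?IH; lra. Qed.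

Lemma INR_sum (f : nat -> nat) (n : nat) :
  INR (\sum_(1 <= k < n.+1) f k) = Rsum (fun k => INR (f k.+1)) n.
Proof.
elim: n => [|n IH]; first by rewrite big_geq.
by rewrite big_nat_recr //= plus_INR IH.
Qed.

Lemma INR_expn3 (j : nat) : INR (expn 3 j) = 3 ^ j.
Proof. by elim: j => [|j IH] //; rewrite expnS mult_INR IH /=; ring. Qed.

Lemma ln3_bounds : 1 <= ln 3 < 2.
Proof.
split; last by rewrite -[X in _ < X]ln_exp; apply: ln_increasing; have := exp_ineq1 2 ltac:(lra);
  lra.
rewrite -[X in X <= _]ln_exp; case: exp_le_3 => [h|->]; last by lra.
by apply: Rlt_le; apply: ln_increasing => //; exact: exp_pos.
Qed.

Definition pow3 (x : R) : R := exp (x * ln 3).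

Lemma pow3_gt0 (x : R) : 0 < pow3 x.
Proof. exact: exp_pos. Qed.

Lemma pow3_add (x y : R) : pow3 (x + y) = pow3 x * pow3 y.
Proof. by rewrite /pow3 Rmult_plus_distr_r exp_plus. Qed.

Lemma pow3_opp (x : R) : pow3 (- x) = / pow3 x.
Proof. by rewrite /pow3 Ropp_mult_distr_l_reverse exp_Ropp. Qed.

Lemma pow3_0 : pow3 0 = 1.
Proof. by rewrite /pow3 Rmult_0_l exp_0. Qed.

Lemma pow3_1 : pow3 1 = 3.
Proof. by rewrite /pow3 Rmult_1_l exp_ln; lra. Qed.

Lemma pow3_INR (n : nat) : pow3 (INR n) = 3 ^ n.
Proof.
elim: n => [|n IH]; first by rewrite pow3_0.
by rewrite S_INR pow3_add IH pow3_1 /=; ring.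
Qed.

Lemma pow3_log3 (x : R) : 0 < x -> pow3 (log3 x) = x.
Proof.
move=> x0; rewrite /pow3 /log3 /Rdiv Rmult_assoc Rinv_l; last by have := ln3_bounds; lra.
by rewrite Rmult_1_r exp_ln.
Qed.

Lemma pow3_le (x y : R) : x <= y -> pow3 x <= pow3 y.
Proof.
case=> [h|->]; last by lra.
apply: Rlt_le; apply: exp_increasing; apply: Rmult_lt_compat_r => //.
by have := ln3_bounds; lra.
Qed.

Lemma pow3_m2 : pow3 (- (2)) = 1 / 9.
Proof. by rewrite pow3_opp (_ : 2 = 1 + 1) // pow3_add pow3_1; field. Qed.

Lemma continuous_pow3 (x : R) : continuous pow3 x.
Proof. by apply: (@ex_derive_continuous); rewrite /pow3; auto_derive. Qed.

(* The shift by 2 makes the function vanish on x <= 0, since osc does on [0, 1/9]. *)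
Definition wave (x : R) : R := osc (pow3 (x - 2)) / pow3 (x - 2).

Lemma wave_nonpos (x : R) : x <= 0 -> wave x = 0.
Proof.
move=> x0; rewrite /wave osc_small; first by rewrite /Rdiv Rmult_0_l.
split; first exact: Rlt_le (pow3_gt0 _).
have := @pow3_le (x - 2) (- (2)) ltac:(lra); rewrite pow3_m2; lra.
Qed.

Lemma wave_bound (x : R) : Rabs (wave x) <= 9 * pow3 (- x).
Proof.
rewrite /wave /Rdiv -pow3_opp Rabs_mult (Rabs_pos_eq (pow3 _)); last exact: Rlt_le (pow3_gt0 _).
have -> : - (x - 2) = - x + - (- (2)) by ring.
rewrite pow3_add [pow3 (- - _)]pow3_opp pow3_m2.
have := osc_bound (pow3 (x - 2)); have := pow3_gt0 (- x); have := Rabs_pos (osc (pow3 (x - 2))).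
nra.
Qed.

(** With T = 3^(x-2) and T' = 3^(y-2), the difference splits into (osc T - osc T') / T' and osc T
    (1/T - 1/T'). Since 1/T <= 9 once x >= 0, these are at most 4 and 9 times 1 - 3^(x-y) <= ln 3 (y
    - x); and ln 3 < 2 gives 26. *)
Lemma wave_lipschitz (x y : R) : Rabs (wave x - wave y) <= 26 * Rabs (x - y).
Proof.
wlog xy : x y / x <= y.
  move=> H; case: (Rle_dec x y) => h; first exact: H.
  by rewrite Rabs_minus_sym (Rabs_minus_sym x); apply: H; lra.
wlog x0 : x xy / 0 <= x.
  move=> H; case: (Rle_dec 0 x) => h; first exact: H.
  rewrite (wave_nonpos x); last by lra.
  case: (Rle_dec 0 y) => hy.
    have := H 0 hy ltac:(lra); rewrite (wave_nonpos 0); last by lra.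
    by rewrite (Rabs_left1 (0 - y)) ?(Rabs_left1 (x - y)); lra.
  by rewrite (wave_nonpos y) ?Rminus_diag ?Rabs_R0; [have := Rabs_pos (x - y); lra|lra].
have T0 := pow3_gt0 (x - 2); have T0' := pow3_gt0 (y - 2).
have e : pow3 (x - 2) / pow3 (y - 2) = pow3 (x - y).
  by rewrite /Rdiv -pow3_opp -pow3_add; congr pow3; ring.
have e1 : 1 - pow3 (x - y) <= 2 * (y - x).
  have := exp_ineq1_le ((x - y) * ln 3); rewrite -/(pow3 (x - y)).
  by have := ln3_bounds; nra.
have e2 : 0 <= 1 - pow3 (x - y) by have := @pow3_le (x - y) 0 ltac:(lra); rewrite pow3_0; lra.
have e3 : / pow3 (x - 2) <= 9.
  rewrite -(Rinv_inv 9); apply: Rinv_le_contravar; first by lra.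
  by have := @pow3_le (- (2)) (x - 2) ltac:(lra); rewrite pow3_m2; lra.
have -> : wave x - wave y =
    (osc (pow3 (x - 2)) - osc (pow3 (y - 2))) / pow3 (y - 2)
    + osc (pow3 (x - 2)) * / pow3 (x - 2) * (1 - pow3 (x - y)).
  by rewrite -e /wave; field; lra.
apply: Rle_trans (Rabs_triang _ _) _.
have b1 : Rabs ((osc (pow3 (x - 2)) - osc (pow3 (y - 2))) / pow3 (y - 2)) <= 4 * (1 - pow3 (x - y)).
  rewrite /Rdiv Rabs_mult (Rabs_pos_eq (/ _)); last by apply: Rlt_le; apply: Rinv_0_lt_compat.
  apply/Rle_div_l => //; apply: Rle_trans (osc_lipschitz _ _) _.
  rewrite Rabs_left1; last by have := @pow3_le (x - 2) (y - 2) ltac:(lra); lra.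
  by rewrite -e; apply: Req_le; field; lra.
have b2 : Rabs (osc (pow3 (x - 2)) * / pow3 (x - 2) * (1 - pow3 (x - y))) <= 9 * (1 - pow3 (x - y)).
  rewrite !Rabs_mult (Rabs_pos_eq (1 - _)) // (Rabs_pos_eq (/ _)); last by apply: Rlt_le;
    apply: Rinv_0_lt_compat.
  apply: Rmult_le_compat_r => //.
  have := osc_bound (pow3 (x - 2)); have := Rabs_pos (osc (pow3 (x - 2))).
  by have := Rinv_0_lt_compat _ T0; nra.
by rewrite (Rabs_left1 (x - y)); lra.
Qed.

Lemma continuous_lipschitz (f : R -> R) (K x : R) :
  (forall x y, Rabs (f x - f y) <= K * Rabs (x - y)) -> continuous f x.
Proof.
move=> hf; apply/filterlim_locally => eps.
have K0 : 0 < Rabs K + 1 by have := Rabs_pos K; lra.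
have d0 : 0 < eps / (Rabs K + 1) by apply: Rdiv_lt_0_compat => //; exact: cond_pos.
exists (mkposreal _ d0) => z; rewrite /ball /= /AbsRing_ball /abs /minus /plus /opp /= => hz.
apply: Rle_lt_trans (hf z x) _.
apply: (@Rle_lt_trans _ ((Rabs K + 1) * Rabs (z - x))).
  by apply: Rmult_le_compat_r; [exact: Rabs_pos|have := Rle_abs K; lra].
by move/Rlt_div_r: hz => /(_ K0); rewrite Rmult_comm.
Qed.

Lemma continuous_wave (x : R) : continuous wave x.
Proof. exact: continuous_lipschitz wave_lipschitz. Qed.

(* Has period 1 only on x <= 1, where the terms with negative index vanish. *)
Definition wave_sum (x : R) : R := Series (fun m => wave (x + INR m)).

Lemma wave_shift_bound (x : R) (m : nat) :
  Rabs (wave (x + INR m)) <= 9 * pow3 (- x) * (/ 3) ^ m.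
Proof.
apply: Rle_trans (wave_bound _) _.
by rewrite Ropp_plus_distr pow3_add [pow3 (- INR m)]pow3_opp pow3_INR pow_inv; lra.
Qed.

Lemma is_series_wave_dom (x : R) :
  is_series (fun m => 9 * pow3 (- x) * (/ 3) ^ m) (27 / 2 * pow3 (- x)).
Proof.
have -> : 27 / 2 * pow3 (- x) = scal (9 * pow3 (- x)) (/ (1 - / 3)).
  by rewrite /scal /= /mult /=; field.
by apply: is_series_scal; apply: is_series_geom; rewrite Rabs_pos_eq; lra.
Qed.

Lemma ex_series_wave (x : R) : ex_series (fun m => wave (x + INR m)).
Proof.
apply: (ex_series_le _ (fun m => 9 * pow3 (- x) * (/ 3) ^ m)) => [m|].
  exact: wave_shift_bound.
by eexists; exact: is_series_wave_dom.
Qed.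

Lemma wave_sum_bound (x : R) : Rabs (wave_sum x) <= 27 / 2 * pow3 (- x).
Proof.
rewrite -(is_series_unique _ _ (is_series_wave_dom x)).
apply: Rle_trans (Series_Rabs _ _) _.
  apply: (ex_series_le _ (fun m => 9 * pow3 (- x) * (/ 3) ^ m)) => [m|].
    by rewrite /norm /= /abs /= Rabs_Rabsolu; exact: wave_shift_bound.
  by eexists; exact: is_series_wave_dom.
apply: Series_le => [m|]; last by eexists; exact: is_series_wave_dom.
by split; [exact: Rabs_pos|exact: wave_shift_bound].
Qed.

Lemma wave_sum_step (x : R) : wave_sum x = wave x + wave_sum (x + 1).
Proof.
rewrite /wave_sum (Series_incr_1 _ (ex_series_wave x)) /= Rplus_0_r; congr (_ + _).
by apply: Series_ext => m; congr wave; rewrite -/(INR m.+1) S_INR; ring.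
Qed.

Lemma wave_sum_split (x : R) (n : nat) :
  wave_sum x = Rsum (fun m => wave (x + INR m)) n + wave_sum (x + INR n).
Proof.
elim: n => [|n IH]; first by rewrite /= Rplus_0_l Rplus_0_r.
by rewrite IH wave_sum_step S_INR /= -Rplus_assoc; congr (_ + _ + wave_sum _); ring.
Qed.

Lemma wave_sum_addn (x : R) (n : nat) : x + INR n <= 1 -> wave_sum (x + INR n) = wave_sum x.
Proof.
elim: n => [|n IH]; first by rewrite Rplus_0_r.
rewrite S_INR => h; rewrite -IH; last by lra.
by rewrite (wave_sum_step (x + INR n)) wave_nonpos; [rewrite Rplus_0_l Rplus_assoc|lra].
Qed.

Definition pwave (x : R) : R := wave_sum (frac_part x).

(** Any representative at most 1 is allowed, not only the fractional part: two nearby points can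
    then share one n, and log3 N can be moved far to the left, so that the series of [wave] collects
    all scales. *)
Lemma pwave_eq (n : Z) (x : R) : x - IZR n <= 1 -> pwave x = wave_sum (x - IZR n).
Proof.
move=> h; have [h1 h2] := base_fp x; rewrite /pwave /frac_part in h1 h2 *.
have [hn|hn] := Z_le_gt_dec n (Int_part x).
  have e : x - IZR n = x - IZR (Int_part x) + INR (Z.to_nat (Int_part x - n)).
    by rewrite INR_IZR_INZ Z2Nat.id ?minus_IZR; [ring|lia].
  by rewrite e in h *; rewrite wave_sum_addn.
have e : x - IZR (Int_part x) = x - IZR n + INR (Z.to_nat (n - Int_part x)).
  by rewrite INR_IZR_INZ Z2Nat.id ?minus_IZR; [ring|lia].
by rewrite e wave_sum_addn // -e; lra.
Qed.

Lemma pwave_addZ (x : R) (n : Z) : pwave (x + IZR n) = pwave x.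
Proof. by rewrite /pwave frac_part_addZ. Qed.

(* Telescoping: with A_r = 3^r (P(2N/3^r)/2 - P(N/3^r)), where P = floor_int,
   one has 3^r osc(N/3^r) = A_{r-1} - 3 A_r. *)
Lemma logn_asm_pwave (N : nat) : (0 < N)%nat ->
  INR (logn 3 (asm_number N)) = INR N * (pwave (log3 (INR N)) - 1 / 2).
Proof.
move=> N0; have N0' : 0 < INR N by apply: lt_0_INR; lia.
(* Subtracting n = 3 N makes the argument nonpositive, and the two extra terms in [RR] undo the
   shift by 2 in [wave], so that the arguments of [osc] in the tail are the integers N 3^m. Moreover
   3 N < RR + 1, as [logn_asm_number] requires. *)
pose n := (3 * N)%nat; pose RR := n.+2; set lN := log3 (INR N).
have e3 : INR N <= pow3 (INR n).
  rewrite pow3_INR; apply: (@Rle_trans _ (INR (expn 3 N))).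
    by apply: le_INR; have := @ltn_expl 3 N isT; lia.
  rewrite INR_expn3.
  by apply: Rle_pow; [lra|rewrite /n; lia].
have lNn : lN <= INR n.
  case: (Rle_dec lN (INR n)) => // /Rnot_le_lt h.
  have : pow3 (INR n) < pow3 lN.
    by apply: exp_increasing; apply: Rmult_lt_compat_r => //; have := ln3_bounds; lra.
  by rewrite pow3_log3 //; lra.
rewrite (@pwave_eq (Z.of_nat n)) -INR_IZR_INZ; last by lra.
rewrite (@wave_sum_split _ RR).
have -> : wave_sum (lN - INR n + INR RR) = 0.
  rewrite /wave_sum -[RHS](Rmult_0_l (Series (fun=> 1))) -Series_scal_l.
  apply: Series_ext => m; rewrite Rmult_0_l /wave.
  have -> : lN - INR n + INR RR + INR m - 2 = lN + INR m by rewrite !S_INR; ring.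
  rewrite pow3_add pow3_log3 // pow3_INR (_ : _ * _ = INR (N * expn 3 m)).
    by rewrite osc_INR /Rdiv Rmult_0_l.
  by rewrite mult_INR INR_expn3.
rewrite Rplus_0_r.
have q0 k : 0 < 3 ^ k by apply: pow_lt; lra.
have -> : INR N * (Rsum (fun m => wave (lN - INR n + INR m)) RR - 1 / 2) =
    Rsum (fun r => 3 ^ r.+1 * osc (INR N / 3 ^ r.+1)) RR - INR N / 2.
  rewrite Rmult_minus_distr_l -Rsum_scal Rsum_rev; congr (_ - _); last by field.
  apply: Rsum_ext => k hk; rewrite /wave.
  have -> : lN - INR n + INR (RR - k.+1) - 2 = lN + - INR k.+1.
    rewrite minus_INR; last by lia.
    by rewrite /RR !S_INR; ring.
  rewrite pow3_add pow3_log3 // pow3_opp pow3_INR -/(INR N / 3 ^ k.+1).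
  by have := q0 k.+1 => ?; field; lra.
pose p r := 3 ^ r * floor_int (INR N / 3 ^ r).
pose q r := 3 ^ r * floor_int (2 * (INR N / 3 ^ r)).
have hosc r : 3 ^ r.+1 * osc (INR N / 3 ^ r.+1) =
    (/ 2 * q r - p r) - 3 * (/ 2 * q r.+1 - p r.+1).
  rewrite osc_floor_int /q /p.
  have -> : 6 * (INR N / 3 ^ r.+1) = 2 * (INR N / 3 ^ r) by have := q0 r => ?; rewrite /=; field;
    lra.
  have -> : 3 * (INR N / 3 ^ r.+1) = INR N / 3 ^ r by have := q0 r => ?; rewrite /=; field; lra.
  by rewrite /=; field.
rewrite (Rsum_ext _ (fun r => (/ 2 * q r - p r) - 3 * (/ 2 * q r.+1 - p r.+1)));
  last by move=> k _; exact: hosc.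
have U3 m k : INR (\sum_(j < m) j %/ expn 3 k) = 3 ^ k * floor_int (INR m / 3 ^ k).
  by rewrite sum_divn_floor_int ?expn_gt0 // INR_expn3.
have := @logn_asm_number N RR.+1 ltac:(rewrite /RR /n; lia).
move/(congr1 INR); rewrite !plus_INR !INR_sum.
rewrite (Rsum_ext _ (fun r => q r.+1)); last first.
  by move=> k _; rewrite U3 plus_INR /q; congr (_ * floor_int _); rewrite /Rdiv; ring.
rewrite (Rsum_ext (fun k => INR (\sum_(j < N) j %/ expn 3 k.+1)) (fun r => p r.+1));
  last by move=> k _; rewrite U3.
rewrite (Rsum_ext (fun k => INR (\sum_(j < N) j %/ expn 3 k.+1.-1)) p); last by move=> k _;
  rewrite U3.
have tele f k : Rsum (fun r => f r.+1) k = Rsum f k + f k - f 0%nat :> R.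
  by have := Rsum_recl f k; rewrite /=; lra.
(* At r = RR the argument is at most 2/9, inside the first cell, so the upper end of the telescoping
   sum contributes nothing. *)
have small c : c <= 2 -> 0 <= c -> floor_int (c * (INR N / 3 ^ RR)) = 0.
  move=> c2 c0.
  have h1 : 0 <= INR N / 3 ^ RR by apply: Rlt_le; apply: Rdiv_lt_0_compat.
  have h2 : INR N / 3 ^ RR <= 1 / 9.
    apply/Rle_div_l => //; rewrite -pow3_INR /RR !S_INR !pow3_add pow3_1; lra.
  by move: (INR N / 3 ^ RR) h1 h2 => z h1 h2; rewrite (@floor_int_on 0); [lra|nra].
have qR : q RR = 0 by rewrite /q small; lra.
have pR : p RR = 0 by have := small 1; rewrite Rmult_1_l /p => ->; lra.
have fi (m : nat) : floor_int (INR m) = INR m * (INR m - 1) / 2.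
  by rewrite INR_IZR_INZ (@floor_int_on (Z.of_nat m)); [field|lra].
(* The r = 0 terms leave the linear part: with A_0 = q 0 / 2 - p 0 = N^2 / 2, the difference p 0 -
   A_0 is - N / 2. *)
have p_0 : p 0%nat = INR N * (INR N - 1) / 2 by rewrite /p /= Rdiv_1_r fi; field.
have q_0 : q 0%nat = INR N * (2 * INR N - 1).
  by rewrite /q /= Rdiv_1_r (_ : 2 * INR N = INR (2 * N)) ?fi mult_INR //=; field.
have -> : Rsum (fun r => / 2 * q r - p r - 3 * (/ 2 * q r.+1 - p r.+1)) RR =
   / 2 * Rsum q RR - Rsum p RR - 3 * (/ 2 * Rsum (fun r => q r.+1) RR - Rsum (fun r => p r.+1) RR).
  by elim: (RR) => [|k IH] /=; [lra|rewrite IH; lra].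
rewrite !tele qR pR p_0 q_0; lra.
Qed.

(* Truncating the series after j terms balances the Lipschitz bound on the
   head against the geometric tail. *)
Lemma pwave_modulus (x y : R) (j : nat) : Rabs (x - y) <= / 3 ^ j ->
  Rabs (pwave x - pwave y) <= 729 * (INR j + 1) / 3 ^ j.
Proof.
move=> hxy; have j0 : 0 < 3 ^ j by apply: pow_lt; lra.
have hxy1 : Rabs (x - y) <= 1.
  apply: Rle_trans hxy _; rewrite -[X in _ <= X]Rinv_1.
  by apply: Rinv_le_contravar; [lra|apply: pow_R1_Rle; lra].
have [h1 h2] := base_Int_part x; set n := Int_part x in h1 h2.
move/Rabs_le_between: hxy1 => hxy1.
(* Subtracting n + 1, not n, keeps y at most 1 even when it exceeds x. Both points are then at least
   -2, whence the tail constant 243/2 = 9 * 27/2. *)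
rewrite !(@pwave_eq (n + 1)) plus_IZR; try lra.
set u := x - _; set v := y - _.
have uv : u - v = x - y by rewrite /u /v; ring.
have [hu hv] : -2 <= u /\ -2 <= v by rewrite /u /v; lra.
rewrite (@wave_sum_split u j) (@wave_sum_split v j).
have -> : Rsum (fun m => wave (u + INR m)) j + wave_sum (u + INR j) -
  (Rsum (fun m => wave (v + INR m)) j + wave_sum (v + INR j)) =
  Rsum (fun m => wave (u + INR m) + - 1 * wave (v + INR m)) j + (wave_sum (u + INR j) - wave_sum
    (v + INR j)).
  by rewrite Rsum_plus Rsum_scal; ring.
apply: Rle_trans (Rabs_triang _ _) _.
have b1 : Rabs (Rsum (fun m => wave (u + INR m) + -1 * wave (v + INR m)) j) <= INR j * (26 / 3 ^ j).
  apply: Rle_trans (Rabs_Rsum _ _) _; rewrite -Rsum_const; apply: Rsum_le => k _.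
  have -> : wave (u + INR k) + -1 * wave (v + INR k) = wave (u + INR k) - wave (v + INR k) by ring.
  apply: Rle_trans (wave_lipschitz _ _) _.
  have -> : u + INR k - (v + INR k) = x - y by rewrite -uv; ring.
  by rewrite /Rdiv; apply: Rmult_le_compat_l => //; lra.
have tail w : -2 <= w -> Rabs (wave_sum (w + INR j)) <= 243 / 2 * / 3 ^ j.
  move=> hw; apply: Rle_trans (wave_sum_bound _) _.
  rewrite Ropp_plus_distr pow3_add [pow3 (- INR j)]pow3_opp pow3_INR -Rmult_assoc.
  apply: Rmult_le_compat_r; first by apply: Rlt_le; apply: Rinv_0_lt_compat.
  have := @pow3_le (- w) (- - (2)) ltac:(lra); rewrite [pow3 (- - _)]pow3_opp pow3_m2; lra.
have b2 := tail u hu; have b3 := tail v hv.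
have := Rabs_triang (wave_sum (u + INR j)) (- wave_sum (v + INR j)); rewrite Rabs_Ropp => b4.
have := pos_INR j; have := Rinv_0_lt_compat _ j0.
rewrite /Rdiv /Rminus in b1 b4 *; nra.
Qed.

(** * Real-analytic functions *)

Definition real_analytic_at (f : R -> R) (x : R) : Prop :=
  exists (a : nat -> R) (r : posreal),
    forall d, Rabs d < r -> is_pseries a d (f (x + d)).

(** Strictness comes from convergence at a point e halfway between |d| and r; beyond the radius the
    terms would not tend to 0. *)
Lemma CV_radius_gt (a : nat -> R) (r d : R) :
  (forall d, Rabs d < r -> ex_pseries a d) -> Rabs d < r -> Rbar_lt (Rabs d) (CV_radius a).
Proof.
move=> h hd; apply: Rbar_not_le_lt => hle.
pose e := (Rabs d + r) / 2.
have p := Rabs_pos d; have e0 : 0 <= e by rewrite /e; lra.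
have he : Rabs e < r by rewrite Rabs_pos_eq // /e; lra.
apply: (CV_disk_outside a e).
  by apply: Rbar_le_lt_trans hle _; rewrite /= (Rabs_pos_eq e) // /e; lra.
by apply: ex_series_lim_0; apply/ex_pseries_R; exact: h.
Qed.

Lemma real_analytic_ext (f g : R -> R) (x : R) :
  (forall y, f y = g y) -> real_analytic_at f x -> real_analytic_at g x.
Proof. by move=> h [a [r H]]; exists a, r => d hd; rewrite -h; exact: H. Qed.

Lemma real_analytic_plus (f g : R -> R) (x : R) :
  real_analytic_at f x -> real_analytic_at g x -> real_analytic_at (fun y => f y + g y) x.
Proof.
move=> [a [r hf]] [b [q hg]].
have m0 : 0 < Rmin r q by apply: Rmin_pos; apply: cond_pos.
exists (PS_plus a b), (mkposreal _ m0) => d /= hd.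
by apply: is_pseries_plus; [apply: hf|apply: hg];
  [have := Rmin_l r q|have := Rmin_r r q]; lra.
Qed.

Lemma real_analytic_mult (f g : R -> R) (x : R) :
  real_analytic_at f x -> real_analytic_at g x -> real_analytic_at (fun y => f y * g y) x.
Proof.
move=> [a [r hf]] [b [q hg]].
have m0 : 0 < Rmin r q by apply: Rmin_pos; apply: cond_pos.
exists (PS_mult a b), (mkposreal _ m0) => d /= hd.
have hr : Rabs d < r by have := Rmin_l r q; lra.
have hq : Rabs d < q by have := Rmin_r r q; lra.
apply: is_pseries_mult; [exact: hf|exact: hg| |].
  by apply: CV_radius_gt hr => e he; eexists; exact: hf.
by apply: CV_radius_gt hq => e he; eexists; exact: hg.
Qed.

Lemma real_analytic_exp (c x : R) : real_analytic_at (fun y => exp (c * y)) x.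
Proof.
exists (fun n => exp (c * x) * c ^ n * / INR (fact n)), (mkposreal _ Rlt_0_1) => d _.
rewrite Rmult_plus_distr_l exp_plus.
have := is_exp_Reals (c * d) => /is_pseries_R h.
apply/is_pseries_R; apply: is_series_ext (is_series_scal (exp (c * x)) _ _ h) => n.
by rewrite /scal /= /mult /= Rpow_mult_distr; ring.
Qed.

Lemma real_analytic_const (c x : R) : real_analytic_at (fun=> c) x.
Proof.
exists (fun n => if n is 0%nat then c else 0), (mkposreal _ Rlt_0_1) => d _.
apply/is_pseries_R; apply/is_series_decr_1.
apply: (is_series_ext (fun=> 0)) => [n|]; first by rewrite /= Rmult_0_l.
have -> : plus c (opp (c * d ^ 0)) = 0 by rewrite /plus /opp /=; ring.
have h := is_series_scal 0 _ _ (is_series_geom (/ 2) ltac:(rewrite Rabs_pos_eq; lra)).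
have e : scal 0 (/ (1 - / 2)) = 0 by rewrite /scal /= /mult /=; ring.
by rewrite e in h; apply: is_series_ext h => n; rewrite /scal /= /mult /=; ring.
Qed.

Lemma real_analytic_id (x : R) : real_analytic_at (fun y => y) x.
Proof.
exists (fun n => if n is 0%nat then x else if n is 1%nat then 1 else 0), (mkposreal _ Rlt_0_1) =>
  d _.
apply/is_pseries_R; apply/is_series_decr_1; apply/is_series_decr_1.
apply: (is_series_ext (fun=> 0)) => [n|]; first by rewrite /= Rmult_0_l.
have -> : plus (plus (x + d) (opp (x * d ^ 0))) (opp (1 * d ^ 1)) = 0 by rewrite /plus /opp /=;
  ring.
have h := is_series_scal 0 _ _ (is_series_geom (/ 2) ltac:(rewrite Rabs_pos_eq; lra)).
have e : scal 0 (/ (1 - / 2)) = 0 by rewrite /scal /= /mult /=; ring.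
by rewrite e in h; apply: is_series_ext h => n; rewrite /scal /= /mult /=; ring.
Qed.

Lemma real_analytic_scal (c : R) (f : R -> R) (x : R) :
  real_analytic_at f x -> real_analytic_at (fun y => c * f y) x.
Proof. by move=> h; apply: real_analytic_mult => //; exact: real_analytic_const. Qed.

(** By continuity the constant coefficient is the limit of the sum from the right, hence 0; dividing
    by d shifts the series down, and the next coefficient follows. One-sided information is all that
    is known at a supremum. *)
Lemma pseries_zero_right (a : nat -> R) (r : R) : 0 < r ->
  (forall d, Rabs d < r -> ex_pseries a d) ->
  (forall d, 0 < d < r -> is_pseries a d 0) -> forall n, a n = 0.
Proof.
move=> r0 hex h0 n.
have coef0 b : (forall d, Rabs d < r -> ex_pseries b d) ->
    (forall d, 0 < d < r -> is_pseries b d 0) -> b 0%nat = 0.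
  move=> {a n hex h0} hex h0.
  have hc : continuity_pt (PSeries b) 0.
    by apply: PSeries_continuity; apply: CV_radius_gt hex _; rewrite Rabs_R0.
  case: (Req_dec (b 0%nat) 0) => // na.
  have [d [d0 hd]] := hc (Rabs (b 0%nat)) (Rabs_pos_lt _ na).
  have m0 : 0 < Rmin d r by apply: Rmin_pos.
  have [ml mr] := (Rmin_l d r, Rmin_r d r).
  pose z := Rmin d r / 2.
  have z0 : 0 < z < r by rewrite /z; lra.
  have zd : z < d by rewrite /z; lra.
  have hz : D_x no_cond 0 z /\ Rabs (z - 0) < d.
    split; first by split => // e; lra.
    by rewrite Rminus_0_r Rabs_pos_eq; lra.
  have := hd z hz; rewrite /= /Rdist PSeries_0.
  rewrite (is_pseries_unique _ _ _ (h0 z z0)) Rminus_0_l Rabs_Ropp; lra.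
elim: n a hex h0 => [|n IH] a hex h0; first exact: coef0.
apply: (IH (PS_decr_1 a)) => d hd.
  case: (Req_dec d 0) => [->|d0]; first by exists (PS_decr_1 a 0); exact: is_pseries_0.
  have [l hl] := hex d hd; exists (scal (/ d) (plus l (opp (a 0%nat)))).
  by apply: is_pseries_decr_1 hl; rewrite /mult /one /= Rinv_l.
have a0 := coef0 a hex h0.
have -> : 0 = scal (/ d) (plus 0 (opp (a 0%nat))).
  by rewrite a0 /scal /plus /opp /= /mult /=; ring.
by apply: is_pseries_decr_1; [rewrite /mult /one /= Rinv_l; lra|exact: h0].
Qed.

(* At the supremum of the points where f does not vanish, the power series of f
   vanishes on the right, hence identically. *)
Lemma real_analytic_identity (f : R -> R) (T : R) :
  (forall x, 0 <= x -> real_analytic_at f x) -> (forall x, T < x -> f x = 0) -> f 0 = 0.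
Proof.
move=> hf hT; case: (Req_dec (f 0) 0) => // nf.
pose E x := 0 <= x /\ f x <> 0.
have [s [ub lub]] : {s | is_lub E s}.
  apply: completeness; last by exists 0; split => //; lra.
  exists T => x [_ hx]; case: (Rle_dec x T) => // /Rnot_le_lt h.
  by case: hx; exact: hT.
have s0 : 0 <= s by apply: ub; split => //; lra.
have zero x : s < x -> f x = 0.
  move=> hx; case: (Req_dec (f x) 0) => // nx.
  have x0 : 0 <= x by lra.
  by have := ub x (conj x0 nx); lra.
have [a [r ha]] := hf s s0; have r0 := cond_pos r.
have az : forall n, a n = 0.
  apply: (pseries_zero_right a r) => // [d hd|d hd]; first by eexists; exact: ha.
  by rewrite -(zero (s + d)); [apply: ha; rewrite Rabs_pos_eq; lra|lra].
suff : s <= s - r / 2 by lra.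
apply: lub => x [x0 nx]; case: (Rle_dec x (s - r / 2)) => // /Rnot_le_lt h.
have hx := ub x (conj x0 nx); case: nx.
have := ha (x - s) ltac:(rewrite Rabs_left1; lra).
rewrite (_ : s + (x - s) = x); last by ring.
move/is_pseries_unique => <-; rewrite /PSeries -[RHS](Rmult_0_l (Series (fun=> 1))) -Series_scal_l.
by apply: Series_ext => n; rewrite az; ring.
Qed.

(** * Laplace transforms *)

(** Integer endpoints suffice for exponentially decaying integrands. Continuity is bundled in, so
    that every integral over [0, n] exists and linearity needs no side conditions. *)
Definition is_improper (f : R -> R) (l : R) : Prop :=
  (forall x, continuous f x) /\ is_lim_seq (fun n => RInt f 0 (INR n)) l.

Lemma ex_RInt_cont (f : R -> R) (a b : R) : (forall x, continuous f x) -> ex_RInt f a b.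
Proof. by move=> h; apply: ex_RInt_continuous => x _. Qed.

Lemma RInt_exp_decay (K c a b : R) : 0 < c ->
  is_RInt (fun x => K * exp (- c * x)) a b (K / c * (exp (- c * a) - exp (- c * b))).
Proof.
move=> c0.
have -> : K / c * (exp (- c * a) - exp (- c * b)) =
    minus ((fun x => - (K / c) * exp (- c * x)) b) ((fun x => - (K / c) * exp (- c * x)) a).
  by rewrite /minus /plus /opp /=; ring.
apply: (@is_RInt_derive R_CompleteNormedModule (fun x => - (K / c) * exp (- c * x))) => x _;
  last by apply: (@ex_derive_continuous); auto_derive.
by auto_derive => //; field; lra.
Qed.

Lemma Rabs_RInt_decay (f : R -> R) (K c a b : R) :
  0 < c -> 0 <= a <= b -> (forall x, continuous f x) ->
  (forall x, 0 <= x -> Rabs (f x) <= K * exp (- c * x)) ->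
  Rabs (RInt f a b) <= K / c * exp (- c * a).
Proof.
move=> c0 [a0 ab] fc hf.
have K0 : 0 <= K.
  by have := hf 0 (Rle_refl 0); rewrite Rmult_0_r exp_0; have := Rabs_pos (f 0); lra.
apply: (@Rle_trans _ (K / c * (exp (- c * a) - exp (- c * b)))).
  apply: (norm_RInt_le f (fun x => K * exp (- c * x)) a b) => // [x hx||].
  - by apply: hf; lra.
  - exact/RInt_correct/ex_RInt_cont.
  - exact: RInt_exp_decay.
apply: Rmult_le_compat_l; first exact: Rdiv_le_0_compat.
by have := exp_pos (- c * b); lra.
Qed.

Lemma ex_improper (f : R -> R) (K c : R) : 0 < c -> (forall x, continuous f x) ->
  (forall x, 0 <= x -> Rabs (f x) <= K * exp (- c * x)) ->
  exists l, is_improper f l /\ Rabs l <= K / c.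
Proof.
move=> c0 fc hf.
have bnd a b (h : 0 <= a <= b) := @Rabs_RInt_decay f K c a b c0 h fc hf.
have K0 : 0 <= K / c.
  apply: Rdiv_le_0_compat => //; have := hf 0 (Rle_refl 0).
  by rewrite Rmult_0_r exp_0; have := Rabs_pos (f 0); lra.
have dif m n : (m <= n)%nat ->
    Rabs (RInt f 0 (INR n) - RInt f 0 (INR m)) <= K / c * exp (- c * INR m).
  move=> mn; rewrite -(RInt_Chasles f 0 (INR m) (INR n)); try exact: ex_RInt_cont.
  rewrite /plus /= (_ : _ + _ - _ = RInt f (INR m) (INR n)); last by ring.
  by apply: bnd; split; [exact: pos_INR|apply: le_INR; lia].
have lim0 : is_lim_seq (fun m => K / c * exp (- c * INR m)) 0.
  have -> : Finite 0 = Rbar_mult (K / c) 0 by rewrite /= Rmult_0_r.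
  apply: is_lim_seq_scal_l; apply: is_lim_seq_ext (is_lim_seq_geom (exp (- c)) _) => [n|].
    elim: n => [|n IH]; first by rewrite Rmult_0_r exp_0.
    by rewrite S_INR Rmult_plus_distr_l exp_plus -IH Rmult_1_r /=; ring.
  rewrite Rabs_pos_eq; last exact: Rlt_le (exp_pos _).
  by rewrite -exp_0; apply: exp_increasing; lra.
have [l hl] : ex_finite_lim_seq (fun n => RInt f 0 (INR n)).
  apply/ex_lim_seq_cauchy_corr => eps.
  have [N hN] : eventually (fun m => Rabs (K / c * exp (- c * INR m) - 0) < eps / 2).
    exact: (proj2 (is_lim_seq_spec _ _) lim0 (pos_div_2 eps)).
  have e0 := cond_pos eps.
  have hN' m n : (N <= m)%coq_nat -> (m <= n)%nat -> Rabs (RInt f 0 (INR n) - RInt f 0 (INR m)) <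
    eps.
    move=> h1 h2; have := dif m n h2; have := hN m h1; rewrite Rminus_0_r.
    by have := Rle_abs (K / c * exp (- c * INR m)); lra.
  exists N => n m hn hm; have [h|h] := leqP m n; first exact: hN'.
  by rewrite Rabs_minus_sym; apply: hN' => //; lia.
exists l; split; first by split.
have := is_lim_seq_abs _ _ hl => /= hl'.
have := is_lim_seq_le _ _ _ _ _ hl' (is_lim_seq_const (K / c)); apply => n.
have := bnd 0 (INR n) (conj (Rle_refl 0) (pos_INR n)).
by rewrite Rmult_0_r exp_0 Rmult_1_r.
Qed.

Lemma is_improper_unique (f : R -> R) (l1 l2 : R) :
  is_improper f l1 -> is_improper f l2 -> l1 = l2.
Proof.
move=> [_ h1] [_ h2]; have := is_lim_seq_unique _ _ h1; rewrite (is_lim_seq_unique _ _ h2).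
by case.
Qed.

Lemma is_improper_ext (f g : R -> R) (l : R) :
  (forall x, f x = g x) -> is_improper f l -> is_improper g l.
Proof.
move=> h [fc hl]; split; first by move=> x; apply: continuous_ext (fc x).
by apply: is_lim_seq_ext hl => n; apply: RInt_ext => x _.
Qed.

Lemma is_improper_plus (f g : R -> R) (lf lg : R) :
  is_improper f lf -> is_improper g lg -> is_improper (fun x => f x + g x) (lf + lg).
Proof.
move=> [fc hf] [gc hg]; split; first by move=> x; apply: (@continuous_plus _ R_AbsRing).
apply: is_lim_seq_ext (is_lim_seq_plus' _ _ _ _ hf hg) => n.
by rewrite (RInt_plus f g) //; exact: ex_RInt_cont.
Qed.

Lemma is_improper_scal (c : R) (f : R -> R) (l : R) :
  is_improper f l -> is_improper (fun x => c * f x) (c * l).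
Proof.
move=> [fc hf]; split; first by move=> x; apply: (@continuous_scal_r _ R_AbsRing).
apply: is_lim_seq_ext (is_lim_seq_scal_l _ c _ hf) => n.
by rewrite (RInt_scal f) //; exact: ex_RInt_cont.
Qed.

(** Beyond order N, |z|^n <= 2^-(N+1) (2|z|)^n, and the exponential series at 2|z| bounds what is
    left. The geometric factor survives integration, while the doubled exponent is absorbed by the
    decay of the integrand. *)
Lemma exp_taylor (z : R) (N : nat) :
  Rabs (exp z - sum_n (fun n => z ^ n / INR (fact n)) N) <= (/ 2) ^ N.+1 * exp (2 * Rabs z).
Proof.
have ex u : is_series (fun n => u ^ n / INR (fact n)) (exp u).
  apply: is_series_ext (proj1 (is_pseries_R _ _ _) (is_exp_Reals u)) => n.
  by rewrite /Rdiv Rmult_comm.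
have fact0 n : 0 < / INR (fact n) by apply: Rinv_0_lt_compat; exact: INR_fact_lt_0.
rewrite -(is_series_unique _ _ (ex z)) -(is_series_unique _ _ (ex (2 * Rabs z))).
rewrite (Series_incr_n _ N.+1) //=; [|lia|by eexists; exact: ex].
rewrite sum_n_Reals (_ : forall u v : R, u + v - u = v); last by move=> u v; ring.
have exz u : ex_series (fun n => u ^ (N.+1 + n)%coq_nat / INR (fact (N.+1 + n)%coq_nat)).
  by apply/(ex_series_incr_n (fun n => u ^ n / INR (fact n))); eexists; exact: ex.
have pos n : 0 <= (2 * Rabs z) ^ n / INR (fact n).
  apply: Rmult_le_pos; last exact: Rlt_le.
  by apply: pow_le; have := Rabs_pos z; lra.
have dom n : Rabs (z ^ (N.+1 + n)%coq_nat / INR (fact (N.+1 + n)%coq_nat)) <=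
    (/ 2) ^ N.+1 * ((2 * Rabs z) ^ (N.+1 + n)%coq_nat / INR (fact (N.+1 + n)%coq_nat)).
  set m := (N.+1 + n)%coq_nat; rewrite /Rdiv Rabs_mult (Rabs_pos_eq (/ _)); last exact: Rlt_le.
  rewrite -RPow_abs (_ : Rabs z ^ m = (/ 2) ^ m * (2 * Rabs z) ^ m); last first.
    by rewrite -Rpow_mult_distr; congr (_ ^ _); field.
  rewrite Rmult_assoc; apply: Rmult_le_compat_r; first exact: pos.
  rewrite !pow_inv; apply: Rinv_le_contravar; first by apply: pow_lt; lra.
  by apply: Rle_pow; [lra|rewrite /m; lia].
apply: Rle_trans (Series_Rabs _ _) _.
  apply: (ex_series_le _ _ _ (ex_series_scal ((/ 2) ^ N.+1) _ (exz (2 * Rabs z)))) => n.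
  by rewrite /norm /= /abs /= Rabs_Rabsolu; exact: dom.
apply: Rle_trans (Series_le _ _ _ (ex_series_scal ((/ 2) ^ N.+1) _ (exz (2 * Rabs z)))) _.
  by move=> n; split; [exact: Rabs_pos|exact: dom].
rewrite Series_scal_l; apply: Rmult_le_compat_l; first by apply: pow_le; lra.
rewrite (Series_incr_n (fun n => (2 * Rabs z) ^ n / INR (fact n)) N.+1); [|lia|by eexists;
  exact: ex].
suff : 0 <= sum_f_R0 (fun n => (2 * Rabs z) ^ n / INR (fact n)) N by rewrite /=; lra.
by apply: cond_pos_sum.
Qed.

(** For n >= 1 the term is the difference of two consecutive Taylor remainders. *)
Lemma pow_div_fact_le (z : R) (n : nat) : Rabs (z ^ n / INR (fact n)) <= 2 * exp (2 * Rabs z).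
Proof.
have e0 := exp_pos (2 * Rabs z).
have half k : 0 <= (/ 2) ^ k <= 1.
  by split; [apply: pow_le; lra|rewrite -(pow1 k); apply: pow_incr; lra].
case: n => [|n].
  rewrite /= Rdiv_1_r Rabs_R1; have := exp_ineq1_le (2 * Rabs z); have := Rabs_pos z; lra.
have h1 := exp_taylor z n; have h2 := exp_taylor z n.+1.
rewrite sum_Sn /plus /= in h2; set s := sum_n _ n in h1 h2.
set w := z * z ^ n / _ in h2; rewrite -/(pow z n.+1) /= -/w.
have -> : w = (exp z - s) - (exp z - (s + w)) by ring.
apply: Rle_trans (Rabs_triang _ _) _; rewrite Rabs_Ropp.
have := half n.+1; have := half n.+2; rewrite /= in h1 h2 *; nra.
Qed.

(* Expanding the kernel in powers of t - t0, the remainder after N terms is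
   O(2^-N) times a kernel that is still integrable near t0. *)
Lemma real_analytic_laplace (a K : R) (phi F : R -> R) (t0 : R) :
  0 < a -> (forall x, continuous phi x) ->
  (forall x, 0 <= x -> Rabs (phi x) <= K * exp (- a * x)) ->
  (forall t, -1 < t -> is_improper (fun x => phi x * exp (- t * (a * x))) (F t)) ->
  -1 < t0 -> real_analytic_at F t0.
Proof.
move=> a0 pc hphi hF ht0.
have K0 : 0 <= K.
  by have := hphi 0 (Rle_refl 0); rewrite Rmult_0_r exp_0; have := Rabs_pos (phi 0); lra.
(* q is the radius obtained for the power series. For |y| <= q a x the factor exp(2|y|) costs a
   quarter of the decay rate a (1 + t0) of [psi], which leaves more than the half kept in c. *)
pose q := (1 + t0) / 8; have q0 : 0 < q by rewrite /q; lra.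
pose c := a * (1 + t0) / 2; have c0 : 0 < c by rewrite /c; nra.
pose psi x := phi x * exp (- t0 * (a * x)).
have psic x : continuous psi x.
  apply: (@continuous_mult _ R_AbsRing) => //.
  by apply: (@ex_derive_continuous); auto_derive.
have bound x y g : 0 <= x -> Rabs y <= q * (a * x) -> Rabs g <= exp (2 * Rabs y) ->
    Rabs (psi x * g) <= K * exp (- c * x).
  move=> x0 hy hg; rewrite /psi !Rabs_mult (Rabs_pos_eq (exp _)); last exact: Rlt_le (exp_pos _).
  apply: (@Rle_trans _ (K * exp (- a * x) * exp (- t0 * (a * x)) * exp (2 * Rabs y))).
    apply: Rmult_le_compat => //; [|exact: Rabs_pos|].
      by apply: Rmult_le_pos; [exact: Rabs_pos|exact: Rlt_le (exp_pos _)].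
    by apply: Rmult_le_compat_r; [exact: Rlt_le (exp_pos _)|exact: hphi].
  rewrite !Rmult_assoc -!exp_plus; apply: Rmult_le_compat_l => //.
  have e : - a * x + (- t0 * (a * x) + 2 * Rabs y) <= - c * x.
    have : 0 <= a * x by nra.
    rewrite /c; rewrite /q in hy q0; nra.
  by case: e => [e|->]; [apply: Rlt_le; exact: exp_increasing|lra].
pose mom n x := psi x * ((- (a * x)) ^ n / INR (fact n)).
have momc n x : continuous (mom n) x.
  apply: (@continuous_mult _ R_AbsRing) => //.
  by apply: (@ex_derive_continuous); auto_derive.
have mom_ex n : exists l, is_improper (mom n) l.
  have [|l [hl _]] := @ex_improper (mom n) (2 * / q ^ n * K) c c0 (momc n); last by exists l.
  move=> x x0; have qn : 0 < q ^ n by apply: pow_lt.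
  have ax0 : 0 <= a * x by nra.
  (* Rescaling by q puts the monomial in the range covered by [bound], at the price of the constant
     q^-n. *)
  have -> : mom n x = 2 * / q ^ n * (psi x * (/ 2 * ((q * - (a * x)) ^ n / INR (fact n)))).
    by rewrite /mom Rpow_mult_distr; field; split; [exact: INR_fact_neq_0|lra].
  rewrite Rabs_mult [Rabs (2 * _)]Rabs_pos_eq; last first.
    by apply: Rmult_le_pos; [lra|apply: Rlt_le; apply: Rinv_0_lt_compat].
  rewrite (Rmult_assoc (2 * _)); apply: Rmult_le_compat_l.
    by apply: Rmult_le_pos; [lra|apply: Rlt_le; apply: Rinv_0_lt_compat].
  apply: (bound x (q * - (a * x))) => //.
    by rewrite Rabs_left1; nra.
  rewrite Rabs_mult (Rabs_pos_eq (/ 2)); last by lra.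
  by have := pow_div_fact_le (q * - (a * x)) n; lra.
pose m n := real (Lim_seq (fun k => RInt (mom n) 0 (INR k))).
have hm n : is_improper (mom n) (m n).
  have [l [hc hl]] := mom_ex n; split => //.
  by rewrite /m (is_lim_seq_unique _ _ hl).
exists m, (mkposreal _ q0) => d /= hd; apply/is_pseries_R.
have part N : is_improper (fun x => psi x * sum_n (fun n => (- d * (a * x)) ^ n / INR (fact n)) N)
    (sum_n (fun n => m n * d ^ n) N).
  elim: N => [|N IH].
    rewrite sum_O Rmult_comm; apply: is_improper_ext (is_improper_scal (d ^ 0) _ _ (hm 0%nat)) => x.
    by rewrite sum_O /mom /=; field.
  rewrite sum_Sn /plus /= (Rmult_comm (m N.+1)).
  have h := is_improper_plus _ _ _ _ IH (is_improper_scal (d ^ N.+1) _ _ (hm N.+1)).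
  apply: is_improper_ext h => x; rewrite sum_Sn /plus /mom.
  rewrite (_ : - d * (a * x) = d * - (a * x)); last by ring.
  rewrite [(d * - (a * x)) ^ N.+1]Rpow_mult_distr.
  change (@eq R (psi x * sum_n (fun n => (d * - (a * x)) ^ n / INR (fact n)) N +
    d ^ N.+1 * (psi x * ((- (a * x)) ^ N.+1 / INR (fact N.+1))))
    (psi x * (sum_n (fun n => (d * - (a * x)) ^ n / INR (fact n)) N +
    d ^ N.+1 * (- (a * x)) ^ N.+1 / INR (fact N.+1)))).
  by field; exact: INR_fact_neq_0.
have tdlt : -1 < t0 + d by move/Rabs_def2: hd; rewrite /q; lra.
have err N : Rabs (sum_n (fun n => m n * d ^ n) N - F (t0 + d)) <= (/ 2) ^ N.+1 * K / c.
  rewrite Rabs_minus_sym.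
  pose rem x := psi x * (exp (- d * (a * x)) - sum_n (fun n => (- d * (a * x)) ^ n / INR (fact
    n)) N).
  have h : is_improper rem (F (t0 + d) + -1 * sum_n (fun n => m n * d ^ n) N).
    apply: is_improper_ext (is_improper_plus _ _ _ _ (hF _ tdlt) (is_improper_scal (-1) _ _ (part
      N))) => x.
    rewrite /rem /psi (_ : - (t0 + d) * (a * x) = - t0 * (a * x) + - d * (a * x)) ?exp_plus; ring.
  have [|l [hl bl]] := @ex_improper rem ((/ 2) ^ N.+1 * K) c c0 (proj1 h).
    move=> x x0; have hpos : 0 < (/ 2) ^ N.+1 by apply: pow_lt; lra.
    have -> : rem x = (/ 2) ^ N.+1 * (psi x * (/ (/ 2) ^ N.+1 *
      (exp (- d * (a * x)) - sum_n (fun n => (- d * (a * x)) ^ n / INR (fact n)) N))).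
      by rewrite /rem; field; apply: Rgt_not_eq; apply: pow_lt; lra.
    rewrite Rabs_mult (Rabs_pos_eq ((/ 2) ^ _)); last exact: Rlt_le.
    rewrite Rmult_assoc; apply: Rmult_le_compat_l; first exact: Rlt_le.
    apply: (bound x (- d * (a * x))) => //.
      rewrite Rabs_mult Rabs_Ropp (Rabs_pos_eq (a * x)); last by nra.
      by apply: Rmult_le_compat_r; [nra|lra].
    rewrite Rabs_mult (Rabs_pos_eq (/ _)); last by apply: Rlt_le; apply: Rinv_0_lt_compat.
    rewrite Rmult_comm; apply/Rle_div_l => //; rewrite [X in _ <= X]Rmult_comm; exact: exp_taylor.
  have e := is_improper_unique _ _ _ h hl.
  by rewrite (_ : F (t0 + d) - _ = l) // -e; ring.
apply: (_ : is_lim_seq _ (Finite (F (t0 + d)))).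
apply/is_lim_seq_spec => eps.
have lim0 : is_lim_seq (fun N => (K / c) * (/ 2) ^ N) 0.
  have -> : Finite 0 = Rbar_mult (K / c) 0 by rewrite /= Rmult_0_r.
  by apply: is_lim_seq_scal_l; apply: is_lim_seq_geom; rewrite Rabs_pos_eq; lra.
have [N hN] := proj2 (is_lim_seq_spec _ _) lim0 eps.
exists N => n hn; apply: Rle_lt_trans (err n) _.
have := hN n.+1 ltac:(lia); rewrite Rminus_0_r => h; apply: Rle_lt_trans h.
by apply: Rle_trans (Rle_abs _); apply: Req_le; field; lra.
Qed.

(** * The Mellin transform of the wave *)

Ltac Cring := match goal with |- ?a = ?b => change (@eq C a b) end; ring.

Lemma Cexp_plus (a b : C) : Cexp (a + b) = (Cexp a * Cexp b)%C.
Proof.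
case: a b => [a1 a2] [b1 b2]; rewrite /Cexp /= exp_plus cos_plus sin_plus.
by apply: injective_projections => /=; ring.
Qed.

(* 3^(-sx); in particular j^(-s) = ker s (log3 j). *)
Definition ker (s : C) (x : R) : C := Cexp (- s * RtoC (x * ln 3)).

Lemma kerE (t y x : R) : ker (t, y) x =
  (exp (- t * (x * ln 3)) * cos (y * (x * ln 3)), - (exp (- t * (x * ln 3)) * sin (y * (x * ln
    3)))).
Proof.
rewrite /ker /Cexp /=.
have -> : - t * (x * ln 3) - - y * 0 = - t * (x * ln 3) by ring.
have -> : - t * 0 + - y * (x * ln 3) = - (y * (x * ln 3)) by ring.
by rewrite cos_neg sin_neg; apply: injective_projections => /=; ring.
Qed.

Lemma ker_plus (s : C) (x y : R) : ker s (x + y) = (ker s x * ker s y)%C.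
Proof. by rewrite /ker -Cexp_plus Rmult_plus_distr_r RtoC_plus; congr Cexp; ring. Qed.

Lemma ker_succ (s : C) (x : R) : ker (s + 1) x = (RtoC (pow3 (- x)) * ker s x)%C.
Proof.
case: s => t y; rewrite /Cplus /= !kerE /pow3 Rplus_0_r.
have -> : - (t + 1) * (x * ln 3) = - x * ln 3 + - t * (x * ln 3) by ring.
by rewrite exp_plus; apply: injective_projections => /=; ring.
Qed.

Lemma Cmod_ker (t y x : R) : Cmod (ker (t, y) x) = exp (- t * (x * ln 3)).
Proof.
rewrite kerE /Cmod /= -[RHS](sqrt_Rsqr); last exact: Rlt_le (exp_pos _).
congr sqrt; have := sin2_cos2 (y * (x * ln 3)); rewrite /Rsqr => h.
set e := exp _; transitivity (e * e * (sin (y * (x * ln 3)) * sin (y * (x * ln 3)) + cos (y * (x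
  * ln 3)) * cos (y * (x * ln 3)))).
  by ring.
by rewrite h Rmult_1_r.
Qed.

Lemma is_RInt_C (f : R -> C) (a b : R) (l : C) :
  is_RInt (fun x => Re (f x)) a b (Re l) -> is_RInt (fun x => Im (f x)) a b (Im l) ->
  @is_RInt C_R_NormedModule f a b l.
Proof. by case: l => l1 l2; exact: (@is_RInt_fct_extend_pair R_NormedModule R_NormedModule). Qed.

Lemma is_RInt_Re (f : R -> C) (a b : R) (l : C) :
  @is_RInt C_R_NormedModule f a b l -> is_RInt (fun x => Re (f x)) a b (Re l).
Proof. exact: (@is_RInt_fct_extend_fst R_NormedModule R_NormedModule). Qed.

Lemma is_RInt_Im (f : R -> C) (a b : R) (l : C) :
  @is_RInt C_R_NormedModule f a b l -> is_RInt (fun x => Im (f x)) a b (Im l).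
Proof. exact: (@is_RInt_fct_extend_snd R_NormedModule R_NormedModule). Qed.

Lemma is_RInt_Cmult (c : C) (f : R -> C) (a b : R) (l : C) :
  @is_RInt C_R_NormedModule f a b l -> @is_RInt C_R_NormedModule (fun x => (c * f x)%C) a b (c *
    l)%C.
Proof.
case: c => c1 c2 h; have hr := is_RInt_Re _ _ _ _ h; have hi := is_RInt_Im _ _ _ _ h.
apply: is_RInt_C => /=.
  exact: (is_RInt_minus _ _ _ _ _ _ (is_RInt_scal _ _ _ c1 _ hr) (is_RInt_scal _ _ _ c2 _ hi)).
exact: (is_RInt_plus _ _ _ _ _ _ (is_RInt_scal _ _ _ c1 _ hi) (is_RInt_scal _ _ _ c2 _ hr)).
Qed.

(** The antiderivative is - 3^(-sx); keeping the factor s ln 3 in the integrand avoids any division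
    by s. *)
Lemma is_RInt_ker (s : C) (a b : R) :
  @is_RInt C_R_NormedModule (fun x => (s * RtoC (ln 3) * ker s x)%C) a b (ker s a - ker s b)%C.
Proof.
case: s => t y; pose g x := ker (t, y) x; rewrite -/(g a) -/(g b).
apply: is_RInt_C.
  apply: (is_RInt_ext (fun x => - ln 3 * ((- t * exp (- t * (x * ln 3))) * cos (y * (x * ln 3)) -
    y * exp (- t * (x * ln 3)) * sin (y * (x * ln 3))))).
    by move=> x _; rewrite kerE /=; ring.
  have -> : Re (g a - g b)%C = minus ((fun x => - Re (g x)) b) ((fun x => - Re (g x)) a).
    by rewrite /minus /plus /opp /=; ring.
  apply: (@is_RInt_derive R_CompleteNormedModule (fun x => - Re (g x))) => x _; last first.
    by apply: (@ex_derive_continuous); auto_derive.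
  apply: (is_derive_ext (fun x => - (exp (- t * (x * ln 3)) * cos (y * (x * ln 3))))).
    by move=> z; rewrite /g kerE.
  by auto_derive => //; ring.
apply: (is_RInt_ext (fun x => ln 3 * (y * exp (- t * (x * ln 3)) * cos (y * (x * ln 3)) + - t *
  exp (- t * (x * ln 3)) * sin (y * (x * ln 3))))).
  by move=> x _; rewrite kerE /=; ring.
have -> : Im (g a - g b)%C = minus ((fun x => - Im (g x)) b) ((fun x => - Im (g x)) a).
  by rewrite /minus /plus /opp /=; ring.
apply: (@is_RInt_derive R_CompleteNormedModule (fun x => - Im (g x))) => x _; last first.
  by apply: (@ex_derive_continuous); auto_derive.
apply: (is_derive_ext (fun x => exp (- t * (x * ln 3)) * sin (y * (x * ln 3)))).
  by move=> z; rewrite /g kerE /= Ropp_involutive.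
by auto_derive => //; ring.
Qed.

Definition ramp (x : R) : R := floor_int (pow3 x) / pow3 x.

Lemma ramp_nonpos (x : R) : x <= 0 -> ramp x = 0.
Proof.
move=> x0; have := pow3_le _ _ x0; rewrite pow3_0 => h; have := pow3_gt0 x => p.
by rewrite /ramp (@floor_int_on 0); [field|]; lra.
Qed.

Lemma log3_le (x y : R) : 0 < x -> x <= y -> log3 x <= log3 y.
Proof.
move=> x0 [h|->]; last by lra.
apply: Rmult_le_compat_r; last by apply: Rlt_le; apply: ln_increasing.
by apply: Rlt_le; apply: Rinv_0_lt_compat; have := ln3_bounds; lra.
Qed.

Lemma ramp_on (j : nat) (x : R) : (0 < j)%nat -> log3 (INR j) <= x <= log3 (INR j.+1) ->
  ramp x = INR j - INR j * INR j.+1 / 2 * pow3 (- x).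
Proof.
move=> j0 [h1 h2]; have j0' : 0 < INR j by apply: lt_0_INR; lia.
have := pow3_le _ _ h1; have := pow3_le _ _ h2; rewrite !pow3_log3 //; last first.
  by rewrite S_INR; lra.
rewrite S_INR => h3 h4; rewrite pow3_opp /ramp (@floor_int_on (Z.of_nat j)) -INR_IZR_INZ //.
by field; lra.
Qed.

(** In the variable x a dilation becomes a translation by a base-3 logarithm, so the four terms of
    [osc] become translates of one function. *)
Lemma wave_ramp (x : R) : wave x =
  ramp (x + (log3 2 - 1)) - 3 * ramp (x + (log3 2 - 2)) - ramp (x + - 1) + 3 * ramp (x + - (2)).
Proof.
rewrite /wave /ramp; set T := pow3 (x - 2); have T0 : 0 < T := pow3_gt0 _.
have -> : pow3 (x + (log3 2 - 1)) = 6 * T.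
  rewrite (_ : x + _ = (x - 2) + 1 + log3 2); last by ring.
  by rewrite (pow3_add (x - 2 + 1)) (pow3_add (x - 2)) pow3_1 pow3_log3 -/T; lra.
have -> : pow3 (x + (log3 2 - 2)) = 2 * T.
  rewrite (_ : x + _ = (x - 2) + log3 2); last by ring.
  by rewrite (pow3_add (x - 2)) pow3_log3 -/T; lra.
have -> : pow3 (x + - 1) = 3 * T.
  rewrite (_ : x + _ = (x - 2) + 1); last by ring.
  by rewrite (pow3_add (x - 2)) pow3_1 -/T; lra.
rewrite -/(x - 2) -/T osc_floor_int; field; lra.
Qed.

Fixpoint Csum (f : nat -> C) (n : nat) : C :=
  if n is n'.+1 then (Csum f n' + f n')%C else 0%C.

Definition zeta_partial (s : C) : nat -> C := Csum (fun j => ker s (log3 (INR j.+1))).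

(** Boundary term of the summation by parts at B + 1. It has order B^(1 - Re s), so it disappears in
    the limit for Re s > 1. *)
Definition zeta_tail (s : C) (B : nat) : C :=
  (ker s (log3 (INR B.+1)) * RtoC (INR B) * (s / 2 + 1))%C.

(* On [log3 j, log3 (j+1)] the integrand is j 3^(-sx) - j(j+1)/2 3^(-(s+1)x), whose
   integral is j^(-s) plus a telescoping term. *)
Lemma is_RInt_ramp (s : C) (B : nat) :
  @is_RInt C_R_NormedModule (fun x => (s * (s + 1) * RtoC (ln 3) * (RtoC (ramp x) * ker s x))%C)
    0 (log3 (INR B.+1)) (zeta_partial s B - zeta_tail s B)%C.
Proof.
elim: B => [|B IH].
  rewrite /log3 ln_1 Rdiv_0_l /zeta_tail /=.
  have -> : (0 - ker s (log3 1) * RtoC 0 * (s / 2 + 1))%C = zero.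
    by rewrite /zero /=; apply: injective_projections => /=; ring.
  exact: is_RInt_point.
set j := B.+1 in IH *; have j0 : 0 < INR j by apply: lt_0_INR; lia.
have j1 : 0 < INR j.+1 by apply: lt_0_INR; lia.
have -> : (zeta_partial s j - zeta_tail s j)%C =
  plus (zeta_partial s B - zeta_tail s B : C_R_NormedModule)%C
   ((s + 1) * RtoC (INR j) * (ker s (log3 (INR j)) - ker s (log3 (INR j.+1))) +
     (- s * RtoC (INR j * INR j.+1 / 2)) * (ker (s + 1) (log3 (INR j)) - ker (s + 1) (log3 (INR
       j.+1))))%C.
  have -> : zeta_partial s j = (zeta_partial s B + ker s (log3 (INR j)))%C by [].
  rewrite !ker_succ !pow3_opp !pow3_log3 // /zeta_tail -/j.
  set k1 := ker s _; set k2 := ker s _; rewrite (S_INR j) (_ : INR B = INR j - 1);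
    last by rewrite S_INR; ring.
  rewrite S_INR in j1.
  have n1 : INR j <> 0 by lra. have n2 : INR j + 1 <> 0 by lra.
  move: (INR j) n1 n2 => J n1 n2; rewrite /plus /= /Cdiv.
  have -> : (/ 2)%C = RtoC (/ 2) by rewrite RtoC_inv.
  case: s k1 k2 {IH} (zeta_partial _ _) => s1 s2 [a1 a2] [b1 b2] [z1 z2].
  by apply: injective_projections => /=; rewrite /plus /=; field.
apply: (@is_RInt_Chasles C_R_NormedModule) IH _.
apply: (@is_RInt_ext C_R_NormedModule (fun x => (s + 1) * RtoC (INR j) * (s * RtoC (ln 3) * ker s
  x) +
   (- s * RtoC (INR j * INR j.+1 / 2)) * ((s + 1) * RtoC (ln 3) * ker (s + 1) x))%C) => [x hx|].
  have hl : log3 (INR j) <= log3 (INR j.+1) by apply: log3_le => //; rewrite S_INR; lra.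
  rewrite Rmin_left // Rmax_right // in hx.
  rewrite (@ramp_on j) // ?ker_succ; last by lra.
  move: (pow3 _) (ker _ _) (INR j) (INR j.+1) => P [a1 a2] J J1.
  by case: s => s1 s2; apply: injective_projections => /=; field.
apply: (@is_RInt_plus C_R_NormedModule); apply: is_RInt_Cmult; exact: is_RInt_ker.
Qed.

(** Substitution turns the range into [c, log3 (B + 1)], and [c, 0] contributes nothing because
    [ramp] vanishes there. *)
Lemma is_RInt_ramp_shift (s : C) (c b : R) (B : nat) :
  c <= 0 -> b + c = log3 (INR B.+1) ->
  @is_RInt C_R_NormedModule (fun x => (s * (s + 1) * RtoC (ln 3) * (RtoC (ramp (x + c)) * ker s
    x))%C)
    0 b (ker s (- c) * (zeta_partial s B - zeta_tail s B))%C.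
Proof.
move=> c0 hb; pose f x := (s * (s + 1) * RtoC (ln 3) * (RtoC (ramp x) * ker s x))%C.
pose g (x : R) : C_R_NormedModule := scal 1 (f (1 * x + c) : C_R_NormedModule).
apply: (@is_RInt_ext C_R_NormedModule (fun x => ker s (- c) * g x)%C) => [x _|].
  have -> : g x = f (x + c) by rewrite /g Rmult_1_l; exact: scal_one.
  rewrite /f.
  have -> : ker s x = (ker s (- c) * ker s (x + c))%C by rewrite -ker_plus; congr ker; ring.
  by Cring.
apply: is_RInt_Cmult; apply: (@is_RInt_comp_lin C_R_NormedModule).
rewrite Rmult_0_r Rplus_0_l Rmult_1_l hb.
have -> : (zeta_partial s B - zeta_tail s B)%C = plus (zero : C_R_NormedModule) (zeta_partial s B
  - zeta_tail s B)%C.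
  by rewrite plus_zero_l.
apply: (@is_RInt_Chasles C_R_NormedModule _ _ 0); last exact: is_RInt_ramp.
have := @is_RInt_const C_R_NormedModule c 0 zero; rewrite scal_zero_r.
apply: is_RInt_ext => x hx; rewrite Rmax_right // in hx.
rewrite /f ramp_nonpos; last by lra.
by change (@eq C (RtoC 0) (s * (s + 1) * RtoC (ln 3) * (RtoC 0 * ker s x))%C); ring.
Qed.

(** At the endpoint m + 2 all four translated endpoints are base-3 logarithms of integers, namely of
    2 * 3^(m+1), 2 * 3^m, 3^(m+1) and 3^m. The predecessors appear because [is_RInt_ramp] ends at
    log3 (B + 1). *)
Lemma is_RInt_wave (s : C) (m : nat) :
  @is_RInt C_R_NormedModule (fun x => (s * (s + 1) * RtoC (ln 3) * (RtoC (wave x) * ker s x))%C)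
    0 (INR m.+2)
    (let V B := zeta_partial s B - zeta_tail s B in
     ker s (- (log3 2 - 1)) * V (2 * expn 3 m.+1).-1 - RtoC 3 * (ker s (- (log3 2 - 2)) * V (2 *
       expn 3 m).-1)
     - ker s (- - 1) * V (expn 3 m.+1).-1 + RtoC 3 * (ker s (- - (2)) * V (expn 3 m).-1))%C.
Proof.
have p0 k : 0 < 3 ^ k by apply: pow_lt; lra.
have l3 : 0 < ln 3 by have := ln3_bounds; lra.
have lp k : log3 (3 ^ k) = INR k by rewrite /log3 ln_pow; [field|]; lra.
have l2p k : log3 (2 * 3 ^ k) = log3 2 + INR k.
  by rewrite /log3 ln_mult ?ln_pow; [field| | |]; try lra.
have l2 : log3 2 <= 1.
  have h : log3 2 <= log3 (3 ^ 1) by apply: log3_le; lra.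
  by rewrite lp in h; rewrite /= in h.
have pos k : (0 < expn 3 k)%nat by rewrite expn_gt0.
have pos2 k : (0 < 2 * expn 3 k)%nat by rewrite muln_gt0 pos.
move=> V.
apply: (@is_RInt_ext C_R_NormedModule (fun x =>
   (s * (s + 1) * RtoC (ln 3) * (RtoC (ramp (x + (log3 2 - 1))) * ker s x))
   - RtoC 3 * (s * (s + 1) * RtoC (ln 3) * (RtoC (ramp (x + (log3 2 - 2))) * ker s x))
   - (s * (s + 1) * RtoC (ln 3) * (RtoC (ramp (x + - 1)) * ker s x))
   + RtoC 3 * (s * (s + 1) * RtoC (ln 3) * (RtoC (ramp (x + - (2))) * ker s x)))%C) => [x _|].
  by rewrite wave_ramp !(RtoC_minus, RtoC_plus, RtoC_mult, RtoC_opp); Cring.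
apply: (@is_RInt_plus C_R_NormedModule); last first.
  apply: is_RInt_Cmult; apply: is_RInt_ramp_shift; first by lra.
  by rewrite prednK // INR_expn3 lp !S_INR; ring.
apply: (@is_RInt_minus C_R_NormedModule); last first.
  apply: is_RInt_ramp_shift; first by lra.
  by rewrite prednK // INR_expn3 lp !S_INR; ring.
apply: (@is_RInt_minus C_R_NormedModule).
  apply: is_RInt_ramp_shift; first by lra.
  by rewrite prednK // mult_INR INR_expn3 l2p !S_INR; ring.
apply: is_RInt_Cmult; apply: is_RInt_ramp_shift; first by lra.
by rewrite prednK // mult_INR INR_expn3 l2p !S_INR; ring.
Qed.

(** * The half-plane Re s > 1 *)

Definition is_clim (u : nat -> C) (l : C) : Prop :=
  is_lim_seq (fun n => Re (u n)) (Re l) /\ is_lim_seq (fun n => Im (u n)) (Im l).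

Lemma is_clim_ext (u v : nat -> C) (l : C) :
  (forall n, u n = v n) -> is_clim u l -> is_clim v l.
Proof. by move=> h [h1 h2]; split; [apply: is_lim_seq_ext h1|apply: is_lim_seq_ext h2] => n;
  rewrite h. Qed.

Lemma is_clim_unique (u : nat -> C) (l1 l2 : C) : is_clim u l1 -> is_clim u l2 -> l1 = l2.
Proof.
move=> [h1 h2] [h3 h4]; apply: injective_projections.
  by have := is_lim_seq_unique _ _ h1; rewrite (is_lim_seq_unique _ _ h3); case.
by have := is_lim_seq_unique _ _ h2; rewrite (is_lim_seq_unique _ _ h4); case.
Qed.

Lemma is_clim_plus (u v : nat -> C) (lu lv : C) :
  is_clim u lu -> is_clim v lv -> is_clim (fun n => (u n + v n)%C) (lu + lv)%C.
Proof. by move=> [h1 h2] [h3 h4]; split; apply: is_lim_seq_plus'. Qed.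

Lemma is_clim_Cmult (c : C) (u : nat -> C) (l : C) :
  is_clim u l -> is_clim (fun n => (c * u n)%C) (c * l)%C.
Proof.
case: c => c1 c2 [h1 h2]; split => /=.
  by apply: is_lim_seq_minus'; exact: is_lim_seq_scal_l (Finite _) _.
by apply: is_lim_seq_plus'; exact: is_lim_seq_scal_l (Finite _) _.
Qed.

Lemma is_clim_minus (u v : nat -> C) (lu lv : C) :
  is_clim u lu -> is_clim v lv -> is_clim (fun n => (u n - v n)%C) (lu - lv)%C.
Proof. by move=> [h1 h2] [h3 h4]; split; apply: is_lim_seq_minus'. Qed.

Lemma is_clim_subseq (u : nat -> C) (l : C) (phi : nat -> nat) :
  (forall n, (n <= phi n)%nat) -> is_clim u l -> is_clim (fun n => u (phi n)) l.
Proof.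
move=> hphi [h1 h2].
have hf : filterlim phi eventually eventually.
  by move=> P [N hN]; exists N => n hn; apply: hN; have := hphi n; lia.
by split; [apply: (is_lim_seq_subseq _ _ phi hf h1)|apply: (is_lim_seq_subseq _ _ phi hf h2)].
Qed.

Lemma is_clim_Cmod (u : nat -> C) (v : nat -> R) (l : C) :
  (forall n, Cmod (u n - l) <= v n) -> is_lim_seq v 0 -> is_clim u l.
Proof.
move=> huv hv.
have vm : is_lim_seq (fun n => - v n) 0.
  have h := proj1 (is_lim_seq_opp v 0) hv.
  by rewrite /= Ropp_0 in h.
have abs x y n : Rabs (x - y) <= v n -> - v n <= x - y <= v n by move/Rabs_le_between.
have key (f : C -> R) : (forall n, Rabs (f (u n) - f l) <= v n) -> is_lim_seq (fun n => f (u n))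
  (f l).
  move=> hf; apply: (is_lim_seq_ext (fun n => f (u n) - f l + f l)) => [n|]; first by ring.
  rewrite -[X in is_lim_seq _ (Finite X)](Rplus_0_l (f l)).
  apply: is_lim_seq_plus'; last exact: is_lim_seq_const.
  by apply: (is_lim_seq_le_le (fun n => - v n) _ v) => // n; apply: abs.
split; apply: key => n; apply: Rle_trans (huv n).
  exact: (Rle_trans _ _ _ (Rmax_l (Rabs (u n - l)%C.1) (Rabs (u n - l)%C.2)) (Rmax_Cmod (u n -
    l)%C)).
exact: (Rle_trans _ _ _ (Rmax_r (Rabs (u n - l)%C.1) (Rabs (u n - l)%C.2)) (Rmax_Cmod (u n - l)%C)).
Qed.

Lemma is_clim_series (a : nat -> C) (l : C) :
  @is_series C_AbsRing C_NormedModule a l -> is_clim (Csum a) l.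
Proof.
move=> ha.
have e n : Csum a n.+1 = @sum_n C_AbelianMonoid a n.
  elim: n => [|n IH]; first by rewrite sum_O /= Cplus_0_l.
  by rewrite sum_Sn -IH.
split; apply/is_lim_seq_incr_1; apply/is_lim_seq_spec => eps.
  have [N hN] := ha _ (ex_intro _ eps (fun y h => h)).
  by exists N => n hn; rewrite e; have [] := hN n hn.
have [N hN] := ha _ (ex_intro _ eps (fun y h => h)).
by exists N => n hn; rewrite e; have [] := hN n hn.
Qed.

Lemma is_clim_zeta (zeta : C -> C) (t y : R) : is_riemann_zeta zeta -> 1 < t ->
  is_clim (fun B => zeta_partial (t, y) B - zeta_tail (t, y) B)%C (zeta (t, y)).
Proof.
move=> [hz _] t1.
have -> : zeta (t, y) = (zeta (t, y) - 0)%C by ring.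
have l3 : 0 < ln 3 by have := ln3_bounds; lra.
have lnlog x : log3 x * ln 3 = ln x by rewrite /log3; field; lra.
apply: is_clim_minus.
  have := is_clim_series _ _ (hz (t, y) t1).
  apply: is_clim_ext; rewrite /zeta_partial => n.
  by elim: n => [|n /= ->] //; rewrite /Rcpow /ker lnlog.
pose K := Cmod ((t, y) / 2 + 1)%C.
apply: (is_clim_Cmod _ (fun B => K * exp ((1 - t) * ln (INR B.+1)))).
  move=> B; rewrite /zeta_tail.
  have -> : (ker (t, y) (log3 (INR B.+1)) * RtoC (INR B) * ((t, y) / 2 + 1) - 0)%C =
     (((t, y) / 2 + 1) * (ker (t, y) (log3 (INR B.+1)) * RtoC (INR B)))%C by ring.
  rewrite !Cmod_mult -/K; apply: Rmult_le_compat_l; first exact: Cmod_ge_0.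
  rewrite Cmod_ker lnlog Cmod_R Rabs_pos_eq; last exact: pos_INR.
  have b0 : 0 < INR B.+1 by apply: lt_0_INR; lia.
  have -> : (1 - t) * ln (INR B.+1) = - t * ln (INR B.+1) + ln (INR B.+1) by ring.
  rewrite exp_plus exp_ln //; apply: Rmult_le_compat_l; first exact: Rlt_le (exp_pos _).
  by rewrite S_INR; lra.
rewrite -[X in is_lim_seq _ (Finite X)](Rmult_0_r K).
apply: (is_lim_seq_scal_l _ K (Finite 0)).
have lnlim : is_lim_seq (fun n => ln (INR n.+1)) p_infty.
  apply: (is_lim_comp_seq ln _ p_infty p_infty); first exact: is_lim_ln_p.
    by exists 0%nat => n _.
  exact: (proj1 (is_lim_seq_incr_1 INR p_infty) is_lim_seq_INR).
apply: (is_lim_comp_seq exp _ m_infty 0); first exact: is_lim_exp_m.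
  by exists 0%nat => n _.
have e : Rbar_mult (1 - t) p_infty = m_infty.
  by apply: is_Rbar_mult_unique; apply: is_Rbar_mult_sym; apply: is_Rbar_mult_p_infty_neg => /=;
    lra.
by rewrite -e; exact: is_lim_seq_scal_l.
Qed.

(** * Analytic continuation to the imaginary axis *)

Definition wave_kernel (s : C) (x : R) : C := (RtoC (wave x) * ker s x)%C.

(** [Lim_seq] gives a value everywhere; it is the improper integral when Re s > -1, by
    [is_improper_wave_mellin]. *)
Definition wave_mellin (s : C) : C :=
  (real (Lim_seq (fun n => RInt (fun x => Re (wave_kernel s x)) 0 (INR n))),
   real (Lim_seq (fun n => RInt (fun x => Im (wave_kernel s x)) 0 (INR n)))).

Lemma wave_weight_decay (w : R -> R) (x : R) : Rabs (w x) <= 1 ->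
  Rabs (wave x * w x) <= 9 * exp (- ln 3 * x).
Proof.
move=> hw; rewrite Rabs_mult; have := wave_bound x; rewrite /pow3.
rewrite (_ : - x * ln 3 = - ln 3 * x); last by ring.
by have := Rabs_pos (wave x); have := Rabs_pos (w x); have := exp_pos (- ln 3 * x); nra.
Qed.

Lemma is_improper_wave (w : R -> R) (t : R) :
  (forall x, continuous w x) -> (forall x, Rabs (w x) <= 1) -> -1 < t ->
  is_improper (fun x => wave x * w x * exp (- t * (ln 3 * x)))
    (real (Lim_seq (fun n => RInt (fun x => wave x * w x * exp (- t * (ln 3 * x))) 0 (INR n)))).
Proof.
move=> wc hw ht; have l3 : 0 < ln 3 by have := ln3_bounds; lra.
have c0 : 0 < ln 3 * (1 + t) by nra.
have [x||l [[hc hl] _]] := @ex_improper (fun x => wave x * w x * exp (- t * (ln 3 * x))) 9 _ c0.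
- apply: (@continuous_mult _ R_AbsRing); first by apply: (@continuous_mult _ R_AbsRing) => //;
  exact: continuous_wave.
  by apply: (@ex_derive_continuous); auto_derive.
- move=> x _; rewrite Rabs_mult (Rabs_pos_eq (exp _)); last exact: Rlt_le (exp_pos _).
  rewrite (_ : - (ln 3 * (1 + t)) * x = - ln 3 * x + - t * (ln 3 * x)); last by ring.
  rewrite exp_plus -(Rmult_assoc 9); apply: Rmult_le_compat_r; first exact: Rlt_le (exp_pos _).
  exact: wave_weight_decay.
by rewrite (is_lim_seq_unique _ _ hl); split.
Qed.

Lemma Re_wave_kernel (t y x : R) :
  Re (wave_kernel (t, y) x) = wave x * cos (y * (x * ln 3)) * exp (- t * (ln 3 * x)).
Proof. by rewrite /wave_kernel kerE /= (Rmult_comm (ln 3)); ring. Qed.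

Lemma Im_wave_kernel (t y x : R) :
  Im (wave_kernel (t, y) x) = wave x * - sin (y * (x * ln 3)) * exp (- t * (ln 3 * x)).
Proof. by rewrite /wave_kernel kerE /= (Rmult_comm (ln 3)); ring. Qed.

Lemma Rabs_sin_opp_le1 (z : R) : Rabs (- sin z) <= 1.
Proof. by rewrite Rabs_Ropp; apply: Rabs_le; have := SIN_bound z; lra. Qed.

Lemma Rabs_cos_le1 (z : R) : Rabs (cos z) <= 1.
Proof. by apply: Rabs_le; have := COS_bound z; lra. Qed.

Lemma is_improper_wave_mellin (t y : R) : -1 < t ->
  is_improper (fun x => Re (wave_kernel (t, y) x)) (Re (wave_mellin (t, y))) /\
  is_improper (fun x => Im (wave_kernel (t, y) x)) (Im (wave_mellin (t, y))).
Proof.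
move=> ht; split.
  have h := @is_improper_wave (fun x => cos (y * (x * ln 3))) t.
  have {}h := h ltac:(move=> x; apply: (@ex_derive_continuous);
    auto_derive => //) ltac:(move=> x; exact: Rabs_cos_le1) ht.
  rewrite /wave_mellin /=; apply: (is_improper_ext _ _ _ (fun x => esym (Re_wave_kernel t y x))).
  rewrite (Lim_seq_ext _ (fun n => RInt (fun x => wave x * cos (y * (x * ln 3)) * exp (- t * (ln
    3 * x))) 0 (INR n))) // => n.
  by apply: RInt_ext => x _; exact: Re_wave_kernel.
have h := @is_improper_wave (fun x => - sin (y * (x * ln 3))) t.
have {}h := h ltac:(move=> x; apply: (@ex_derive_continuous); auto_derive => //) ltac:(move=> x;
  exact: Rabs_sin_opp_le1) ht.
rewrite /wave_mellin /=; apply: (is_improper_ext _ _ _ (fun x => esym (Im_wave_kernel t y x))).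
rewrite (Lim_seq_ext _ (fun n => RInt (fun x => wave x * - sin (y * (x * ln 3)) * exp (- t * (ln
  3 * x))) 0 (INR n))) // => n.
by apply: RInt_ext => x _; exact: Im_wave_kernel.
Qed.

(* 9^(-s) (2^s - 1) (3^s - 3), the factor 9^(-s) coming from the shift in wave. *)
Definition euler_factor (s : C) : C :=
  (ker s (- (log3 2 - 1)) - RtoC 3 * ker s (- (log3 2 - 2)) - ker s (- - 1) + RtoC 3 * ker s (- -
    (2)))%C.

(** The identity at the endpoints m + 2 passes to the limit because each of the four corrected
    partial sums, along its own sequence of indices, tends to zeta s. *)
Lemma wave_mellin_zeta (zeta : C -> C) (t y : R) : is_riemann_zeta zeta -> 1 < t ->
  let s : C := (t, y) in
  (s * (s + 1) * RtoC (ln 3) * wave_mellin s)%C = (euler_factor s * zeta s)%C.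
Proof.
move=> hz t1 s; have [hr hi] := @is_improper_wave_mellin t y ltac:(lra).
have hV := is_clim_zeta zeta t y hz t1; rewrite -/s in hV hr hi *.
pose W n : C := (RInt (fun x => Re (wave_kernel s x)) 0 (INR n), RInt (fun x => Im (wave_kernel s
  x)) 0 (INR n)).
have hW n : @is_RInt C_R_NormedModule (wave_kernel s) 0 (INR n) (W n).
  by apply: is_RInt_C; apply/RInt_correct/ex_RInt_cont; [case: hr|case: hi].
have limW : is_clim W (wave_mellin s) by split; [case: hr|case: hi].
have limW' := is_clim_Cmult (s * (s + 1) * RtoC (ln 3))%C _ _
   (is_clim_subseq W _ (fun m => m.+2) ltac:(move=> n; lia) limW).
apply: (is_clim_unique _ _ _ limW').
have e3 m : (m < expn 3 m)%nat by rewrite ltn_expl.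
have S1 := is_clim_subseq _ _ (fun m => (2 * expn 3 m.+1).-1) ltac:(move=> n; have := e3 n;
  rewrite expnS; lia) hV.
have S2 := is_clim_subseq _ _ (fun m => (2 * expn 3 m).-1) ltac:(move=> n; have := e3 n; lia) hV.
have S3 := is_clim_subseq _ _ (fun m => (expn 3 m.+1).-1) ltac:(move=> n; have := e3 n;
  rewrite expnS; lia) hV.
have S4 := is_clim_subseq _ _ (fun m => (expn 3 m).-1) ltac:(move=> n; have := e3 n; lia) hV.
have -> : (euler_factor s * zeta s)%C =
   (ker s (- (log3 2 - 1)) * zeta s - RtoC 3 * (ker s (- (log3 2 - 2)) * zeta s)
     - ker s (- - 1) * zeta s + RtoC 3 * (ker s (- - (2)) * zeta s))%C.
  by rewrite /euler_factor; ring.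
apply: is_clim_ext; last first.
  apply: is_clim_plus; last by apply: is_clim_Cmult; apply: is_clim_Cmult; exact: S4.
  apply: is_clim_minus; last by apply: is_clim_Cmult; exact: S3.
  apply: is_clim_minus; last by apply: is_clim_Cmult; apply: is_clim_Cmult; exact: S2.
  by apply: is_clim_Cmult; exact: S1.
move=> m /=.
have h1 := is_RInt_wave s m;
  have h2 := is_RInt_Cmult (s * (s + 1) * RtoC (ln 3))%C _ _ _ _ (hW m.+2).
have un (l1 l2 : C) (f : R -> C) b : @is_RInt C_R_NormedModule f 0 b l1 -> @is_RInt
  C_R_NormedModule f 0 b l2 -> l1 = l2.
  move=> g1 g2; apply: injective_projections.
    exact: (filterlim_locally_unique _ _ _ (is_RInt_Re _ _ _ _ g1) (is_RInt_Re _ _ _ _ g2)).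
  exact: (filterlim_locally_unique _ _ _ (is_RInt_Im _ _ _ _ g1) (is_RInt_Im _ _ _ _ g2)).
exact: (un _ _ _ _ h1 h2).
Qed.

Definition line_analytic (f : R -> C) (t : R) : Prop :=
  real_analytic_at (fun u => Re (f u)) t /\ real_analytic_at (fun u => Im (f u)) t.

Lemma line_analytic_plus (f g : R -> C) (t : R) :
  line_analytic f t -> line_analytic g t -> line_analytic (fun u => (f u + g u)%C) t.
Proof. by move=> [h1 h2] [h3 h4]; split; apply: real_analytic_plus. Qed.

Lemma line_analytic_mult (f g : R -> C) (t : R) :
  line_analytic f t -> line_analytic g t -> line_analytic (fun u => (f u * g u)%C) t.
Proof.
move=> [h1 h2] [h3 h4]; split.
  apply: (real_analytic_ext (fun u => Re (f u) * Re (g u) + -1 * (Im (f u) * Im (g u)))).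
    by move=> u; case: (f u) (g u) => [a b] [c d] /=; ring.
  by apply: real_analytic_plus; [|apply: real_analytic_scal]; apply: real_analytic_mult.
by apply: real_analytic_plus; apply: real_analytic_mult.
Qed.

Lemma line_analytic_const (c : C) (t : R) : line_analytic (fun=> c) t.
Proof. by split; exact: real_analytic_const. Qed.

Lemma line_analytic_opp (f : R -> C) (t : R) :
  line_analytic f t -> line_analytic (fun u => - f u)%C t.
Proof.
move=> h; have [h1 h2] := line_analytic_mult _ _ _ (line_analytic_const (RtoC (-1)) t) h.
by split; [apply: real_analytic_ext h1|apply: real_analytic_ext h2] => u;
  case: (f u) => [a b] /=; ring.
Qed.

Lemma line_analytic_id (y t : R) : line_analytic (fun u => (u, y)) t.
Proof. by split; [exact: real_analytic_id|exact: real_analytic_const]. Qed.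

Lemma line_analytic_ker (y x t : R) : line_analytic (fun u => ker (u, y) x) t.
Proof.
split.
  apply: (real_analytic_ext (fun u => cos (y * (x * ln 3)) * exp (- (x * ln 3) * u))).
    by move=> u; rewrite kerE /= (_ : - (x * ln 3) * u = - u * (x * ln 3)); ring.
  by apply: real_analytic_scal; exact: real_analytic_exp.
apply: (real_analytic_ext (fun u => - sin (y * (x * ln 3)) * exp (- (x * ln 3) * u))).
  by move=> u; rewrite kerE /= (_ : - (x * ln 3) * u = - u * (x * ln 3)); ring.
by apply: real_analytic_scal; exact: real_analytic_exp.
Qed.

Lemma line_analytic_wave_mellin (y t : R) : -1 < t -> line_analytic (fun u => wave_mellin (u, y)) t.
Proof.
have l3 : 0 < ln 3 by have := ln3_bounds; lra.
move=> ht; split.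
  apply: (@real_analytic_laplace (ln 3) 9 (fun x => wave x * cos (y * (x * ln 3)))) => // [x|x
    _|u hu].
  - apply: (@continuous_mult _ R_AbsRing); first exact: continuous_wave.
    by apply: (@ex_derive_continuous); auto_derive.
  - by apply: (wave_weight_decay (fun x => cos (y * (x * ln 3)))); exact: Rabs_cos_le1.
  - apply: (is_improper_ext _ _ _ (Re_wave_kernel u y)).
    by have [] := @is_improper_wave_mellin u y hu.
apply: (@real_analytic_laplace (ln 3) 9 (fun x => wave x * - sin (y * (x * ln 3)))) => // [x|x
  _|u hu].
- apply: (@continuous_mult _ R_AbsRing); first exact: continuous_wave.
  by apply: (@ex_derive_continuous); auto_derive.
- by apply: (wave_weight_decay (fun x => - sin (y * (x * ln 3)))); exact: Rabs_sin_opp_le1.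
- apply: (is_improper_ext _ _ _ (Im_wave_kernel u y)).
  by have [] := @is_improper_wave_mellin u y hu.
Qed.

(** On a horizontal line the increment z - s is a real d, so the real and imaginary parts of the
    coefficients give two real power series in d. *)
Lemma line_analytic_of_analytic (f : C -> C) (t y : R) :
  analytic_at f (t, y) -> line_analytic (fun u => f (u, y)) t.
Proof.
move=> [r [a ha]].
have hd d : Rabs d < r -> @is_series C_AbsRing C_NormedModule (fun k => (RtoC (d ^ k) * a k)%C)
  (f ((t + d)%R, y)).
  move=> hd; have := ha ((t + d)%R, y).
  have -> : (((t + d)%R, y) - (t, y))%C = RtoC d by apply: injective_projections => /=; ring.
  rewrite Cmod_R => /(_ hd); rewrite /is_pseries; apply: is_series_ext => k.
  have -> : @pow_n C_AbsRing (RtoC d) k = RtoC (d ^ k).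
    by elim: k => [|k IH] //=; rewrite IH RtoC_mult.
  by [].
split.
  exists (fun k => Re (a k)), r => d /hd /is_clim_series [h _]; apply/is_pseries_R.
  apply: (_ : is_lim_seq _ (Finite _));
    apply: is_lim_seq_ext (proj1 (is_lim_seq_incr_1 _ _) h) => n.
  elim: n => [|n IH]; first by rewrite sum_O /Re /Im /=; ring.
  by rewrite sum_Sn -IH /plus /Re /Im /=; ring.
exists (fun k => Im (a k)), r => d /hd /is_clim_series [_ h]; apply/is_pseries_R.
apply: (_ : is_lim_seq _ (Finite _)); apply: is_lim_seq_ext (proj1 (is_lim_seq_incr_1 _ _) h) => n.
elim: n => [|n IH]; first by rewrite sum_O /Re /Im /=; ring.
by rewrite sum_Sn -IH /plus /Re /Im /=; ring.
Qed.

Lemma sin_2piZ (k : Z) : sin (2 * IZR k * PI) = 0.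
Proof. by apply: sin_eq_0_1; exists (2 * k)%Z; rewrite mult_IZR. Qed.

Lemma cos_2piZ (k : Z) : cos (2 * IZR k * PI) = 1.
Proof.
rewrite Rmult_assoc cos_2a_sin sin_eq_0_1; last by exists k.
by ring.
Qed.

Lemma chiE (k : Z) : chi k = (0, 2 * IZR k * PI / ln 3).
Proof.
rewrite /chi /Cdiv -RtoC_inv; last by have := ln3_bounds; lra.
by apply: injective_projections => /=; rewrite /Rdiv; ring.
Qed.

Lemma coef_wave_mellin (zeta : C -> C) (k : Z) : is_riemann_zeta zeta -> k <> 0%Z ->
  coef zeta k = wave_mellin (chi k).
Proof.
move=> hz k0; have l3 : 0 < ln 3 by have := ln3_bounds; lra.
set y := 2 * IZR k * PI / ln 3.
(* Used twice: the horizontal line avoids the pole at 1, and s does not vanish at its end point on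
   the imaginary axis. *)
have y0 : y <> 0.
  have p0 := PI_RGT_0; have k0' : IZR k <> 0 by apply: not_0_IZR.
  by apply: Rmult_integral_contrapositive; split; [nra|apply: Rinv_neq_0_compat; lra].
have ylx x : y * (x * ln 3) = 2 * IZR k * PI * x by rewrite /y; field; lra.
pose f u := ((u, y) * ((u, y) + 1) * RtoC (ln 3) * wave_mellin (u, y)
              + - (euler_factor (u, y) * zeta (u, y)))%C.
have fan t : 0 <= t -> line_analytic f t.
  move=> t0; apply: line_analytic_plus.
    apply: line_analytic_mult; last by apply: line_analytic_wave_mellin; lra.
    apply: line_analytic_mult; last exact: line_analytic_const.
    apply: line_analytic_mult; first exact: line_analytic_id.
    by apply: line_analytic_plus; [exact: line_analytic_id|exact: line_analytic_const].
  apply: line_analytic_opp; apply: line_analytic_mult; last first.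
    by apply: line_analytic_of_analytic; apply: (proj2 hz) => -[_].
  rewrite /euler_factor; apply: line_analytic_plus; last first.
    by apply: line_analytic_mult; [exact: line_analytic_const|exact: line_analytic_ker].
  apply: line_analytic_plus; last by apply: line_analytic_opp; exact: line_analytic_ker.
  apply: line_analytic_plus; first exact: line_analytic_ker.
  apply: line_analytic_opp; apply: line_analytic_mult; first exact: line_analytic_const.
  exact: line_analytic_ker.
have f1 t : 1 < t -> f t = 0%C.
  by move=> t1; rewrite /f (wave_mellin_zeta zeta t y hz t1); ring.
have f0 : f 0 = 0%C.
  apply: injective_projections.
    apply: (real_analytic_identity (fun u => Re (f u)) 1) => [t t0|t t1]; last by rewrite f1.
    by have [] := fan t t0.
  apply: (real_analytic_identity (fun u => Im (f u)) 1) => [t t0|t t1]; last by rewrite f1.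
  by have [] := fan t t0.
(* As 3^(-s) = 1 at s = chi k, integer shifts drop out of [euler_factor]: with X = 2^(-s) or its
   equal under [e2], only the translation by log3 2 is still visible. *)
have per : ker (0, y) 1 = 1%C.
  rewrite kerE ylx Rmult_1_r cos_2piZ sin_2piZ.
  by rewrite Ropp_0 Rmult_0_l exp_0; apply: injective_projections => /=; ring.
have e2 : ker (0, y) (- log3 2) = Rcpow 2 (chi k).
  rewrite /ker /Rcpow chiE -/y; congr Cexp.
  rewrite (_ : - log3 2 * ln 3 = - ln 2); last by rewrite /log3; field; lra.
  by rewrite RtoC_opp; ring.
have ef : euler_factor (0, y) = (RtoC 2 * (1 - Rcpow 2 (chi k)))%C.
  rewrite /euler_factor.
  rewrite (_ : - (log3 2 - 1) = - log3 2 + 1); last by ring.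
  rewrite (_ : - (log3 2 - 2) = - log3 2 + 1 + 1); last by ring.
  rewrite (_ : - - 1 = 1); last by ring.
  rewrite (_ : - - (2) = 1 + 1); last by ring.
  rewrite !ker_plus per e2.
  have -> : (RtoC 2 = RtoC 3 - 1)%C by rewrite -RtoC_minus; congr RtoC; ring.
  ring.
rewrite /coef -ef chiE -/y.
have nz : ((0, y) * (1 + (0, y)) * RtoC (ln 3))%C <> 0%C.
  repeat apply: Cmult_neq_0.
  - by case.
  - by case; rewrite Rplus_0_r; lra.
  - by move/RtoC_inj; lra.
have hf : ((0, y) * (1 + (0, y)) * RtoC (ln 3) * wave_mellin (0, y))%C = (euler_factor (0, y) *
  zeta (0, y))%C.
  transitivity (f 0 + euler_factor (0, y) * zeta (0, y))%C; first by rewrite /f; ring.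
  by rewrite f0; ring.
rewrite -hf; move: nz; set c := ((0%R, y) * _ * _)%C => nz.
by field.
Qed.

(** * Fourier coefficients of the fluctuation *)

(** The factor j + 1 is absorbed by 4 (5/4)^j, and 5/12 is 5/4 times 1/3. The ratio 5/12 is below 1
    / sqrt 3, which means a Hoelder exponent above 1/2. *)
Lemma pwave_modulus_geom (x y : R) (j : nat) : Rabs (x - y) <= / 3 ^ j ->
  Rabs (pwave x - pwave y) <= 2916 * (5 / 12) ^ j.
Proof.
move=> h; apply: Rle_trans (pwave_modulus _ _ _ h) _.
have j0 : 0 < / 3 ^ j by apply: Rinv_0_lt_compat; apply: pow_lt; lra.
have -> : 2916 * (5 / 12) ^ j = 729 * (4 * (5 / 4) ^ j) / 3 ^ j.
  rewrite (_ : 5 / 12 = 5 / 4 * / 3); last by field.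
  by rewrite Rpow_mult_distr pow_inv; field; apply: pow_nonzero; lra.
apply: Rmult_le_compat_r; first exact: Rlt_le.
apply: Rmult_le_compat_l; first by lra.
suff : INR j + 4 <= 4 * (5 / 4) ^ j by lra.
elim: j {h j0} => [|j IH]; first by rewrite /=; lra.
by rewrite S_INR; have := pos_INR j; rewrite /=; lra.
Qed.

Lemma pow_lt_eps (r eps : R) : 0 <= r < 1 -> 0 < eps -> exists n, r ^ n < eps.
Proof.
move=> hr e0; have [n hn] := pow_lt_1_zero r ltac:(rewrite Rabs_pos_eq; lra) eps e0.
exists n; have := hn n (le_n n); rewrite Rabs_pos_eq //; apply: pow_le; lra.
Qed.

Lemma continuous_pwave (x : R) : continuous pwave x.
Proof.
apply/filterlim_locally => eps.
have [j hj] := pow_lt_eps (5 / 12) (eps / 2916) ltac:(lra) ltac:(have := cond_pos eps; lra).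
have d0 : 0 < / 3 ^ j by apply: Rinv_0_lt_compat; apply: pow_lt; lra.
exists (mkposreal _ d0) => z hz; apply: Rle_lt_trans (pwave_modulus_geom z x j _) _.
  exact: Rlt_le hz.
lra.
Qed.

(** Cut into unit intervals, the integral of [wave] times w over [0, n] becomes, by periodicity of
    w, that of the first n terms of the series over [0, 1]; the tail is uniformly of order 3^-n. *)
Lemma is_RInt_pwave (w : R -> R) (l : R) :
  (forall x, continuous w x) -> (forall x, Rabs (w x) <= 1) -> (forall x, w (x + 1) = w x) ->
  is_improper (fun x => wave x * w x) l -> is_RInt (fun x => pwave x * w x) 0 1 l.
Proof.
move=> wc wb wp [_ hl].
have fc x : continuous (fun x => wave x * w x) x.
  by apply: (@continuous_mult _ R_AbsRing) => //; exact: continuous_wave.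
have pc x : continuous (fun x => pwave x * w x) x.
  by apply: (@continuous_mult _ R_AbsRing) => //; exact: continuous_pwave.
have wpn x n : w (x + INR n) = w x.
  elim: n => [|n IH]; first by rewrite Rplus_0_r.
  by rewrite S_INR -Rplus_assoc wp.
have part n : is_RInt (fun x => Rsum (fun m => wave (x + INR m)) n * w x) 0 1
    (RInt (fun x => wave x * w x) 0 (INR n)).
  elim: n => [|n IH].
    rewrite RInt_point; have := @is_RInt_const R_NormedModule 0 1 0; rewrite scal_zero_r.
    by apply: is_RInt_ext => x _; rewrite /= Rmult_0_l.
  rewrite -(RInt_Chasles _ 0 (INR n) (INR n.+1)); try exact: ex_RInt_cont.
  apply: (is_RInt_ext (fun x => plus (Rsum (fun m => wave (x + INR m)) n * w x) (scal 1 (wave (1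
    * x + INR n) * w (1 * x + INR n))))).
    move=> x _; rewrite Rmult_1_l wpn /plus /scal /= /mult /=; ring.
  apply: is_RInt_plus => //; apply: (is_RInt_comp_lin (fun x => wave x * w x) 1 (INR n)).
  rewrite Rmult_0_r Rplus_0_l Rmult_1_l S_INR (Rplus_comm 1).
  exact/RInt_correct/ex_RInt_cont.
have hp := RInt_correct _ _ _ (ex_RInt_cont _ 0 1 pc).
have bnd n : Rabs (RInt (fun x => wave x * w x) 0 (INR n) - RInt (fun x => pwave x * w x) 0 1) <=
  81 / 2 * (/ 3) ^ n.
  have h := is_RInt_minus _ _ _ _ _ _ (part n) hp.
  have h2 : forall x, 0 <= x <= 1 -> Rabs (minus (Rsum (fun m => wave (x + INR m)) n * w x)
    (pwave x * w x)) <= 81 / 2 * (/ 3) ^ n.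
    move=> x hx; rewrite (@pwave_eq 0) ?Rminus_0_r; last by lra.
    rewrite (@wave_sum_split _ n) /minus /plus /opp /=.
    set s := Rsum _ _; set r := wave_sum _.
    have -> : s * w x + - ((s + r) * w x) = - (r * w x) by ring.
    rewrite Rabs_Ropp Rabs_mult.
    have h3 : Rabs r <= 81 / 2 * (/ 3) ^ n.
      apply: Rle_trans (wave_sum_bound _) _;
        rewrite Ropp_plus_distr pow3_add [pow3 (- INR n)]pow3_opp pow3_INR -pow_inv.
      have p := pow_le (/ 3) n ltac:(lra).
      have := @pow3_le (- x) 1 ltac:(lra); rewrite pow3_1; have := pow3_gt0 (- x); nra.
    have := wb x; have := Rabs_pos (w x); have := Rabs_pos r; nra.
  have := @norm_RInt_le_const R_NormedModule _ 0 1 _ _ Rle_0_1 h2 h.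
  by rewrite Rminus_0_r Rmult_1_l.
suff -> : l = RInt (fun x => pwave x * w x) 0 1 by [].
suff h : is_lim_seq (fun n => RInt (fun x => wave x * w x) 0 (INR n)) (RInt (fun x => pwave x * w
  x) 0 1).
  by have := is_lim_seq_unique _ _ h; rewrite (is_lim_seq_unique _ _ hl); case.
apply/is_lim_seq_spec => eps; have e0 := cond_pos eps.
have [n0 hn0] := pow_lt_eps (/ 3) (2 / 81 * eps) ltac:(lra) ltac:(lra).
exists n0 => n hn; apply: Rle_lt_trans (bnd n) _.
suff : (/ 3) ^ n <= (/ 3) ^ n0 by lra.
rewrite !pow_inv; apply: Rinv_le_contravar; first by apply: pow_lt; lra.
by apply: Rle_pow; [lra|].
Qed.

Lemma continuous_ramp (x : R) : continuous ramp x.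
Proof.
have c1 : continuous pow3 x := continuous_pow3 x.
apply: (@continuous_mult _ R_AbsRing).
  apply: (continuous_comp pow3 floor_int) => //.
  apply: (@continuous_plus _ R_AbsRing R_NormedModule); last exact: continuous_saw.
  by apply: (@ex_derive_continuous); auto_derive.
apply: (continuous_comp pow3 Rinv) => //.
by apply: continuous_Rinv; apply: Rgt_not_eq; exact: pow3_gt0.
Qed.

(** [wave] is e(x + log3 2) - e(x) with e = 0 for x <= 1 and e tending to 1 at infinity, so the
    integral over [0, n] collapses to that of e over [n, n + log3 2], which tends to log3 2. *)
Lemma is_improper_wave_mean : is_improper wave (log3 2).
Proof.
split; first exact: continuous_wave.
pose e x := ramp (x - 1) - 3 * ramp (x - 2).
have ec x : continuous e x.
  apply: (@continuous_minus _ R_AbsRing R_NormedModule).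
    apply: (continuous_comp (fun x => x - 1) ramp); last exact: continuous_ramp.
    by apply: (@ex_derive_continuous); auto_derive.
  apply: (@continuous_scal_r _ R_AbsRing R_NormedModule).
  apply: (continuous_comp (fun x => x - 2) ramp); last exact: continuous_ramp.
  by apply: (@ex_derive_continuous); auto_derive.
set l2 := log3 2.
have l20 : 0 <= l2 by rewrite -(_ : log3 1 = 0); [apply: log3_le; lra|rewrite /log3 ln_1 Rdiv_0_l].
have l21 : l2 <= 1.
  rewrite -(_ : log3 3 = 1); first by apply: log3_le; lra.
  by rewrite /log3; field; have := ln3_bounds; lra.
have we x : wave x = e (x + l2) - e x.
  rewrite wave_ramp /e -/l2 (_ : x + - 1 = x - 1); last by ring.
  rewrite (_ : x + - (2) = x - 2) //.
  rewrite (_ : x + l2 - 1 = x + (l2 - 1)); last by ring.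
  rewrite (_ : x + l2 - 2 = x + (l2 - 2)); last by ring.
  by ring.
have e0 x : x <= 1 -> e x = 0 by move=> hx; rewrite /e !ramp_nonpos; lra.
(* The limit 1 is the polynomial part (3T - 1)/2 - 3 (T - 1)/2. *)
have e1 x : Rabs (e x - 1) <= 9 * pow3 (- x).
  rewrite /e /ramp; set T := pow3 (x - 2); have T0 : 0 < T := pow3_gt0 _.
  have -> : pow3 (x - 1) = 3 * T.
    have -> : x - 1 = x - 2 + 1 by ring.
    by rewrite (pow3_add (x - 2)) pow3_1 -/T Rmult_comm.
  have -> : 9 * pow3 (- x) = / T.
    rewrite -pow3_opp (_ : - (x - 2) = - - (2) + - x); last by ring.
    by rewrite pow3_add [pow3 (- - _)]pow3_opp pow3_m2; field.
  have -> : floor_int (3 * T) / (3 * T) - 3 * (floor_int T / T) - 1 = (saw (3 * T) / 3 - 3 * saw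
    T) * / T.
    by rewrite /floor_int; field; lra.
  rewrite Rabs_mult (Rabs_pos_eq (/ T)); last by apply: Rlt_le; apply: Rinv_0_lt_compat.
  rewrite -[X in _ <= X]Rmult_1_l; apply: Rmult_le_compat_r; first by apply: Rlt_le;
    apply: Rinv_0_lt_compat.
  by have := saw_bounds (3 * T); have := saw_bounds T => *; apply: Rabs_le; lra.
have int n : RInt wave 0 (INR n) = RInt e (INR n) (INR n + l2).
  have h1 : is_RInt (fun x => minus (scal 1 (e (1 * x + l2))) (e x)) 0 (INR n)
      (minus (RInt e l2 (INR n + l2)) (RInt e 0 (INR n))).
    apply: is_RInt_minus; last exact/RInt_correct/ex_RInt_cont.
    apply: (is_RInt_comp_lin e 1 l2); rewrite Rmult_0_r Rplus_0_l Rmult_1_l.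
    exact/RInt_correct/ex_RInt_cont.
  have -> : RInt wave 0 (INR n) = minus (RInt e l2 (INR n + l2)) (RInt e 0 (INR n)).
    apply: is_RInt_unique; apply: is_RInt_ext h1 => x _.
    by rewrite we Rmult_1_l /minus /scal /plus /opp /= /mult /=; ring.
  have h2 : RInt e 0 l2 = 0.
    rewrite (RInt_ext _ (fun=> 0)); first by rewrite RInt_const /scal /= /mult /=; ring.
    by move=> x; rewrite Rmax_right // => hx; rewrite e0; lra.
  have h3 := RInt_Chasles e 0 l2 (INR n + l2) (ex_RInt_cont _ _ _ ec) (ex_RInt_cont _ _ _ ec).
  have h4 := RInt_Chasles e 0 (INR n) (INR n + l2) (ex_RInt_cont _ _ _ ec) (ex_RInt_cont _ _ _ ec).
  rewrite /minus /plus /opp /= in h3 h4 *; lra.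
apply/is_lim_seq_spec => eps; have eps0 := cond_pos eps.
have [n0 hn0] := pow_lt_eps (/ 3) (/ 9 * eps) ltac:(lra) ltac:(lra).
exists n0 => n hn; rewrite int.
have h := is_RInt_minus _ _ _ _ _ _ (RInt_correct _ _ _ (ex_RInt_cont _ (INR n) (INR n + l2) ec))
   (@is_RInt_const R_NormedModule (INR n) (INR n + l2) 1).
have hb : forall x, INR n <= x <= INR n + l2 -> Rabs (minus (e x) 1) <= 9 * (/ 3) ^ n0.
  move=> x hx; apply: Rle_trans (e1 x) _; apply: Rmult_le_compat_l; first by lra.
  rewrite pow_inv -pow3_INR -pow3_opp; apply: pow3_le.
  by have := le_INR _ _ hn; lra.
have hab : INR n <= INR n + l2 by lra.
have := @norm_RInt_le_const R_NormedModule _ _ _ _ _ hab hb h.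
rewrite /norm /= /abs /minus /plus /opp /scal /= /mult /=.
rewrite (_ : INR n + l2 - INR n = l2) ?Rmult_1_r; last by ring.
move=> h1; apply: Rle_lt_trans h1 _; have := pow_le (/ 3) n0 ltac:(lra); nra.
Qed.

Lemma is_RInt_pwave_mean : is_RInt pwave 0 1 (log3 2).
Proof.
apply: (is_RInt_ext (fun x => pwave x * 1)) => [x _|]; first by rewrite Rmult_1_r.
apply: (is_RInt_pwave (fun=> 1)) => // [x|x|]; first exact: continuous_const.
  by rewrite Rabs_R1; lra.
by apply: is_improper_ext is_improper_wave_mean => x; rewrite Rmult_1_r.
Qed.

Lemma coef_pwave (zeta : C -> C) (k : Z) : is_riemann_zeta zeta -> k <> 0%Z ->
  is_RInt (fun x => pwave x * cos (2 * IZR k * PI * x)) 0 1 (Re (coef zeta k)) /\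
  is_RInt (fun x => pwave x * - sin (2 * IZR k * PI * x)) 0 1 (Im (coef zeta k)).
Proof.
move=> hz k0; rewrite (coef_wave_mellin _ _ hz k0) chiE; set y := _ / _.
have ylx x : y * (x * ln 3) = 2 * IZR k * PI * x by rewrite /y; field; have := ln3_bounds; lra.
have per x : 2 * IZR k * PI * (x + 1) = 2 * IZR k * PI * x + 2 * IZR k * PI by ring.
have [h1 h2] := @is_improper_wave_mellin 0 y ltac:(lra).
split.
  apply: is_RInt_pwave => [x|x|x|].
  - by apply: (@ex_derive_continuous); auto_derive.
  - exact: Rabs_cos_le1.
  - by rewrite per cos_plus cos_2piZ sin_2piZ; ring.
  apply: is_improper_ext h1 => x; rewrite Re_wave_kernel ylx.
  by rewrite Ropp_0 Rmult_0_l exp_0 Rmult_1_r.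
apply: (is_RInt_pwave (fun x => - sin (2 * IZR k * PI * x))) => [x|x|x|].
- by apply: (@ex_derive_continuous); auto_derive.
- exact: Rabs_sin_opp_le1.
- by rewrite per sin_plus cos_2piZ sin_2piZ; ring.
apply: is_improper_ext h2 => x; rewrite Im_wave_kernel ylx.
by rewrite Ropp_0 Rmult_0_l exp_0 Rmult_1_r.
Qed.

(** * Fourier coefficients and Bessel's inequality *)

Definition cosZ (k : Z) (x : R) : R := cos (2 * IZR k * PI * x).
Definition sinZ (k : Z) (x : R) : R := sin (2 * IZR k * PI * x).

Lemma continuous_cosZ (k : Z) (x : R) : continuous (cosZ k) x.
Proof. by apply: (@ex_derive_continuous); rewrite /cosZ; auto_derive. Qed.

Lemma continuous_sinZ (k : Z) (x : R) : continuous (sinZ k) x.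
Proof. by apply: (@ex_derive_continuous); rewrite /sinZ; auto_derive. Qed.

Lemma cosZ_0 (x : R) : cosZ 0 x = 1.
Proof. by rewrite /cosZ !(Rmult_0_r, Rmult_0_l) cos_0. Qed.

Lemma sinZ_0 (x : R) : sinZ 0 x = 0.
Proof. by rewrite /sinZ !(Rmult_0_r, Rmult_0_l) sin_0. Qed.

Lemma angleZ_add1 (k : Z) (x : R) : 2 * IZR k * PI * (x + 1) = 2 * IZR k * PI * x + 2 * IZR k * PI.
Proof. by ring. Qed.

Lemma cosZ_add1 (k : Z) (x : R) : cosZ k (x + 1) = cosZ k x.
Proof. by rewrite /cosZ angleZ_add1 cos_plus cos_2piZ sin_2piZ; ring. Qed.

Lemma sinZ_add1 (k : Z) (x : R) : sinZ k (x + 1) = sinZ k x.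
Proof. by rewrite /sinZ angleZ_add1 sin_plus cos_2piZ sin_2piZ; ring. Qed.

Lemma cosZ_shift (k : Z) (x a : R) : cosZ k (x + a) = cosZ k x * cosZ k a - sinZ k x * sinZ k a.
Proof. by rewrite /cosZ Rmult_plus_distr_l cos_plus. Qed.

Lemma sinZ_shift (k : Z) (x a : R) : sinZ k (x + a) = sinZ k x * cosZ k a + cosZ k x * sinZ k a.
Proof. by rewrite /sinZ Rmult_plus_distr_l sin_plus. Qed.

Lemma Rabs_cosZ (k : Z) (x : R) : Rabs (cosZ k x) <= 1.
Proof. exact: Rabs_cos_le1. Qed.

Lemma Rabs_sinZ (k : Z) (x : R) : Rabs (sinZ k x) <= 1.
Proof. by rewrite -Rabs_Ropp; exact: Rabs_sin_opp_le1. Qed.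

Lemma angle_neq0 (k : Z) : k <> 0%Z -> 2 * IZR k * PI <> 0.
Proof.
move=> /not_0_IZR k0; apply: Rmult_integral_contrapositive_currified; last exact: PI_neq0.
by apply: Rmult_integral_contrapositive_currified => //; lra.
Qed.

Lemma is_RInt_cosZ (k : Z) : k <> 0%Z -> is_RInt (cosZ k) 0 1 0.
Proof.
move=> k0; have c0 := angle_neq0 k k0.
pose F x := sin (2 * IZR k * PI * x) / (2 * IZR k * PI).
rewrite [X in is_RInt _ _ _ X](_ : 0 = minus (F 1) (F 0)); last first.
  by rewrite /F Rmult_1_r sin_2piZ Rmult_0_r sin_0 /minus /plus /opp /=; field; have := PI_neq0;
    have := not_0_IZR _ k0; split.
apply: (@is_RInt_derive R_CompleteNormedModule F) => x _; last exact: continuous_cosZ.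
by rewrite /F; auto_derive => //; rewrite /cosZ; field; have := PI_neq0; have := not_0_IZR _ k0;
  split.
Qed.

Lemma is_RInt_sinZ (k : Z) : is_RInt (sinZ k) 0 1 0.
Proof.
have [->|k0] := Z.eq_dec k 0.
  have := @is_RInt_const R_NormedModule 0 1 0; rewrite scal_zero_r.
  by apply: is_RInt_ext => x _; rewrite sinZ_0.
have c0 := angle_neq0 k k0.
pose F x := - cos (2 * IZR k * PI * x) / (2 * IZR k * PI).
rewrite [X in is_RInt _ _ _ X](_ : 0 = minus (F 1) (F 0)); last first.
  by rewrite /F Rmult_1_r cos_2piZ Rmult_0_r cos_0 /minus /plus /opp /=; field; have := PI_neq0;
    have := not_0_IZR _ k0; split.
apply: (@is_RInt_derive R_CompleteNormedModule F) => x _; last exact: continuous_sinZ.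
by rewrite /F; auto_derive => //; rewrite /sinZ; field; have := PI_neq0; have := not_0_IZR _ k0;
  split.
Qed.

Lemma angleZ_plus (j k : Z) (x : R) :
  2 * IZR (j + k) * PI * x = 2 * IZR j * PI * x + 2 * IZR k * PI * x.
Proof. by rewrite plus_IZR; ring. Qed.

Lemma angleZ_minus (j k : Z) (x : R) :
  2 * IZR (j - k) * PI * x = 2 * IZR j * PI * x - 2 * IZR k * PI * x.
Proof. by rewrite minus_IZR; ring. Qed.

Lemma is_RInt_cos_cos (j k : Z) : j <> k -> (j + k)%Z <> 0%Z ->
  is_RInt (fun x => cosZ j x * cosZ k x) 0 1 0.
Proof.
move=> h1 h2; apply: (is_RInt_ext (fun x => / 2 * (cosZ (j - k) x + cosZ (j + k) x))).
  by move=> x _ /=; rewrite /cosZ angleZ_minus angleZ_plus cos_minus cos_plus; field.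
rewrite [X in is_RInt _ _ _ X](_ : 0 = scal (/ 2) (plus 0 0) :> R);
  last by rewrite /scal /plus /= /mult /=; ring.
by apply: is_RInt_scal; apply: is_RInt_plus; apply: is_RInt_cosZ => //; lia.
Qed.

Lemma is_RInt_sin_sin (j k : Z) : j <> k -> (j + k)%Z <> 0%Z ->
  is_RInt (fun x => sinZ j x * sinZ k x) 0 1 0.
Proof.
move=> h1 h2; apply: (is_RInt_ext (fun x => / 2 * (cosZ (j - k) x + - cosZ (j + k) x))).
  by move=> x _ /=; rewrite /cosZ /sinZ angleZ_minus angleZ_plus cos_minus cos_plus; field.
rewrite [X in is_RInt _ _ _ X](_ : 0 = scal (/ 2) (minus 0 0) :> R);
  last by rewrite /scal /minus /opp /plus /= /mult /=; ring.
by apply: is_RInt_scal; apply: is_RInt_minus; apply: is_RInt_cosZ => //; lia.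
Qed.

Lemma is_RInt_sin_cos (j k : Z) : is_RInt (fun x => sinZ j x * cosZ k x) 0 1 0.
Proof.
apply: (is_RInt_ext (fun x => / 2 * (sinZ (j + k) x + sinZ (j - k) x))).
  by move=> x _ /=; rewrite /cosZ /sinZ angleZ_minus angleZ_plus sin_minus sin_plus; field.
rewrite [X in is_RInt _ _ _ X](_ : 0 = scal (/ 2) (plus 0 0) :> R);
  last by rewrite /scal /plus /= /mult /=; ring.
by apply: is_RInt_scal; apply: is_RInt_plus; exact: is_RInt_sinZ.
Qed.

Lemma is_RInt_cos2 (k : Z) : k <> 0%Z -> is_RInt (fun x => cosZ k x * cosZ k x) 0 1 (/ 2).
Proof.
move=> k0; apply: (is_RInt_ext (fun x => / 2 * (1 + cosZ (k + k) x))).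
  move=> x _; rewrite /cosZ angleZ_plus cos_plus.
  by have := sin2_cos2 (2 * IZR k * PI * x); rewrite /Rsqr; lra.
rewrite [X in is_RInt _ _ _ X](_ : / 2 = scal (/ 2) (plus (scal (1 - 0) 1) 0) :> R);
  last by rewrite /scal /plus /= /mult /=; ring.
apply: is_RInt_scal; apply: is_RInt_plus; first exact: is_RInt_const.
by apply: is_RInt_cosZ; lia.
Qed.

Lemma is_RInt_sin2 (k : Z) : k <> 0%Z -> is_RInt (fun x => sinZ k x * sinZ k x) 0 1 (/ 2).
Proof.
move=> k0; apply: (is_RInt_ext (fun x => 1 - cosZ k x * cosZ k x)).
  by move=> x _; rewrite /cosZ /sinZ; have := sin2_cos2 (2 * IZR k * PI * x); rewrite /Rsqr; lra.
rewrite [X in is_RInt _ _ _ X](_ : / 2 = minus (scal (1 - 0) 1) (/ 2) :> R);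
  last by rewrite /scal /minus /opp /plus /= /mult /=; field.
by apply: is_RInt_minus; [exact: is_RInt_const|exact: is_RInt_cos2].
Qed.

Definition fcos (f : R -> R) (k : nat) : R := RInt (fun x => f x * cosZ (Z.of_nat k) x) 0 1.
Definition fsin (f : R -> R) (k : nat) : R := RInt (fun x => f x * sinZ (Z.of_nat k) x) 0 1.

Lemma is_RInt_fcos (f : R -> R) (k : nat) : (forall x, continuous f x) ->
  is_RInt (fun x => f x * cosZ (Z.of_nat k) x) 0 1 (fcos f k).
Proof.
move=> fc; apply/RInt_correct/ex_RInt_cont => x.
by apply: (@continuous_mult _ R_AbsRing) => //; exact: continuous_cosZ.
Qed.

Lemma is_RInt_fsin (f : R -> R) (k : nat) : (forall x, continuous f x) ->
  is_RInt (fun x => f x * sinZ (Z.of_nat k) x) 0 1 (fsin f k).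
Proof.
move=> fc; apply/RInt_correct/ex_RInt_cont => x.
by apply: (@continuous_mult _ R_AbsRing) => //; exact: continuous_sinZ.
Qed.

Lemma is_RInt_lin (f g : R -> R) (c a b lf lg : R) :
  is_RInt f a b lf -> is_RInt g a b lg -> is_RInt (fun x => f x + c * g x) a b (lf + c * lg).
Proof. by move=> hf hg; apply: (@is_RInt_plus R_NormedModule) => //;
  apply: (@is_RInt_scal R_NormedModule). Qed.

(** The induction carries the residual g of f after removal of the harmonics 1 to n: the integral of
    its square is the right side minus the left side, hence nonnegative, and its coefficients of
    order above n are still those of f. *)
Lemma bessel (f : R -> R) (n : nat) : (forall x, continuous f x) ->
  Rsum (fun k => 2 * (fcos f k.+1 ^ 2 + fsin f k.+1 ^ 2)) n <= RInt (fun x => f x * f x) 0 1.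
Proof.
move=> fc; set A := fcos f; set B := fsin f; set Q := RInt _ 0 1.
suff [g [gc [gQ _]]] : exists g : R -> R, (forall x, continuous g x) /\
    is_RInt (fun x => g x * g x) 0 1 (Q - Rsum (fun k => 2 * (A k.+1 ^ 2 + B k.+1 ^ 2)) n) /\
    forall m, (n < m)%nat -> is_RInt (fun x => g x * cosZ (Z.of_nat m) x) 0 1 (A m) /\
                        is_RInt (fun x => g x * sinZ (Z.of_nat m) x) 0 1 (B m).
  suff : 0 <= Q - Rsum (fun k => 2 * (A k.+1 ^ 2 + B k.+1 ^ 2)) n by lra.
  have h0 : is_RInt (fun=> 0) 0 1 0.
    by have := @is_RInt_const R_NormedModule 0 1 0; rewrite scal_zero_r.
  by apply: (is_RInt_le _ _ 0 1 _ _ Rle_0_1 h0 gQ) => x _; nra.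
elim: n => [|n [g [gc [gQ gm]]]].
  exists f; split => //; split; last by move=> m _; split;
    [exact: is_RInt_fcos|exact: is_RInt_fsin].
  rewrite /= Rminus_0_r; apply/RInt_correct/ex_RInt_cont => x.
  exact: (@continuous_mult _ R_AbsRing).
set k := Z.of_nat n.+1; have k0 : k <> 0%Z by rewrite /k; lia.
have [gA gB] := gm n.+1 ltac:(lia); rewrite -/k in gA gB.
set a := A n.+1 in gA *; set b := B n.+1 in gB *.
exists (fun x => g x + - 2 * (a * cosZ k x + b * sinZ k x)); split; last split.
- move=> x; apply: (@continuous_plus _ R_AbsRing R_NormedModule) => //.
  apply: (@continuous_scal_r _ R_AbsRing R_NormedModule).
  apply: (@continuous_plus _ R_AbsRing R_NormedModule);
    apply: (@continuous_scal_r _ R_AbsRing R_NormedModule).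
    exact: continuous_cosZ.
  exact: continuous_sinZ.
- rewrite [Rsum _ n.+1]/= -/a -/b; set S := Rsum _ n in gQ *.
  have h := is_RInt_lin _ _ (8 * a * b) _ _ _ _ (is_RInt_lin _ _ (4 * b ^ 2) _ _ _ _ (is_RInt_lin
    _ _ (4 * a ^ 2) _ _ _ _
     (is_RInt_lin _ _ (-4 * b) _ _ _ _ (is_RInt_lin _ _ (-4 * a) _ _ _ _ gQ gA) gB) (is_RInt_cos2
       k k0)) (is_RInt_sin2 k k0)) (is_RInt_sin_cos k k).
  have -> : Q - (S + 2 * (a * (a * 1) + b * (b * 1))) =
     Q - S + -4 * a * a + -4 * b * b + 4 * a ^ 2 * / 2 + 4 * b ^ 2 * / 2 + 8 * a * b * 0 by field.
  by apply: is_RInt_ext h => x _ /=; ring.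
move=> m hm; have [mA mB] := gm m ltac:(lia); set z := Z.of_nat m in mA mB *.
have h1 : k <> z by rewrite /k /z; lia.
have h2 : (k + z)%Z <> 0%Z by rewrite /k /z; lia.
split.
  have h := is_RInt_lin _ _ (-2 * b) _ _ _ _ (is_RInt_lin _ _ (-2 * a) _ _ _ _ mA
    (is_RInt_cos_cos k z h1 h2)) (is_RInt_sin_cos k z).
  rewrite !Rmult_0_r !Rplus_0_r in h.
  by apply: is_RInt_ext h => x _ /=; ring.
have h := is_RInt_lin _ _ (-2 * b) _ _ _ _ (is_RInt_lin _ _ (-2 * a) _ _ _ _ mB (is_RInt_sin_cos
  z k)) (is_RInt_sin_sin k z h1 h2).
rewrite !Rmult_0_r !Rplus_0_r in h.
by apply: is_RInt_ext h => x _ /=; ring.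
Qed.

Lemma RInt_periodic (f : R -> R) (a : R) : (forall x, continuous f x) -> (forall x, f (x + 1) = f
  x) ->
  RInt f a (a + 1) = RInt f 0 1.
Proof.
move=> fc fp; have ex u v := ex_RInt_cont f u v fc.
have h1 := RInt_Chasles f a 0 1 (ex _ _) (ex _ _).
have h2 := RInt_Chasles f a 1 (a + 1) (ex _ _) (ex _ _).
have h3 : RInt f 1 (a + 1) = RInt f 0 a.
  symmetry; apply: is_RInt_unique; apply: (is_RInt_ext (fun x => scal 1 (f (1 * x + 1)))).
    by move=> x _; rewrite Rmult_1_l fp /scal /= /mult /=; ring.
  apply: (is_RInt_comp_lin f); rewrite Rmult_0_r Rplus_0_l Rmult_1_l.
  exact: RInt_correct.
have h4 : RInt f 0 a = - RInt f a 0 by rewrite -(opp_RInt_swap f a 0).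
rewrite h3 h4 /plus /= in h1 h2; lra.
Qed.

Lemma RInt_shift (f : R -> R) (a u v : R) : (forall x, continuous f x) ->
  RInt (fun x => f (x + a)) u v = RInt f (u + a) (v + a).
Proof.
move=> fc; apply: is_RInt_unique; apply: (is_RInt_ext (fun x => scal 1 (f (1 * x + a)))).
  by move=> x _; rewrite Rmult_1_l /scal /= /mult /=; ring.
by apply: (is_RInt_comp_lin f); rewrite !Rmult_1_l; exact/RInt_correct/ex_RInt_cont.
Qed.

Lemma RInt_periodic_shift (f : R -> R) (a : R) : (forall x, continuous f x) -> (forall x, f (x +
  1) = f x) ->
  RInt (fun x => f (x + a)) 0 1 = RInt f 0 1.
Proof. by move=> fc fp; rewrite RInt_shift // Rplus_0_l Rplus_comm; exact: RInt_periodic. Qed.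

Lemma continuous_shift (f : R -> R) (a x : R) : (forall x, continuous f x) -> continuous (fun x
  => f (x + a)) x.
Proof.
by move=> fc; apply: (continuous_comp (fun x => x + a) f) => //; apply: (@ex_derive_continuous);
  auto_derive.
Qed.

(** Periodicity moves the translation from f to the cosine, where the addition formula applies. *)
Lemma fcos_shift (f : R -> R) (a : R) (k : nat) : (forall x, continuous f x) -> (forall x, f (x +
  1) = f x) ->
  fcos (fun x => f (x + a)) k = cosZ (Z.of_nat k) a * fcos f k + sinZ (Z.of_nat k) a * fsin f k.
Proof.
move=> fc fp; set z := Z.of_nat k.
pose g x := f x * cosZ z (x + - a).
have gc x : continuous g x.
  apply: (@continuous_mult _ R_AbsRing) => //.
  by apply: continuous_shift => y; exact: continuous_cosZ.
rewrite /fcos (RInt_ext _ (fun x => g (x + a))); last first.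
  by move=> x _; rewrite /g Rplus_assoc Rplus_opp_r Rplus_0_r.
rewrite RInt_periodic_shift //; last first.
  by move=> x; rewrite /g fp -(cosZ_add1 _ (x + - a)); congr (_ * cosZ _ _); ring.
apply: is_RInt_unique; rewrite -/(fcos f k).
have h := is_RInt_lin _ _ (sinZ z a) _ _ _ _ (is_RInt_scal _ _ _ (cosZ z a) _ (is_RInt_fcos f k
  fc)) (is_RInt_fsin f k fc).
apply: is_RInt_ext h => x _; rewrite /g cosZ_shift /scal /= /mult /= -/z /cosZ /sinZ.
by rewrite Ropp_mult_distr_r_reverse cos_neg sin_neg; ring.
Qed.

Lemma fsin_shift (f : R -> R) (a : R) (k : nat) : (forall x, continuous f x) -> (forall x, f (x +
  1) = f x) ->
  fsin (fun x => f (x + a)) k = cosZ (Z.of_nat k) a * fsin f k - sinZ (Z.of_nat k) a * fcos f k.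
Proof.
move=> fc fp; set z := Z.of_nat k.
pose g x := f x * sinZ z (x + - a).
have gc x : continuous g x.
  apply: (@continuous_mult _ R_AbsRing) => //.
  by apply: continuous_shift => y; exact: continuous_sinZ.
rewrite /fsin (RInt_ext _ (fun x => g (x + a))); last first.
  by move=> x _; rewrite /g Rplus_assoc Rplus_opp_r Rplus_0_r.
rewrite RInt_periodic_shift //; last first.
  by move=> x; rewrite /g fp -(sinZ_add1 _ (x + - a)); congr (_ * sinZ _ _); ring.
apply: is_RInt_unique; rewrite -/(fsin f k).
have h := is_RInt_lin _ _ (- sinZ z a) _ _ _ _ (is_RInt_scal _ _ _ (cosZ z a) _ (is_RInt_fsin f k
  fc)) (is_RInt_fcos f k fc).
have -> : cosZ z a * fsin f k - sinZ z a * fcos f k = scal (cosZ z a) (fsin f k) + - sinZ z a *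
  fcos f k.
  by rewrite /scal /= /mult /=; ring.
apply: is_RInt_ext h => x _; rewrite /g sinZ_shift /scal /= /mult /= -/z /cosZ /sinZ.
by rewrite Ropp_mult_distr_r_reverse cos_neg sin_neg; ring.
Qed.

(** * Absolute convergence and uniqueness *)

Lemma fcos_lin (f g : R -> R) (c : R) (k : nat) : (forall x, continuous f x) -> (forall x,
  continuous g x) ->
  fcos (fun x => f x + c * g x) k = fcos f k + c * fcos g k.
Proof.
move=> fc gc; apply: is_RInt_unique.
have h := is_RInt_lin _ _ c _ _ _ _ (is_RInt_fcos f k fc) (is_RInt_fcos g k gc).
by apply: is_RInt_ext h => x _ /=; ring.
Qed.

Lemma fsin_lin (f g : R -> R) (c : R) (k : nat) : (forall x, continuous f x) -> (forall x,
  continuous g x) ->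
  fsin (fun x => f x + c * g x) k = fsin f k + c * fsin g k.
Proof.
move=> fc gc; apply: is_RInt_unique.
have h := is_RInt_lin _ _ c _ _ _ _ (is_RInt_fsin f k fc) (is_RInt_fsin g k gc).
by apply: is_RInt_ext h => x _ /=; ring.
Qed.

Lemma continuous_lin (f g : R -> R) (c : R) : (forall x, continuous f x) -> (forall x, continuous
  g x) ->
  forall x, continuous (fun x => f x + c * g x) x.
Proof.
move=> fc gc x; apply: (@continuous_plus _ R_AbsRing R_NormedModule) => //.
exact: (@continuous_scal_r _ R_AbsRing R_NormedModule).
Qed.

(* Bessel's inequality for f(x + h) - f(x - h), whose k-th coefficients have
   size 2 |sin(2 pi k h)| >= 1 times those of f when h = 3^-j / 12. *)
Lemma bernstein_block (f : R -> R) (M : R) (j : nat) :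
  (forall x, continuous f x) -> (forall x, f (x + 1) = f x) ->
  (forall x y, Rabs (x - y) <= / 3 ^ j -> Rabs (f x - f y) <= M * (5 / 12) ^ j) ->
  Rsum (fun i => Rabs (fcos f (expn 3 j + i)) + Rabs (fsin f (expn 3 j + i))) (2 * expn 3 j)
    <= (M ^ 2 + 2) * (3 / 4) ^ j.
Proof.
move=> fc fp fm; set A := fcos f; set B := fsin f.
have p3 : 0 < 3 ^ j by apply: pow_lt; lra.
pose h := / (12 * 3 ^ j); have h0 : 0 < h by apply: Rinv_0_lt_compat; lra.
pose g x := f (x + h) + -1 * f (x + - h).
have c1 x : continuous (fun x => f (x + h)) x by exact: continuous_shift.
have c2 x : continuous (fun x => f (x + - h)) x by exact: continuous_shift.
have gc := continuous_lin _ _ (-1) c1 c2.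
have cN k : cosZ k (- h) = cosZ k h by rewrite /cosZ Ropp_mult_distr_r_reverse cos_neg.
have sN k : sinZ k (- h) = - sinZ k h by rewrite /sinZ Ropp_mult_distr_r_reverse sin_neg.
have gA k : fcos g k = 2 * sinZ (Z.of_nat k) h * B k.
  by rewrite /g fcos_lin // !fcos_shift // cN sN /B; ring.
have gB k : fsin g k = - 2 * sinZ (Z.of_nat k) h * A k.
  by rewrite /g fsin_lin // !fsin_shift // cN sN /A; ring.
have key i : (i < 2 * expn 3 j)%nat ->
    A (expn 3 j + i)%nat ^ 2 + B (expn 3 j + i)%nat ^ 2 <=
    fcos g (expn 3 j + i) ^ 2 + fsin g (expn 3 j + i) ^ 2.
  move=> hi; rewrite gA gB; set k := (expn 3 j + i)%nat; set s := sinZ _ h.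
  have k1 : 3 ^ j <= INR k by rewrite -INR_expn3; apply: le_INR; rewrite /k; lia.
  have k2 : INR k <= 3 * 3 ^ j.
    by rewrite -INR_expn3 (_ : 3 = INR 3) -?mult_INR; [apply: le_INR; rewrite /k; lia|rewrite /=;
      ring].
  (* For 3^j <= k <= 3 * 3^j the angle lies between pi/6 and pi/2, where the sine is at least
     1/2. *)
  have hang : 2 * IZR (Z.of_nat k) * PI * h = PI / 6 * (INR k / 3 ^ j).
    by rewrite -INR_IZR_INZ /h; field; lra.
  have q1 : 1 <= INR k / 3 ^ j by apply/Rle_div_r; lra.
  have q2 : INR k / 3 ^ j <= 3 by apply/Rle_div_l; lra.
  have s1 : / 2 <= s.
    rewrite /s /sinZ hang (_ : / 2 = sin (PI / 6)); last by rewrite sin_PI6; field.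
    by have p := PI_RGT_0; apply: sin_incr_1; nra.
  have s2 : 1 <= 4 * s ^ 2 by nra.
  have := pow2_ge_0 (A k); have := pow2_ge_0 (B k); nra.
have gM : RInt (fun x => g x * g x) 0 1 <= (M * (5 / 12) ^ j) ^ 2.
  have hc x : continuous (fun x => g x * g x) x by apply: (@continuous_mult _ R_AbsRing); exact: gc.
  have h1 := RInt_correct _ 0 1 (ex_RInt_cont _ 0 1 hc).
  have h2 := @is_RInt_const R_NormedModule 0 1 ((M * (5 / 12) ^ j) ^ 2).
  apply: Rle_trans (is_RInt_le _ _ 0 1 _ _ Rle_0_1 h1 h2 _) _; last first.
    by rewrite /scal /= /mult /=; lra.
  move=> x _; have := fm (x + h) (x + - h).
  have -> : x + h - (x + - h) = 2 * h by ring.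
  rewrite Rabs_pos_eq; last by lra.
  have hh : 2 * h <= / 3 ^ j.
    have -> : 2 * h = / 6 * / 3 ^ j by rewrite /h; field; lra.
    have := Rinv_0_lt_compat _ p3; lra.
  move=> /(_ hh) /Rabs_le_between hg.
  have -> : g x = f (x + h) - f (x + - h) by rewrite /g; ring.
  by nra.
(* [bessel] starts at coefficient 1, so the block starting at 3^j is preceded by 3^j - 1 terms,
   which are dropped as nonnegative. *)
have bs := bessel g ((expn 3 j).-1 + 2 * expn 3 j) gc.
rewrite Rsum_add in bs.
have e3 : (0 < expn 3 j)%nat by rewrite expn_gt0.
rewrite (Rsum_ext (fun k => 2 * (fcos g ((expn 3 j).-1 + k).+1 ^ 2 + fsin g ((expn 3 j).-1 +
  k).+1 ^ 2))
    (fun i => 2 * (fcos g (expn 3 j + i) ^ 2 + fsin g (expn 3 j + i) ^ 2))) in bs; last first.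
  by move=> k _; rewrite -addSn prednK.
have pos : 0 <= Rsum (fun k => 2 * (fcos g k.+1 ^ 2 + fsin g k.+1 ^ 2)) (expn 3 j).-1.
  elim: (expn 3 j).-1 => [|n IH] /=; first by lra.
  have := pow2_ge_0 (fcos g n.+1); have := pow2_ge_0 (fsin g n.+1); rewrite /= in IH *; lra.
have blk : Rsum (fun i => A (expn 3 j + i)%nat ^ 2 + B (expn 3 j + i)%nat ^ 2) (2 * expn 3 j) <=
  / 2 * (M * (5 / 12) ^ j) ^ 2.
  have := Rsum_le _ _ _ key.
  rewrite !Rsum_scal in bs pos; lra.
have l0 : 0 < 4 ^ j by apply: pow_lt; lra.
(* In place of Cauchy-Schwarz, |u| <= (4^j u^2 + 4^-j) / 2. The weight 4^j makes both parts decay: 4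
   (5/12)^2 = 25/36, and the 2 * 3^j terms 4^-j give the ratio 3/4. *)
apply: (@Rle_trans _ (Rsum (fun i => / 2 * 4 ^ j * (A (expn 3 j + i)%nat ^ 2 + B (expn 3 j +
  i)%nat ^ 2) + / 4 ^ j) (2 * expn 3 j))).
  apply: Rsum_le => i _; move: (A _) (B _) => a b.
  have am u : Rabs u <= / 2 * 4 ^ j * u ^ 2 + / 2 * / 4 ^ j.
    have := pow2_ge_0 (4 ^ j * Rabs u - 1); rewrite -(pow2_abs u) => h1.
    have -> : / 2 * 4 ^ j * Rabs u ^ 2 + / 2 * / 4 ^ j =
      Rabs u + / 2 * / 4 ^ j * (4 ^ j * Rabs u - 1) ^ 2 by field; lra.
    have := Rinv_0_lt_compat _ l0; nra.
  have := am a; have := am b; lra.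
rewrite Rsum_plus Rsum_scal Rsum_const mult_INR INR_expn3.
apply: (@Rle_trans _ (/ 2 * 4 ^ j * (/ 2 * (M * (5 / 12) ^ j) ^ 2) + INR 2 * 3 ^ j * / 4 ^ j)).
  by apply: Rplus_le_compat_r; apply: Rmult_le_compat_l; [lra|].
have -> : / 2 * 4 ^ j * (/ 2 * (M * (5 / 12) ^ j) ^ 2) = / 4 * M ^ 2 * (25 / 36) ^ j.
  have -> : (25 / 36) ^ j = 4 ^ j * ((5 / 12) ^ j) ^ 2.
    by rewrite -pow_mult Nat.mul_comm pow_mult -Rpow_mult_distr; congr (_ ^ _); field.
  by field.
have -> : INR 2 * 3 ^ j * / 4 ^ j = 2 * (3 / 4) ^ j.
  by rewrite /Rdiv Rpow_mult_distr pow_inv /=; ring.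
have : (25 / 36) ^ j <= (3 / 4) ^ j by apply: pow_incr; lra.
have : 0 <= (25 / 36) ^ j by apply: pow_le; lra.
have := pow2_ge_0 M; nra.
Qed.

Lemma bernstein (f : R -> R) (M : R) :
  (forall x, continuous f x) -> (forall x, f (x + 1) = f x) ->
  (forall x y j, Rabs (x - y) <= / 3 ^ j -> Rabs (f x - f y) <= M * (5 / 12) ^ j) ->
  ex_series (fun k => Rabs (fcos f k) + Rabs (fsin f k)).
Proof.
move=> fc fp fm; set F := fun k => _.
have F0 k : 0 <= F k by rewrite /F; have := Rabs_pos (fcos f k); have := Rabs_pos (fsin f k); lra.
have mono m n : (m <= n)%nat -> Rsum F m <= Rsum F n.
  move=> mn; rewrite -(subnKC mn) Rsum_add.
  suff : 0 <= Rsum (fun k => F (m + k)%nat) (n - m) by lra.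
  by elim: (n - m)%nat => [|i IH] /=; [lra|have := F0 (m + i)%nat; lra].
(* The blocks from 3^i to 3^(i+1) cover the positive indices; the right side is the closed form of
   the geometric sum of the block bounds. *)
have geo J : Rsum F (expn 3 J) <= F 0%nat + 4 * (M ^ 2 + 2) * (1 - (3 / 4) ^ J).
  elim: J => [|J IH]; first by rewrite /=; lra.
  rewrite expnS (_ : 3 * expn 3 J = expn 3 J + 2 * expn 3 J)%nat; last by lia.
  rewrite Rsum_add; have := bernstein_block f M J fc fp ltac:(move=> x y; exact: fm).
  rewrite -/F [(3 / 4) ^ J.+1]/=; rewrite /F in IH *; lra.
have bnd n : Rsum F n <= F 0%nat + 4 * (M ^ 2 + 2).
  have h : (n <= expn 3 n)%nat by apply: ltnW; rewrite ltn_expl.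
  have := mono _ _ h; have := geo n; have : 0 <= (3 / 4) ^ n by apply: pow_le; lra.
  have := pow2_ge_0 M; nra.
have [l hl] : ex_finite_lim_seq (Rsum F).
  apply: (ex_finite_lim_seq_incr _ (F 0%nat + 4 * (M ^ 2 + 2))) => // n.
  by apply: mono.
exists l; apply: (_ : is_lim_seq _ (Finite l)).
apply: is_lim_seq_ext (proj1 (is_lim_seq_incr_1 _ _) hl) => n.
elim: n => [|n IH]; first by rewrite sum_O /=; ring.
by rewrite sum_Sn -IH /plus.
Qed.

Lemma RInt_ge_const (f : R -> R) (a b c : R) : (forall x, continuous f x) -> a <= b ->
  (forall x, a < x < b -> c <= f x) -> c * (b - a) <= RInt f a b.
Proof.
move=> fc ab hf.
have h1 := RInt_correct _ a b (ex_RInt_cont _ a b fc).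
have h2 := @is_RInt_const R_NormedModule a b c.
have := is_RInt_le _ _ a b _ _ ab h2 h1 hf; rewrite /scal /= /mult /=; lra.
Qed.

(* The trigonometric polynomials (1 + cos 2 pi u - cos 2 pi d)^n are at most 1 in
   absolute value for d <= |u| <= 1/2 and grow geometrically near u = 0. *)
Lemma fourier_coefs_zero_nonpos (g : R -> R) (x0 : R) :
  (forall x, continuous g x) -> (forall x, g (x + 1) = g x) ->
  (forall k, fcos g k = 0) -> (forall k, fsin g k = 0) -> g x0 <= 0.
Proof.
move=> gc gp gA gB; apply: Rnot_lt_le => g0.
pose G u := g (u + x0).
have Gc u : continuous G u by exact: continuous_shift.
have Gp u : G (u + 1) = G u by rewrite /G -(gp (u + x0)); congr g; ring.
have GA k : fcos G k = 0 by rewrite /G fcos_shift // gA gB; ring.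
pose c := g x0 / 2; have c0 : 0 < c by rewrite /c; lra.
have [d [d0 hd]] : exists d, 0 < d <= / 4 /\ forall u, Rabs u <= d -> c <= G u.
  have /filterlim_locally := Gc 0; move=> /(_ (mkposreal _ c0)) [e he].
  have e0 := cond_pos e; exists (Rmin (e / 2) (/ 4)); split.
    by split; [apply: Rmin_pos; lra|exact: Rmin_r].
  move=> u hu; have := he u; rewrite /ball /= /AbsRing_ball /abs /minus /plus /opp /=.
  have hue : Rabs (u + - 0) < e.
    by rewrite Ropp_0 Rplus_0_r; have := Rmin_l (e / 2) (/ 4); lra.
  move=> /(_ hue) /Rabs_lt_between; rewrite {2 4}/G Rplus_0_l.
  by rewrite /c; lra.
pose kap u := 1 + cosZ 1 u - cosZ 1 d.
have kapc u : continuous kap u.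
  apply: (@ex_derive_continuous); rewrite /kap /cosZ; by auto_derive.
pose I n k u := G u * kap u ^ n * cosZ k u.
have powc n u : continuous (fun u => kap u ^ n) u.
  elim: n => [|n IH]; first exact: continuous_const.
  exact: (@continuous_mult _ R_AbsRing).
have Ic n k u : continuous (I n k) u.
  by apply: (@continuous_mult _ R_AbsRing);
    [exact: (@continuous_mult _ R_AbsRing)|exact: continuous_cosZ].
(* All integer frequencies are treated together, since a factor [kap] shifts the frequency by -1, 0
   or 1. *)
have I0 n k : is_RInt (I n k) 0 1 0.
  elim: n k => [|n IH] k.
    have hk : cosZ k =1 cosZ (Z.of_nat (Z.abs_nat k)).
      move=> u; rewrite Zabs2Nat.id_abs; have [->|->] := Z.abs_eq_or_opp k; first by [].
      by rewrite /cosZ opp_IZR -cos_neg; congr cos; ring.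
    have := is_RInt_fcos G (Z.abs_nat k) Gc; rewrite GA.
    by apply: is_RInt_ext => u _; rewrite /I hk /= Rmult_1_r.
  have h := is_RInt_lin _ _ (/ 2) _ _ _ _ (is_RInt_lin _ _ (/ 2) _ _ _ _
     (is_RInt_scal _ _ _ (1 - cosZ 1 d) _ (IH k)) (IH (k + 1)%Z)) (IH (k - 1)%Z).
  rewrite scal_zero_r !Rmult_0_r !Rplus_0_r in h.
  have e0 : plus (zero : R_NormedModule) 0 = 0 by rewrite /plus /zero /=; ring.
  apply: is_RInt_ext h => u _;
    rewrite /I /scal /= /mult /= /cosZ angleZ_plus angleZ_minus cos_plus cos_minus /kap /cosZ.
  by field.
have I0' n : RInt (I n 0%Z) (- / 2) (- / 2 + 1) = 0.
  rewrite RInt_periodic //; first exact: is_RInt_unique.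
  by move=> u; rewrite /I Gp !cosZ_0 /kap cosZ_add1.
have cosabs u : cosZ 1 u = cosZ 1 (Rabs u).
  rewrite /Rabs; case: Rcase_abs => _ //.
  by rewrite /cosZ Ropp_mult_distr_r_reverse cos_neg.
have cosdec u v : 0 <= u -> u <= v -> v <= / 2 -> cosZ 1 v <= cosZ 1 u.
  by move=> hu huv hv; have p := PI_RGT_0; apply: cos_decr_1; nra.
pose eta := cosZ 1 (d / 2) - cosZ 1 d.
have eta0 : 0 < eta.
  have : cosZ 1 d < cosZ 1 (d / 2) by have p := PI_RGT_0; apply: cos_decreasing_1; nra.
  by rewrite /eta; lra.
have [M hM] : exists M, forall u, - / 2 <= u <= / 2 -> Rabs (G u) <= M.
  have hcc u : - / 2 <= u <= / 2 -> continuity_pt G u by move=> _; apply/continuity_pt_filterlim;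
    exact: Gc.
  have [m [hm _]] := continuity_ab_min G (- / 2) (/ 2) ltac:(lra) hcc.
  have [m' [hm' _]] := continuity_ab_maj G (- / 2) (/ 2) ltac:(lra) hcc.
  exists (Rabs (G m) + Rabs (G m')) => u hu; have := hm u hu; have := hm' u hu.
  have := Rle_abs (G m'); have := Rle_abs (- G m); rewrite Rabs_Ropp.
  have := Rabs_pos (G m); have := Rabs_pos (G m').
  by move=> *; apply: Rabs_le; lra.
have M0 : 0 <= M by apply: Rle_trans (Rabs_pos _) (hM 0 ltac:(lra)).
have low n u : - / 2 <= u <= / 2 -> - M <= I n 0%Z u.
  move=> hu; rewrite /I cosZ_0 Rmult_1_r; have hMu := hM u hu.
  have au : Rabs u <= / 2 by apply: Rabs_le; lra.
  case: (Rle_dec (Rabs u) d) => hud.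
    have k1 : 1 <= kap u by rewrite /kap cosabs;
      have := cosdec (Rabs u) d (Rabs_pos _) hud ltac:(lra); lra.
    have := pow_R1_Rle _ n k1; have := hd u hud; nra.
  have k1 : Rabs (kap u) <= 1.
    apply: Rabs_le; rewrite /kap; have := cosdec d (Rabs u) ltac:(lra) ltac:(lra) au.
    rewrite -cosabs; have := cosdec d (/ 4) ltac:(lra) ltac:(lra) ltac:(lra).
    have := COS_bound (2 * IZR 1 * PI * u); rewrite -/(cosZ 1 u).
    have := COS_bound (2 * IZR 1 * PI * d); rewrite -/(cosZ 1 d).
    have -> : cosZ 1 (/ 4) = 0 by rewrite /cosZ (_ : _ * _ = PI / 2) ?cos_PI2 //; field.
    lra.
  have k2 : Rabs (kap u ^ n) <= 1.
    rewrite -RPow_abs -(pow1 n); apply: pow_incr; split => //; exact: Rabs_pos.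
  have : Rabs (G u * kap u ^ n) <= M.
    by rewrite Rabs_mult; have := Rabs_pos (G u); have := Rabs_pos (kap u ^ n); nra.
  by move/Rabs_le_between; lra.
have high n u : - (d / 2) < u < d / 2 -> c * (1 + eta) ^ n <= I n 0%Z u.
  move=> hu; rewrite /I cosZ_0 Rmult_1_r.
  have au : Rabs u <= d / 2 by apply: Rabs_le; lra.
  have k1 : 1 + eta <= kap u.
    by rewrite /kap /eta (cosabs u); have := cosdec (Rabs u) (d / 2) (Rabs_pos _) au ltac:(lra);
      lra.
  have k2 : (1 + eta) ^ n <= kap u ^ n by apply: pow_incr; lra.
  have k3 : 0 <= (1 + eta) ^ n by apply: pow_le; lra.
  by apply: Rmult_le_compat => //; [lra|apply: hd; lra].
(* The total integral is 0, the middle interval of length d contributes at least c (1 + eta)^n d,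
   and the rest, of length below 1, at least -M. Bernoulli's inequality then contradicts this bound
   for large n. *)
have main n : c * (1 + eta) ^ n * d <= M.
  have ex u v := ex_RInt_cont (I n 0%Z) u v (Ic n 0%Z).
  have ch1 := RInt_Chasles (I n 0%Z) (- / 2) (- (d / 2)) (- / 2 + 1) (ex _ _) (ex _ _).
  have ch2 := RInt_Chasles (I n 0%Z) (- (d / 2)) (d / 2) (- / 2 + 1) (ex _ _) (ex _ _).
  have b1 := RInt_ge_const (I n 0%Z) (- / 2) (- (d / 2)) (- M) (Ic n 0%Z) ltac:(lra) ltac:(move=>
    u hu; apply: low; lra).
  have b2 := RInt_ge_const (I n 0%Z) (- (d / 2)) (d / 2) _ (Ic n 0%Z) ltac:(lra) (high n).
  have b3 := RInt_ge_const (I n 0%Z) (d / 2) (- / 2 + 1) (- M) (Ic n 0%Z) ltac:(lra) ltac:(move=>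
    u hu; apply: low; lra).
  rewrite I0' /plus /= in ch1 ch2; nra.
have cd0 : 0 < c * d * eta by apply: Rmult_lt_0_compat => //; apply: Rmult_lt_0_compat; lra.
have [n hn] := INR_unbounded (M / (c * d * eta)).
move/Rlt_div_l: hn => /(_ cd0) hn.
have := main n; have := poly n eta eta0; nra.
Qed.

Lemma fourier_coefs_zero (g : R -> R) (x : R) :
  (forall x, continuous g x) -> (forall x, g (x + 1) = g x) ->
  (forall k, fcos g k = 0) -> (forall k, fsin g k = 0) -> g x = 0.
Proof.
move=> gc gp gA gB; apply: Rle_antisym; first exact: fourier_coefs_zero_nonpos.
have z0 : forall x : R, continuous (fun=> 0) x by move=> y; exact: continuous_const.
have c1 := continuous_lin _ _ (-1) z0 gc.
have zA k : fcos (fun=> 0) k = 0.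
  rewrite /fcos (RInt_ext _ (fun=> 0)); first by rewrite RInt_const /scal /= /mult /=; ring.
  by move=> y _; rewrite Rmult_0_l.
have zB k : fsin (fun=> 0) k = 0.
  rewrite /fsin (RInt_ext _ (fun=> 0)); first by rewrite RInt_const /scal /= /mult /=; ring.
  by move=> y _; rewrite Rmult_0_l.
suff : 0 + -1 * g x <= 0 by lra.
apply: (fourier_coefs_zero_nonpos (fun x => 0 + -1 * g x)) => // [y|k|k]; first by rewrite gp.
  by rewrite fcos_lin // zA gA; ring.
by rewrite fsin_lin // zB gB; ring.
Qed.

(** * Summation over the nonzero integers *)

Definition list_sum (a : Z -> C) (l : list Z) : C :=
  fold_right (fun (k : Z) (acc : C) => a k + acc)%C (RtoC 0) l.

Fixpoint symZ (n : nat) : list Z :=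
  if n is n'.+1 then (Z.of_nat n :: - Z.of_nat n :: symZ n')%Z else nil.

Lemma In_symZ (n : nat) (k : Z) : In k (symZ n) <-> (1 <= Z.abs k <= Z.of_nat n)%Z.
Proof.
elim: n => [|n IH]; first by split => //=; lia.
change (Z.of_nat n.+1 = k \/ (- Z.of_nat n.+1)%Z = k \/ In k (symZ n) <-> (1 <= Z.abs k <=
  Z.of_nat n.+1)%Z).
rewrite IH; lia.
Qed.

Lemma NoDup_symZ (n : nat) : NoDup (symZ n).
Proof.
elim: n => [|n IH]; first exact: NoDup_nil.
change (NoDup (Z.of_nat n.+1 :: (- Z.of_nat n.+1)%Z :: symZ n)).
apply: NoDup_cons; last by apply: NoDup_cons => // /In_symZ; lia.
by move=> [h|/In_symZ h]; lia.
Qed.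

Lemma list_sum_symZ (a : Z -> C) (n : nat) :
  list_sum a (symZ n) = Csum (fun i => a (Z.of_nat i.+1) + a (- Z.of_nat i.+1)%Z)%C n.
Proof.
elim: n => [|n IH] //.
change (a (Z.of_nat n.+1) + (a (- Z.of_nat n.+1)%Z + list_sum a (symZ n)) =
  Csum (fun i => a (Z.of_nat i.+1) + a (- Z.of_nat i.+1)%Z) n + (a (Z.of_nat n.+1) + a (-
    Z.of_nat n.+1)%Z))%C.
rewrite IH; ring.
Qed.

Lemma list_sum_perm (a : Z -> C) (l1 l2 : list Z) :
  Permutation l1 l2 -> list_sum a l1 = list_sum a l2.
Proof.
elim=> [|x l l' _ IH|x y l|l l' l'' _ IH1 _ IH2] //=; first by rewrite IH.
  by ring.
by rewrite IH1.
Qed.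

Lemma list_sum_filter (a : Z -> C) (p : Z -> bool) (l : list Z) :
  (list_sum a l = list_sum a (filter p l) + list_sum (fun k => if p k then RtoC 0 else a k) l)%C.
Proof.
elim: l => [|x l IH] /=; first by ring.
by rewrite IH; case: (p x) => /=; ring.
Qed.

(** Induction on l, taking each element out of l' once it is used; a repetition in l would need it
    twice. *)
Lemma Cmod_list_sum_incl (a : Z -> C) (l l' : list Z) : NoDup l -> incl l l' ->
  Cmod (list_sum a l) <= Re (list_sum (fun k => RtoC (Cmod (a k))) l').
Proof.
elim: l l' => [|x l IH] l' nd inc.
  rewrite /= Cmod_0; elim: l' {inc} => [|y l' IH] /=; first by lra.
  by have := Cmod_ge_0 (a y); rewrite /Re /= in IH *; lra.
move: nd => /NoDup_cons_iff [nx nd].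
have [l1 [l2 e]] := in_split x l' (inc x (or_introl erefl)).
have inc' : incl l (app l1 l2).
  move=> y hy; have := inc y (or_intror hy); rewrite e => /(@in_app_or _ _ _ _) [h|[h|h]].
  - by apply: in_or_app; left.
  - by rewrite -h in hy.
  - by apply: in_or_app; right.
rewrite e (list_sum_perm _ (app l1 (x :: l2)) (x :: app l1 l2)); last first.
  by apply: Permutation_sym; exact: Permutation_middle.
have := IH _ nd inc'; have := Cmod_triangle (a x) (list_sum a l).
by rewrite /Re /=; lra.
Qed.

Lemma Series_Rsum (u : nat -> R) (n : nat) : ex_series u ->
  Series u = Rsum u n + Series (fun k => u (n + k)%nat).
Proof.
move=> hu; elim: n => [|n IH]; first by rewrite /= Rplus_0_l.
rewrite IH (Series_incr_1 (fun k => u (n + k)%nat)); last exact/(ex_series_incr_n u n).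
rewrite addn0 /= Rplus_assoc; congr (_ + (_ + _)).
by apply: Series_ext => k; rewrite addnS addSn.
Qed.

Lemma Series_tail_le (u a : nat -> R) (n : nat) : (forall k, Rabs (u k) <= a k) -> ex_series a ->
  Rabs (Series u - Rsum u n) <= Series a - Rsum a n.
Proof.
move=> ua ha; have hu : ex_series u by apply: ex_series_le ha => k; exact: ua.
have ha' : ex_series (fun k => a (n + k)%nat) by apply/(ex_series_incr_n a n).
rewrite (Series_Rsum u n hu) (Series_Rsum a n ha) !(_ : forall x y : R, x + y - x = y);
  try by move=> x y; ring.
apply: Rle_trans (Series_Rabs _ _) _.
  by apply: ex_series_le ha' => k; rewrite /norm /= /abs /= Rabs_Rabsolu; exact: ua.
by apply: Series_le => // k; split; [exact: Rabs_pos|exact: ua].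
Qed.

Lemma Series_tail_small (a : nat -> R) (eps : R) : ex_series a -> 0 < eps ->
  exists N, forall n, (N <= n)%nat -> Rabs (Series a - Rsum a n) < eps.
Proof.
move=> ha e0; have hs : is_lim_seq (sum_n a) (Series a) := Series_correct _ ha.
have [N hN] := proj2 (is_lim_seq_spec _ _) hs (mkposreal _ e0).
exists N.+1 => -[//|n] hn; have := hN n ltac:(lia); rewrite Rabs_minus_sym /=.
suff -> : sum_n a n = Rsum a n + a n by [].
elim: n {hn} => [|n IH]; first by rewrite sum_O /=; ring.
by rewrite sum_Sn IH.
Qed.

Lemma Cmod_le_Rabs (z : C) : Cmod z <= Rabs (Re z) + Rabs (Im z).
Proof.
have -> : z = (RtoC (Re z) + RtoC (Im z) * Ci)%C.
  by case: z => x y; apply: injective_projections => /=; ring.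
apply: Rle_trans (Cmod_triangle _ _) _; rewrite Cmod_mult !Cmod_R Cmod_Ci.
by rewrite /Re /Im /= !(Rmult_0_r, Rmult_0_l, Rplus_0_r, Rplus_0_l, Rminus_0_r, Rmult_1_r); lra.
Qed.

(** A finite set containing [symZ n] is [symZ n] together with indices beyond n, whose terms sum to
    at most twice the tail of F. So convergence of the symmetric sums and domination give unordered
    convergence. *)
Lemma is_sum_nonzeroZ_pairs (a : Z -> C) (F : nat -> R) (l : C) :
  (forall n, Cmod (a (Z.of_nat n.+1)) <= F n) -> (forall n, Cmod (a (- Z.of_nat n.+1)%Z) <= F n) ->
  ex_series F ->
  is_clim (Csum (fun n => a (Z.of_nat n.+1) + a (- Z.of_nat n.+1)%Z)%C) l ->
  is_sum_nonzeroZ a l.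
Proof.
move=> h1 h2 hF [hr hi] eps; have e0 := cond_pos eps.
have [N0 hN0] := Series_tail_small F (eps / 8) hF ltac:(lra).
have e4 : 0 < eps / 4 by lra.
have [N1 hN1] := proj2 (is_lim_seq_spec _ _) hr (mkposreal _ e4).
have [N2 hN2] := proj2 (is_lim_seq_spec _ _) hi (mkposreal _ e4).
pose n := (N0 + N1 + N2)%nat.
exists (symZ n); split; first by rewrite In_symZ; lia.
move=> L nd nz inc; rewrite -/(list_sum a L).
pose p k := Z.leb (Z.abs k) (Z.of_nat n).
have hperm : Permutation (filter p L) (symZ n).
  apply: NoDup_Permutation; [exact: NoDup_filter|exact: NoDup_symZ|] => k.
  rewrite filter_In In_symZ /p Z.leb_le; split => [[hk h]|h].
    have k0 : k <> 0%Z by move=> e; apply: nz; rewrite -e.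
    by lia.
  by split; [apply: inc; apply/In_symZ|lia].
rewrite (list_sum_filter a p) (list_sum_perm a _ _ hperm) list_sum_symZ.
set s := Csum _ n; set t := list_sum _ L.
have hs : Cmod (s - l) < eps / 2.
  apply: Rle_lt_trans (Cmod_le_Rabs _) _.
  have := hN1 n ltac:(rewrite /n; lia); have := hN2 n ltac:(rewrite /n; lia).
  rewrite -/s /= /Re /Im /=; rewrite /Rminus; lra.
have ht : Cmod t <= 2 * (eps / 8).
  have [m hm] : exists m, incl L (symZ m).
    elim: L nz {nd inc hperm t} => [|k L IH] nz; first by exists 0%nat.
    have [m hm] := IH (fun h => nz (or_intror h)).
    exists (m + Z.abs_nat k)%nat => j [<-|hj]; apply/In_symZ.
      by have : k <> 0%Z by [move=> e; apply: nz; left]; lia.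
    by have := hm j hj; rewrite In_symZ; lia.
  pose w k := RtoC (Cmod (if p k then RtoC 0 else a k)).
  apply: (@Rle_trans _ (Re (list_sum w (symZ m)))); first exact: Cmod_list_sum_incl.
  rewrite list_sum_symZ.
  have F0 i : 0 <= F i by apply: Rle_trans (h1 i); exact: Cmod_ge_0.
  pose ff i := (w (Z.of_nat i.+1) + w (- Z.of_nat i.+1)%Z)%C;
    change (Re (Csum ff m) <= 2 * (eps / 8)).
  have w0 z : (Z.abs z <= Z.of_nat n)%Z -> w z = RtoC 0.
    by rewrite /w /p => /Z.leb_le ->; rewrite Cmod_0.
  have cw z : Re (w z) <= Cmod (a z).
    rewrite /w /=; case: (p z); [rewrite Cmod_0; exact: Cmod_ge_0|lra].
  have b k : (k <= n)%nat -> Re (Csum ff k) = 0.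
    elim: k => [|k IH] hk //.
    transitivity (Re (Csum ff k) + Re (ff k)); first by [].
    by rewrite IH 1?ltnW // /ff !w0 /=; [ring|lia|lia].
  have b2 k : Re (Csum ff (n + k)) <= 2 * (Rsum F (n + k) - Rsum F n).
    elim: k => [|k IH]; first by rewrite addn0 b // Rminus_diag; lra.
    rewrite addnS; set i := (n + k)%nat in IH *.
    have -> : Re (Csum ff i.+1) = Re (Csum ff i) + (Re (w (Z.of_nat i.+1)) + Re (w (- Z.of_nat
      i.+1)%Z)) by [].
    have -> : Rsum F i.+1 = Rsum F i + F i by [].
    have := cw (Z.of_nat i.+1); have := cw (- Z.of_nat i.+1)%Z; have := h1 i; have := h2 i; lra.
  have [hmn|hmn] := leqP m n; first by rewrite b //; lra.
  have := b2 (m - n)%nat; rewrite subnKC; last by lia.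
  have h3 : Rsum F m <= Series F.
    have hm0 := Series_tail_le F F m ltac:(move=> k; rewrite Rabs_pos_eq; [lra|exact: F0]) hF.
    by have := Rabs_pos (Series F - Rsum F m); lra.
  have := hN0 n ltac:(rewrite /n; lia); have := Rle_abs (Series F - Rsum F n); lra.
have -> : (s + t - l)%C = ((s - l) + t)%C by ring.
apply: Rle_lt_trans (Cmod_triangle _ _) _; lra.
Qed.

(** * The Fourier series of the fluctuation *)

Lemma uniform_series_tail (u : nat -> R -> R) (a : nat -> R) (eps : R) :
  (forall k x, Rabs (u k x) <= a k) -> ex_series a -> 0 < eps ->
  exists N, forall n x, (N <= n)%nat ->
    Rabs (Series (fun k => u k x) - Rsum (fun k => u k x) n) < eps.
Proof.
move=> ua ha e0; have [N hN] := Series_tail_small a eps ha e0.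
exists N => n x hn; apply: Rle_lt_trans (hN n hn).
by apply: Rle_trans (Rle_abs _); apply: Series_tail_le.
Qed.

Lemma continuous_Rsum (u : nat -> R -> R) (n : nat) (x : R) :
  (forall k x, continuous (u k) x) -> continuous (fun x => Rsum (fun k => u k x) n) x.
Proof.
move=> uc; elim: n => [|n IH] /=; first exact: continuous_const.
by apply: (@continuous_plus _ R_AbsRing R_NormedModule).
Qed.

Lemma continuous_uniform_series (u : nat -> R -> R) (a : nat -> R) (x : R) :
  (forall k x, Rabs (u k x) <= a k) -> ex_series a -> (forall k x, continuous (u k) x) ->
  continuous (fun x => Series (fun k => u k x)) x.
Proof.
move=> ua ha uc; apply/filterlim_locally => eps; have e0 := cond_pos eps.
have [N hN] := uniform_series_tail u a (eps / 3) ua ha ltac:(lra).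
have e3 : 0 < eps / 3 by lra.
have /filterlim_locally /(_ (mkposreal _ e3)) [d hd] := continuous_Rsum u N x uc.
exists d => y hy; have := hd y hy; have := hN N x (leqnn N); have := hN N y (leqnn N).
rewrite /ball /= /AbsRing_ball /abs /minus /plus /opp /=.
set s := Rsum _ N; set t := Rsum _ N; set Sy := Series _; set Sx := Series _ => h1 h2 h3.
have -> : Sy + - Sx = (Sy - s) + ((s + - t) - (Sx - t)) by ring.
apply: Rle_lt_trans (Rabs_triang _ _) _.
have := Rabs_triang (s + - t) (- (Sx - t)).
rewrite Rabs_Ropp /Rminus in h1 h2 h3 *; lra.
Qed.

(** The integrals of the partial sums are assumed equal to l from index N on, which is what
    orthogonality provides; uniform convergence carries this value to the series. *)
Lemma is_RInt_uniform_series (u : nat -> R -> R) (a : nat -> R) (w : R -> R) (l : R) (N : nat) :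
  (forall k x, Rabs (u k x) <= a k) -> ex_series a -> (forall k x, continuous (u k) x) ->
  (forall x, continuous w x) -> (forall x, Rabs (w x) <= 1) ->
  (forall n, (N <= n)%nat -> is_RInt (fun x => Rsum (fun k => u k x) n * w x) 0 1 l) ->
  is_RInt (fun x => Series (fun k => u k x) * w x) 0 1 l.
Proof.
move=> ua ha uc wc wb hl; pose T x := Series (fun k => u k x).
have Tc x : continuous (fun x => T x * w x) x.
  by apply: (@continuous_mult _ R_AbsRing) => //; exact: continuous_uniform_series ua ha uc.
have hT := RInt_correct _ _ _ (ex_RInt_cont _ 0 1 Tc).
suff -> : l = RInt (fun x => T x * w x) 0 1 by [].
apply: cond_eq => eps e0.
have [N' hN'] := uniform_series_tail u a (eps / 2) ua ha ltac:(lra).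
pose n := (N + N')%nat.
have h := is_RInt_minus _ _ _ _ _ _ (hl n ltac:(rewrite /n; lia)) hT.
have hb : forall x, 0 <= x <= 1 ->
    Rabs (minus (Rsum (fun k => u k x) n * w x) (T x * w x)) <= eps / 2.
  move=> x _; rewrite /minus /plus /opp /=; set s := Rsum _ n.
  have -> : s * w x + - (T x * w x) = - ((T x - s) * w x) by ring.
  rewrite Rabs_Ropp Rabs_mult; have := hN' n x ltac:(rewrite /n; lia); have := wb x.
  have := Rabs_pos (w x); have := Rabs_pos (T x - s); rewrite -/(T x) -/s; nra.
have := @norm_RInt_le_const R_NormedModule _ 0 1 _ _ Rle_0_1 hb h.
rewrite /norm /= /abs /minus /plus /opp /= /Rminus; lra.
Qed.

(** The sum of the terms of index k and -k in the complex Fourier series of a real function. *)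
Definition harmonic (f : R -> R) (k : nat) (x : R) : R :=
  2 * (fcos f k * cosZ (Z.of_nat k) x + fsin f k * sinZ (Z.of_nat k) x).

Lemma continuous_harmonic (f : R -> R) (k : nat) (x : R) : continuous (harmonic f k) x.
Proof. by apply: (@ex_derive_continuous); rewrite /harmonic /cosZ /sinZ; auto_derive. Qed.

Lemma Rabs_harmonic (f : R -> R) (k : nat) (x : R) :
  Rabs (harmonic f k x) <= 2 * (Rabs (fcos f k) + Rabs (fsin f k)).
Proof.
rewrite /harmonic Rabs_mult (Rabs_pos_eq 2); last by lra.
apply: Rmult_le_compat_l; first by lra.
apply: Rle_trans (Rabs_triang _ _) _; rewrite !Rabs_mult.
have := Rabs_cosZ (Z.of_nat k) x; have := Rabs_sinZ (Z.of_nat k) x.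
have := Rabs_pos (fcos f k); have := Rabs_pos (fsin f k); nra.
Qed.

Lemma is_RInt_harmonic_cos (f : R -> R) (j k : nat) :
  is_RInt (fun x => harmonic f j.+1 x * cosZ (Z.of_nat k) x) 0 1 (if j.+1 == k then fcos f k else
    0).
Proof.
have hs := is_RInt_scal _ _ _ (2 * fsin f j.+1) _ (is_RInt_sin_cos (Z.of_nat j.+1) (Z.of_nat k)).
have [e|ne] := eqVneq j.+1 k.
  rewrite -e in hs *; have h := is_RInt_lin _ _ (2 * fcos f j.+1) _ _ _ _ hs (is_RInt_cos2
    (Z.of_nat j.+1) ltac:(lia)).
  rewrite (_ : fcos f j.+1 = scal (2 * fsin f j.+1) 0 + 2 * fcos f j.+1 * / 2 :> R); last first.
    by rewrite /scal /= /mult /=; field.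
  by apply: is_RInt_ext h => x _; rewrite /harmonic /scal; cbn -[Z.of_nat]; rewrite /mult;
    cbn -[Z.of_nat]; ring.
have h := is_RInt_lin _ _ (2 * fcos f j.+1) _ _ _ _ hs (is_RInt_cos_cos (Z.of_nat j.+1) (Z.of_nat
  k) ltac:(lia) ltac:(lia)).
rewrite [X in is_RInt _ _ _ X](_ : 0 = scal (2 * fsin f j.+1) 0 + 2 * fcos f j.+1 * 0 :> R);
  last first.
  by rewrite /scal /= /mult /=; ring.
by apply: is_RInt_ext h => x _; rewrite /harmonic /scal; cbn -[Z.of_nat]; rewrite /mult;
  cbn -[Z.of_nat]; ring.
Qed.

Lemma is_RInt_harmonic_sin (f : R -> R) (j k : nat) :
  is_RInt (fun x => harmonic f j.+1 x * sinZ (Z.of_nat k) x) 0 1 (if j.+1 == k then fsin f k else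
    0).
Proof.
have hs := is_RInt_scal _ _ _ (2 * fcos f j.+1) _ (is_RInt_sin_cos (Z.of_nat k) (Z.of_nat j.+1)).
have [e|ne] := eqVneq j.+1 k.
  rewrite -e in hs *; have h := is_RInt_lin _ _ (2 * fsin f j.+1) _ _ _ _ hs (is_RInt_sin2
    (Z.of_nat j.+1) ltac:(lia)).
  rewrite (_ : fsin f j.+1 = scal (2 * fcos f j.+1) 0 + 2 * fsin f j.+1 * / 2 :> R); last first.
    by rewrite /scal /= /mult /=; field.
  by apply: is_RInt_ext h => x _; rewrite /harmonic /scal; cbn -[Z.of_nat]; rewrite /mult;
    cbn -[Z.of_nat]; ring.
have h := is_RInt_lin _ _ (2 * fsin f j.+1) _ _ _ _ hs (is_RInt_sin_sin (Z.of_nat j.+1) (Z.of_nat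
  k) ltac:(lia) ltac:(lia)).
rewrite [X in is_RInt _ _ _ X](_ : 0 = scal (2 * fcos f j.+1) 0 + 2 * fsin f j.+1 * 0 :> R);
  last first.
  by rewrite /scal /= /mult /=; ring.
by apply: is_RInt_ext h => x _; rewrite /harmonic /scal; cbn -[Z.of_nat]; rewrite /mult;
  cbn -[Z.of_nat]; ring.
Qed.

Lemma is_RInt_Rsum_mult (u : nat -> R -> R) (w : R -> R) (c : nat -> R) (n : nat) :
  (forall k, is_RInt (fun x => u k x * w x) 0 1 (c k)) ->
  is_RInt (fun x => Rsum (fun k => u k x) n * w x) 0 1 (Rsum c n).
Proof.
move=> h; elim: n => [|n IH] /=.
  have := @is_RInt_const R_NormedModule 0 1 0; rewrite scal_zero_r.
  by apply: is_RInt_ext => x _; rewrite Rmult_0_l.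
have h' := is_RInt_lin _ _ 1 _ _ _ _ IH (h n); rewrite Rmult_1_l in h'.
by apply: is_RInt_ext h' => x _; cbn; ring.
Qed.

Lemma Rsum_delta (v : R) (k n : nat) :
  Rsum (fun j => if j.+1 == k then v else 0) n = if (0 < k <= n)%nat then v else 0.
Proof.
elim: n => [|n IH] /=; first by case: k.
rewrite IH; have [<-|ne] := eqVneq n.+1 k; first by rewrite ltnn andbF leqnn /=; lra.
by rewrite (leq_eqVlt k n.+1) eq_sym (negbTE ne) /= ltnS; lra.
Qed.

(** The harmonics converge uniformly, by [bernstein], to a continuous T with the coefficients of f
    except at 0. Then f - A0 - T has only zero coefficients and vanishes by [fourier_coefs_zero]. *)
Lemma fourier_series (f : R -> R) (M : R) :
  (forall x, continuous f x) -> (forall x, f (x + 1) = f x) ->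
  (forall x y j, Rabs (x - y) <= / 3 ^ j -> Rabs (f x - f y) <= M * (5 / 12) ^ j) ->
  forall x, is_series (fun k => harmonic f k.+1 x) (f x - fcos f 0).
Proof.
move=> fc fp fm x; set A0 := fcos f 0.
pose u k y := harmonic f k.+1 y.
pose a k := 2 * (Rabs (fcos f k.+1) + Rabs (fsin f k.+1)).
have ua k y : Rabs (u k y) <= a k by exact: Rabs_harmonic.
have ha : ex_series a.
  apply: (@ex_series_scal R_AbsRing R_NormedModule 2).
  by apply/(ex_series_incr_1 (fun k => Rabs (fcos f k) + Rabs (fsin f k))); exact: bernstein fm.
have uc k y : continuous (u k) y by exact: continuous_harmonic.
pose T y := Series (fun k => u k y).
have Tc y : continuous T y by exact: (continuous_uniform_series u a y ua ha uc).
have Tp y : T (y + 1) = T y.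
  by apply: Series_ext => k; rewrite /u /harmonic cosZ_add1 sinZ_add1.
have TA k : fcos T k = if (0 < k)%nat then fcos f k else 0.
  apply: is_RInt_unique; apply: (is_RInt_uniform_series u a _ _ k ua ha uc).
  - by move=> y; exact: continuous_cosZ.
  - by move=> y; exact: Rabs_cosZ.
  move=> n hn; have h := is_RInt_Rsum_mult _ _ _ n (fun j => is_RInt_harmonic_cos f j k).
  by rewrite Rsum_delta hn andbT in h.
have TB k : fsin T k = if (0 < k)%nat then fsin f k else 0.
  apply: is_RInt_unique; apply: (is_RInt_uniform_series u a _ _ k ua ha uc).
  - by move=> y; exact: continuous_sinZ.
  - by move=> y; exact: Rabs_sinZ.
  move=> n hn; have h := is_RInt_Rsum_mult _ _ _ n (fun j => is_RInt_harmonic_sin f j k).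
  by rewrite Rsum_delta hn andbT in h.
have one_c (y : R) : continuous (fun _ : R => 1) y by exact: continuous_const.
have oneA k : fcos (fun=> 1) k = if (0 < k)%nat then 0 else 1.
  apply: is_RInt_unique; apply: (is_RInt_ext (cosZ (Z.of_nat k))) => [y _|];
    first by rewrite Rmult_1_l.
  case: k => [|k]; last by apply: is_RInt_cosZ; lia.
  have := @is_RInt_const R_NormedModule 0 1 1; rewrite /scal /= /mult /= Rmult_1_r Rminus_0_r.
  by apply: is_RInt_ext => y _; rewrite cosZ_0.
have oneB k : fsin (fun=> 1) k = 0.
  apply: is_RInt_unique; apply: (is_RInt_ext (sinZ (Z.of_nat k))) => [y _|];
    first by rewrite Rmult_1_l.
  exact: is_RInt_sinZ.
have B0 : fsin f 0 = 0.
  rewrite /fsin (RInt_ext _ (fun=> 0)); first by rewrite RInt_const /scal /= /mult /=; ring.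
  by move=> y _; rewrite sinZ_0 Rmult_0_r.
have c1 := continuous_lin _ _ (- A0) fc one_c.
have z : f x + - A0 * 1 + -1 * T x = 0.
  apply: (fourier_coefs_zero (fun y => f y + - A0 * 1 + -1 * T y)) => [y|y|k|k].
  - exact: (continuous_lin _ _ (-1) c1 Tc).
  - by rewrite fp Tp.
  - by rewrite (fcos_lin _ _ (-1)) // (fcos_lin _ _ (- A0)) // TA oneA; case: k => [|k] /=;
    rewrite -/A0; ring.
  - by rewrite (fsin_lin _ _ (-1)) // (fsin_lin _ _ (- A0)) // TB oneB; case: k => [|k] /=;
    rewrite ?B0; ring.
have -> : f x - A0 = T x by lra.
by apply: Series_correct; apply: ex_series_le ha => k; exact: ua.
Qed.

Lemma fourier_charE (k : Z) (x : R) : fourier_char k x = (cosZ k x, sinZ k x).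
Proof.
rewrite /fourier_char /Cexp /cosZ /sinZ; set t := 2 * IZR k * PI * x; rewrite /=.
rewrite !(Rmult_0_r, Rmult_0_l, Rmult_1_r, Rplus_0_r, Rminus_0_r) exp_0 !Rmult_1_l.
by congr (_, _).
Qed.

Lemma Cmod_fourier_char (k : Z) (x : R) : Cmod (fourier_char k x) = 1.
Proof.
rewrite fourier_charE /Cmod /= -[RHS]sqrt_1; congr sqrt.
by have := sin2_cos2 (2 * IZR k * PI * x); rewrite /Rsqr /cosZ /sinZ; lra.
Qed.

Lemma cosZ_opp (k : Z) (x : R) : cosZ (- k) x = cosZ k x.
Proof. by rewrite /cosZ opp_IZR -[RHS]cos_neg; congr cos; ring. Qed.

Lemma sinZ_opp (k : Z) (x : R) : sinZ (- k) x = - sinZ k x.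
Proof. by rewrite /sinZ opp_IZR -sin_neg; congr sin; ring. Qed.

Lemma coef_pos (zeta : C -> C) (n : nat) : is_riemann_zeta zeta ->
  coef zeta (Z.of_nat n.+1) = (fcos pwave n.+1, - fsin pwave n.+1).
Proof.
move=> hz; have [h1 h2] := coef_pwave zeta (Z.of_nat n.+1) hz ltac:(lia).
apply: injective_projections => /=; symmetry; first exact: is_RInt_unique h1.
apply: Ropp_eq_reg; rewrite Ropp_involutive; apply: is_RInt_unique.
by apply: is_RInt_ext (is_RInt_opp _ _ _ _ h2) => x _; rewrite /opp /= /sinZ; ring.
Qed.

Lemma coef_neg (zeta : C -> C) (n : nat) : is_riemann_zeta zeta ->
  coef zeta (- Z.of_nat n.+1) = (fcos pwave n.+1, fsin pwave n.+1).
Proof.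
move=> hz; have [h1 h2] := coef_pwave zeta (- Z.of_nat n.+1) hz ltac:(lia).
apply: injective_projections => /=; symmetry.
  by apply: is_RInt_unique; apply: is_RInt_ext h1 => x _; rewrite -/(cosZ _ x) cosZ_opp.
apply: is_RInt_unique; apply: is_RInt_ext h2 => x _.
by rewrite -/(sinZ _ x) sinZ_opp Ropp_involutive.
Qed.

End Analysis.

Theorem theorem3 (zeta : C -> C) (hzeta : is_riemann_zeta zeta) :
  exists Phi : R -> C,
    (forall x : R,
       is_sum_nonzeroZ (fun k : Z => (coef zeta k * fourier_char k x)%C) (Phi x)) /\
    (forall x : R, Phi (x + 1)%R = Phi x) /\
    (forall x : R, continuous Phi x) /\
    (forall k : Z, k <> 0%Z -> is_fourier_coef Phi k (coef zeta k)) /\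
    (forall N : nat, (0 < N)%nat ->
       RtoC (INR (logn 3 (asm_number N))) =
       (RtoC (INR N * (log3 2 - 1 / 2))%R + RtoC (INR N) * Phi (log3 (INR N)))%C).
Proof.
(* Removing the mean of [pwave] leaves a function without constant term, and turns the - 1/2 of
   [logn_asm_pwave] into log3 2 - 1/2. *)
pose f x := (pwave x - log3 2)%R.
have pper x : pwave (x + 1)%R = pwave x := pwave_addZ x 1.
exists (fun x => RtoC (f x)); split; last split; last split; last split.
- move=> x; pose F k := (Rabs (fcos pwave k.+1) + Rabs (fsin pwave k.+1))%R.
  have mean : fcos pwave 0 = log3 2.
    apply: is_RInt_unique; apply: is_RInt_ext is_RInt_pwave_mean => y _.
    by rewrite cosZ_0 Rmult_1_r.
  apply: (is_sum_nonzeroZ_pairs _ F) => [n|n||].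
  + rewrite Cmod_mult Cmod_fourier_char Rmult_1_r coef_pos //.
    by apply: Rle_trans (Cmod_le_Rabs _) _; rewrite /F /= Rabs_Ropp; exact: Rle_refl.
  + rewrite Cmod_mult Cmod_fourier_char Rmult_1_r coef_neg //.
    exact: Cmod_le_Rabs.
  + apply/(ex_series_incr_1 (fun k => (Rabs (fcos pwave k) + Rabs (fsin pwave k))%R)).
    exact: (bernstein pwave 2916 continuous_pwave pper pwave_modulus_geom).
  have hs := fourier_series pwave 2916 continuous_pwave pper pwave_modulus_geom x.
  rewrite mean -/(f x) in hs.
  (* The terms of index k and -k are conjugate, so each pair is real and equals one harmonic. *)
  have e n : Csum (fun n => (coef zeta (Z.of_nat n.+1) * fourier_char (Z.of_nat n.+1) x +
      coef zeta (- Z.of_nat n.+1) * fourier_char (- Z.of_nat n.+1) x)%C) n =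
      RtoC (Rsum (fun k => harmonic pwave k.+1 x) n).
    elim: n => [|n IH] //; cbn [Csum Rsum]; rewrite IH coef_pos // coef_neg // !fourier_charE.
    rewrite cosZ_opp sinZ_opp /harmonic.
    by apply: injective_projections; cbn -[Z.of_nat]; ring.
  apply: is_clim_ext (fun n => esym (e n)) _; split; last exact: is_lim_seq_const.
  apply/is_lim_seq_incr_1; apply: (is_lim_seq_ext _ _ _ _ (_ : is_lim_seq _ _)); last exact: hs.
  by elim=> [|n IH]; [rewrite sum_O /=; ring|rewrite sum_Sn IH].
- by move=> x; rewrite /f pper.
- move=> x; apply/filterlim_locally => eps.
  have /filterlim_locally /(_ eps) := continuous_pwave x.
  apply: filter_imp => y hy; split; last exact: ball_center.
  have -> : (fst (RtoC (f y))) = plus (pwave y) (- log3 2)%R by [].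
  move: hy; rewrite /ball /= /AbsRing_ball /abs /minus /plus /opp /f /=.
  by rewrite (_ : (pwave y + - log3 2 + - (pwave x - log3 2))%R = (pwave y + - pwave x)%R) //; ring.
- move=> k k0; have [h1 h2] := coef_pwave zeta k hzeta k0.
  apply: is_RInt_C.
    have h := is_RInt_lin _ _ (- log3 2) _ _ _ _ h1 (is_RInt_cosZ k k0).
    rewrite Rmult_0_r Rplus_0_r in h.
    by apply: is_RInt_ext h => x _; rewrite fourier_charE cosZ_opp /f /= /cosZ; ring.
  have h := is_RInt_lin _ _ (log3 2) _ _ _ _ h2 (is_RInt_sinZ k).
  rewrite Rmult_0_r Rplus_0_r in h.
  by apply: is_RInt_ext h => x _; rewrite fourier_charE sinZ_opp /f /= /sinZ; ring.
- move=> N N0; rewrite logn_asm_pwave // -RtoC_mult -RtoC_plus; congr RtoC.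
  by rewrite /f; ring.
Qed.
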